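(* There is an absolute constant $C_0>0$ such that the following holds. Assume: (a) $d\le n$ and $\eta_1 := C_0\sigma_x^2\sqrt{d/n}<\tfrac12$; (b) $r_d(\Sigma)/n\le C_1$ for a constant $C_1>0$; (c) for some constant $0<\delta_1<1$, $\dfrac{\Vert\theta^*_{(d+1):p}\Vert^2_{\Sigma_{(d+1):p}}}{\Vert\theta^*_{1:d}\Vert^2_{\Sigma_{1:d}^{-1}}}\le \dfrac{\delta_1}{4(1+\sigma_x^2)}\lambda_{d+1}^2$. Let $A_0$ be a constant with $A_0\ge1$ and $(1+A_0)^2<4\delta_1^{-1}$. Assume further that $\sigma^2\asymp1$, $\Vert\theta^*_{1:d}\Vert^2_{\Sigma_{1:d}^{-1}}\lambda_d^2\asymp1$, $r_d(\Sigma)\asymp n$, $\lambda_d\gtrsim\lambda_{d+1}\sqrt{\frac{n}{r_d(\Sigma^2)}}$, $\lambda_d\gg\lambda_{d+1}$, and $64\frac{\sqrt{\delta_1}}{1-\sqrt{\delta_1}}<1$. Then: (i) with a probability approaching 1, $$\mathrm{MSE}^*_{\mathrm{out}}\asymp\max\Big\{\frac{\lambda_{d+1}}{\lambda_d}\sqrt{\frac{r_d(\Sigma^2)}{n}},\ \frac dn\Big\},$$ and this order is attained by $\mathrm{MSE}_{\mathrm{out}}$ with the choice $$\tau=\sqrt{\lambda_d\lambda_{d+1}\sqrt{\tfrac{r_d(\Sigma^2)}{n}}}\ \min\Big\{\sqrt{cA_0^{-2}},\ \frac{A_0\lambda_d}{\sqrt{\lambda_d\lambda_{d+1}\sqrt{r_d(\Sigma^2)/n}}}\Big\},$$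 where $c$ is a constant satisfying $\lambda_{d+1}\sqrt{\frac{n}{r_d(\Sigma^2)}}\le c\lambda_d$; (ii) with a probability approaching 1, $$\mathrm{MSE}^*_{\mathrm{in}}\asymp\max\Big\{\frac{\lambda_{d+1}}{\lambda_d},\ \frac dn\Big\},$$ and this order is attained by $\mathrm{MSE}_{\mathrm{in}}$ with the choice $\tau\asymp\sqrt{\lambda_{d+1}\lambda_d}$. Therefore $\mathrm{MSE}^*_{\mathrm{out}}\lesssim\mathrm{MSE}^*_{\mathrm{in}}$ with a probability approaching 1.
   Context: Model. Let $1\le d<p$ be integers. The data $(y_1,x_1),\dots,(y_n,x_n)$ are i.i.d. from $y_i=x_i^\top\theta^*+\epsilon_i$, where $\theta^*\in\mathbb R^p$, $x_i\in\mathbb R^p$ is random with $E(x_i)=0$, $\mathrm{Var}(x_i)=\Sigma$ non-singular, and $\epsilon_i\in\mathbb R$ is independent of $x_i$ with $E(\epsilon_i)=0$, $\mathrm{Var}(\epsilon_i)=\sigma^2$. Throughout, $\Sigma=\mathrm{Diag}(\lambda_1,\dots,\lambda_p)$ with $\lambda_1\ge\dots\ge\lambda_p>0$. The vector $\Sigma^{-1/2}x_i$ is sub-gaussian with sub-gaussian norm $\sigma_x$, where a real random variable $z$ has norm $\Vert z\Vert_{\psi_2}=\inf\{t>0: E\exp(z^2/t^2)\le 2\}$ and a random vector $Z$ has norm $\sup_{s\ne 0}\Vert\langle s,Z\rangle/\Vert s\Vert\,\Vert_{\psi_2}$. $Y=(y_1,\dots,y_n)^\top$, $X=(x_1,\dots,x_n)^\top$,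 $\hat\Sigma=X^\top X/n$. For $\tau>0$ the ridge estimator is $\hat\theta(\tau)=X^\top(XX^\top+n\tau I_n)^{-1}Y$ (minimizer of $\frac1n\Vert Y-X\theta\Vert^2+\tau\Vert\theta\Vert^2$), and $\hat\theta(0)=\lim_{\tau\to0+}\hat\theta(\tau)$. $\Vert b\Vert_M=(b^\top Mb)^{1/2}$. $\mathrm{MSE}_{\mathrm{out}}=E[\Vert\hat\theta(\tau)-\theta^*\Vert_\Sigma^2\mid X]$ and $\mathrm{MSE}_{\mathrm{in}}=E[\Vert\hat\theta(\tau)-\theta^*\Vert_{\hat\Sigma}^2\mid X]$. $\mathrm{MSE}^*_{\mathrm{out}}$ (resp. $\mathrm{MSE}^*_{\mathrm{in}}$) denotes $\mathrm{MSE}_{\mathrm{out}}$ (resp. $\mathrm{MSE}_{\mathrm{in}}$) with an optimal choice of $\tau\ge0$, i.e. its infimum over $\tau\ge0$. $\theta^*_{1:d}$, $\theta^*_{(d+1):p}$ are the first $d$ and last $p-d$ entries of $\theta^*$; $\Sigma_{1:d}=\mathrm{Diag}(\lambda_1,\dots,\lambda_d)$, $\Sigma_{(d+1):p}=\mathrm{Diag}(\lambda_{d+1},\dots,\lambda_p)$; $r_d(\Sigma)=\frac{\sum_{j>d}\lambda_j}{\lambda_{d+1}}$, $r_d(\Sigma^2)=\frac{\sum_{j>d}\lambda_j^2}{\lambda_{d+1}^2}$. Asymptotics. One considers a sequence of such models indexed by $n\to\infty$; $p,d,\Sigma,\theta^*,\sigma^2,\tau$ may depend on $n$, while $\sigma_x,C_1,\delta_1,A_0$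 are fixed. For positive sequences, $a_n\lesssim b_n$ (equivalently $b_n\gtrsim a_n$) means $a_n\le c\,b_n$ for all large $n$ for some constant $c>0$; $a_n\asymp b_n$ means both $a_n\lesssim b_n$ and $b_n\lesssim a_n$; $a_n\gg b_n$ means $b_n/a_n\to0$. A relation $\lesssim$ or $\asymp$ involving random quantities holds ''with a probability approaching 1'' if, for suitable constants, the corresponding inequalities hold on events of probability tending to 1 as $n\to\infty$. *)

(* Defs.v *)
From HB Require Import structures.
From mathcomp Require Import all_boot all_order all_algebra.
From mathcomp Require Import all_classical all_reals all_analysis.
Set Implicit Arguments.
Unset Strict Implicit.
Unset Printing Implicit Defensive.
Import Order.TTheory GRing.Theory Num.Theory.
Import numFieldNormedType.Exports.
Local Open Scope classical_set_scope.
Local Open Scope ring_scope.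

(* ||b||_M = (b^T M b)^(1/2) *)
Definition normM (R : realType) (p : nat) (M : 'M[R]_p) (b : 'cV[R]_p) : R :=
  Num.sqrt ((b^T *m M *m b) 0 0).

(* The eigenvalues lambda_1, lambda_2, ... and the entries theta_1, theta_2, ...
   are kept as functions nat -> R with 1-based indices; only the values at
   1, ..., p matter. [vseg a m f] is the vector (f (a+1), ..., f (a+m)) and
   [dseg a m f] is Diag(f (a+1), ..., f (a+m)), so that theta_{1:d} is
   [vseg 0 d theta] and theta_{(d+1):p} is [vseg d (p - d) theta]. *)
Definition vseg (R : realType) (a m : nat) (f : nat -> R) : 'cV[R]_m :=
  \col_(i < m) f (a + i).+1.

Definition dseg (R : realType) (a m : nat) (f : nat -> R) : 'M[R]_m :=
  diag_mx (\row_(i < m) f (a + i).+1).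

(* r_d(Diag(f_1, ..., f_p)) = (\sum_(j > d) f_j) / f_(d+1) *)
Definition eff_rank (R : realType) (d p : nat) (f : nat -> R) : R :=
  (\sum_(d.+1 <= j < p.+1) f j) / f d.+1.

(* The product (that is, Borel) sigma-algebra on matrices, generated by the
   entries. *)
Definition mx_measurable (R : realType) (m k : nat) : set (set 'M[R]_(m, k)) :=
  <<s [set A | exists i j (B : set R),
         measurable B /\ A = [set M : 'M[R]_(m, k) | B (M i j)]] >>.

Definition random_mx (R : realType) (disp : measure_display)
    (T : measurableType disp) (m k : nat) (Z : T -> 'M[R]_(m, k)) : Prop :=
  forall i j, measurable_fun [set: T] (fun w => Z w i j).

Definition sigma_mx (R : realType) (T : Type) (m k : nat)
    (Z : T -> 'M[R]_(m, k)) : set (set T) :=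
  preimage_set_system [set: T] Z (@mx_measurable R m k).

(* The product rule for subfamilies is the case B i = setT outside of the
   subfamily. *)
Definition mutually_independent (R : realType) (disp : measure_display)
    (T : measurableType disp) (P : probability T R) (n m k : nat)
    (Z : 'I_n -> T -> 'M[R]_(m, k)) : Prop :=
  forall B : 'I_n -> set 'M[R]_(m, k), (forall i, mx_measurable (B i)) ->
    P [set w | forall i, B i (Z i w)] =
    (\prod_(i < n) P (Z i @^-1` B i))%E.

Definition identically_distributed (R : realType) (disp : measure_display)
    (T : measurableType disp) (P : probability T R) (n m k : nat)
    (Z : 'I_n -> T -> 'M[R]_(m, k)) : Prop :=
  forall (i j : 'I_n) (B : set 'M[R]_(m, k)), mx_measurable B ->
    P (Z i @^-1` B) = P (Z j @^-1` B).

Definition independent2 (R : realType) (disp : measure_display)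
    (T : measurableType disp) (P : probability T R) (m k m' k' : nat)
    (U : T -> 'M[R]_(m, k)) (V : T -> 'M[R]_(m', k')) : Prop :=
  forall B C, mx_measurable B -> mx_measurable C ->
    P (U @^-1` B `&` V @^-1` C) = (P (U @^-1` B) * P (V @^-1` C))%E.

Definition psi2_norm (R : realType) (disp : measure_display)
    (T : measurableType disp) (P : probability T R) (z : T -> R) : \bar R :=
  ereal_inf [set t%:E | t in
    [set t : R | 0 < t /\
       ('E_P[fun w => expR (z w ^+ 2 / t ^+ 2)] <= 2%:E)%E]].

Definition psi2_norm_vec (R : realType) (disp : measure_display)
    (T : measurableType disp) (P : probability T R) (p : nat)
    (Z : T -> 'cV[R]_p) : \bar R :=
  ereal_sup [set psi2_norm P (fun w => (s^T *m Z w) 0 0 / normM 1%:M s) |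
    s in [set s : 'cV[R]_p | s != 0]].

Definition response (R : realType) (n p : nat) (X : 'M[R]_(n, p))
    (theta : nat -> R) (eps : 'cV[R]_n) : 'cV[R]_n :=
  X *m vseg 0 p theta + eps.

(* The rows of X w are the x_i^T. *)
Record regression_model (R : realType) (disp : measure_display)
    (T : measurableType disp) (P : probability T R) (n d p : nat)
    (lam theta : nat -> R) (sigma sigma_x : R)
    (X : T -> 'M[R]_(n, p)) (eps : T -> 'cV[R]_n) : Prop := RegressionModel {
  rm_dim : (1 <= d < p)%N ;
  rm_lam_mono : forall j k, (1 <= j)%N -> (j <= k)%N -> (k <= p)%N ->
    lam k <= lam j ;
  rm_lam_gt0 : forall j, (1 <= j)%N -> (j <= p)%N -> 0 < lam j ;
  rm_X_meas : random_mx X ;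
  rm_eps_meas : random_mx eps ;
  rm_indep : mutually_independent P (fun (i : 'I_n) w =>
    row_mx (row i (response (X w) theta (eps w))) (row i (X w))) ;
  rm_ident : identically_distributed P (fun (i : 'I_n) w =>
    row_mx (row i (response (X w) theta (eps w))) (row i (X w))) ;
  rm_noise_indep : forall i : 'I_n,
    independent2 P (fun w => row i (X w)) (fun w => row i (eps w)) ;
  rm_X_mean : forall i j, ('E_P[fun w => X w i j] = 0)%E ;
  rm_X_var : forall i j k,
    covariance P (fun w => X w i j) (fun w => X w i k) =
    (dseg 0 p lam j k)%:E ;
  rm_eps_mean : forall i, ('E_P[fun w => eps w i ord0] = 0)%E ;
  rm_eps_var : forall i, ('V_P[fun w => eps w i ord0])%E = (sigma ^+ 2)%:E ;
  rm_subgaussian : forall i : 'I_n,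
    psi2_norm_vec P (fun w =>
      dseg 0 p (fun j => (Num.sqrt (lam j))^-1) *m (row i (X w))^T) =
    sigma_x%:E }.

Definition ridge_pos (R : realType) (n p : nat) (X : 'M[R]_(n, p))
    (Y : 'cV[R]_n) (tau : R) : 'cV[R]_p :=
  X^T *m invmx (X *m X^T + (n%:R * tau)%:M) *m Y.

Definition ridge (R : realType) (n p : nat) (X : 'M[R]_(n, p))
    (Y : 'cV[R]_n) (tau : R) : 'cV[R]_p :=
  if 0 < tau then ridge_pos X Y tau
  else lim (ridge_pos X Y t @[t --> (0 : R)^'+]).

(* W is a finite version of E[Z | G], for Z >= 0 (not necessarily
   integrable) and G a sub-sigma-algebra. *)
Definition cond_expectation (R : realType) (disp : measure_display)
    (T : measurableType disp) (P : probability T R) (G : set (set T))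
    (Z W : T -> R) : Prop :=
  (forall B : set R, measurable B -> G (W @^-1` B)) /\
  (forall A, G A ->
    (\int[P]_(w in A) (W w)%:E = \int[P]_(w in A) (Z w)%:E)%E).

(* M tau w is E[ ||thetahat(tau) - theta||_S^2 | X ](w). A conditional
   expectation is determined only up to a null set depending on tau, so the
   infimum over the uncountable set tau >= 0 is meaningful only for a version
   that is regular in tau: since tau |-> thetahat(tau) is continuous on
   [0, +oo[, the version is taken almost surely continuous there, which
   determines it up to a single null set. *)
Definition is_MSE (R : realType) (disp : measure_display)
    (T : measurableType disp) (P : probability T R) (n p : nat)
    (S : T -> 'M[R]_p) (theta : nat -> R)
    (X : T -> 'M[R]_(n, p)) (eps : T -> 'cV[R]_n) (M : R -> T -> R) : Prop :=
  (forall tau, 0 <= tau ->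
     cond_expectation P (sigma_mx X)
       (fun w => normM (S w)
          (ridge (X w) (response (X w) theta (eps w)) tau
           - vseg 0 p theta) ^+ 2)
       (M tau)) /\
  {ae P, forall w, {within `[0, +oo[, continuous (fun tau : R => M tau w)}}.

Definition is_MSE_out (R : realType) (disp : measure_display)
    (T : measurableType disp) (P : probability T R) (n p : nat)
    (lam theta : nat -> R)
    (X : T -> 'M[R]_(n, p)) (eps : T -> 'cV[R]_n) (M : R -> T -> R) : Prop :=
  is_MSE P (fun=> dseg 0 p lam) theta X eps M.

Definition is_MSE_in (R : realType) (disp : measure_display)
    (T : measurableType disp) (P : probability T R) (n p : nat)
    (theta : nat -> R)
    (X : T -> 'M[R]_(n, p)) (eps : T -> 'cV[R]_n) (M : R -> T -> R) : Prop :=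
  is_MSE P (fun w => n%:R^-1 *: ((X w)^T *m X w)) theta X eps M.

Definition optimal (R : realType) (T : Type) (M : R -> T -> R) (w : T) : R :=
  inf [set M tau w | tau in [set tau : R | 0 <= tau]].

Definition lesssim (R : realType) (a b : nat -> R) : Prop :=
  exists2 c : R, 0 < c & \forall n \near \oo, a n <= c * b n.

Definition asymp (R : realType) (a b : nat -> R) : Prop :=
  lesssim a b /\ lesssim b a.

Definition dominates (R : realType) (a b : nat -> R) : Prop :=
  (b n / a n) @[n --> \oo] --> (0 : R).

(* "With a probability approaching 1"; the sequence of models may live on
   varying probability spaces. *)
Definition lesssim_prob (R : realType) (disp : nat -> measure_display)
    (T : forall n, measurableType (disp n))
    (P : forall n, probability (T n) R) (a b : forall n, T n -> R) : Prop :=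
  exists2 c : R, 0 < c &
    exists E : forall n, set (T n),
      [/\ forall n, measurable (E n),
          P n (E n) @[n --> \oo] --> 1%E &
          \forall n \near \oo, forall w, E n w -> a n w <= c * b n w].

Definition asymp_prob (R : realType) (disp : nat -> measure_display)
    (T : forall n, measurableType (disp n))
    (P : forall n, probability (T n) R) (a b : forall n, T n -> R) : Prop :=
  lesssim_prob P a b /\ lesssim_prob P b a.

(* Main.v *)
Require Import Defs.
From HB Require Import structures.
From mathcomp Require Import all_boot all_order all_algebra.
From mathcomp Require Import all_classical all_reals all_analysis.
From mathcomp Require Import measurable_realfun ring lra.

(** Given X, the error of the ridge estimator splits into a squared bias and
    sigma^2 times a variance, both explicit in the ridge matrix X X^T + n tau.
    On the event where the first d whitened columns are nearly isometric, the
    remaining columns have squared operator norm O(n lambda_(d+1)) and a few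
    Frobenius norms are close to their means, deterministic linear algebra
    bounds both parts from both sides: up to constants, with x = tau / lambda_d,
    rho = lambda_(d+1) / lambda_d and e^2 = r_d(Sigma^2) / n, the bias is of
    order x^2 for small x, the head variance of order d / n, and the tail
    variance of order (rho e / x)^2 out of sample and (rho / x)^2 in sample.
    Balancing bias and tail variance gives x^2 = rho e, resp. x^2 = rho.

    The event has probability 1 - O(1 / n). Frobenius norms of Z D concentrate
    by Chernoff's method over the independent rows; a net handles the head, and
    the operator norm of the tail is handled by cutting its coordinates into
    blocks of length n and averaging the exponential moments of the blocks.

    A conditional expectation is only determined for each fixed tau up to a null
    set, so the lower bound is transferred to the given version first for
    rational tau and then, by continuity, for all tau >= 0. *)

(** No matrix is diagonalised. Spectral facts are replaced by Frobenius and operator norm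
    inequalities: upper bounds come from normal equations, lower bounds from Cauchy-Schwarz against
    a well-chosen test vector. The head and tail columns of the design are not orthogonal, and this
    interaction is the obstacle; it is paid for by the rank [d] of the head, a loss of order d / n,
    and that term belongs to the rates anyway.

    The infimum over tau shapes the rest. The good event does not mention tau, so one event serves
    all tau > 0 at once, while tau = 0, where the estimator is a limit, is reached only through
    continuity. All constants of the regime are absorbed into one number [K], and the lower bounds
    are polynomial in it.

    The tail dimension p - d is not bounded in terms of n, so a net of its unit ball would have too
    many points for a union bound at scale n. A block of n coordinates has a net of at most 2^(18 n)
    points, which a deviation of order n compensates. The head makes the same bargain with d in
    place of n, and this fixes the constant 300. *)

Set Implicit Arguments.
Unset Strict Implicit.
Unset Printing Implicit Defensive.
Import Order.TTheory GRing.Theory Num.Theory.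
Import numFieldNormedType.Exports.
Local Open Scope ring_scope.

(** * Frobenius inner product *)

Section Frobenius.
Variable R : realType.

Definition mdot m k (A B : 'M[R]_(m, k)) : R := \sum_i \sum_j A i j * B i j.
Definition fro m k (A : 'M[R]_(m, k)) : R := mdot A A.
Definition nF m k (A : 'M[R]_(m, k)) : R := Num.sqrt (fro A).

Lemma mdotC m k (A B : 'M[R]_(m, k)) : mdot A B = mdot B A.
Proof.
by apply: eq_bigr => i _; apply: eq_bigr => j _; rewrite mulrC.
Qed.

Lemma mdotDl m k (A B C : 'M[R]_(m, k)) :
  mdot (A + B) C = mdot A C + mdot B C.
Proof.
rewrite -big_split; apply: eq_bigr => i _ /=.
by rewrite -big_split; apply: eq_bigr => j _; rewrite mxE mulrDl.
Qed.

Lemma mdotZl m k a (A B : 'M[R]_(m, k)) : mdot (a *: A) B = a * mdot A B.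
Proof.
rewrite mulr_sumr; apply: eq_bigr => i _ /=.
by rewrite mulr_sumr; apply: eq_bigr => j _; rewrite mxE mulrA.
Qed.

Lemma mdotDr m k (A B C : 'M[R]_(m, k)) :
  mdot A (B + C) = mdot A B + mdot A C.
Proof. by rewrite mdotC mdotDl !(mdotC A). Qed.

Lemma mdotZr m k a (A B : 'M[R]_(m, k)) : mdot A (a *: B) = a * mdot A B.
Proof. by rewrite mdotC mdotZl mdotC. Qed.

Lemma mdotNl m k (A B : 'M[R]_(m, k)) : mdot (- A) B = - mdot A B.
Proof. by rewrite -scaleN1r mdotZl mulN1r. Qed.

Lemma mdotNr m k (A B : 'M[R]_(m, k)) : mdot A (- B) = - mdot A B.
Proof. by rewrite mdotC mdotNl mdotC. Qed.

Lemma mdot_tr m k (A B : 'M[R]_(m, k)) : mdot A B = \tr (A^T *m B).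
Proof.
rewrite /mdot exchange_big; apply: eq_bigr => j _ /=.
by rewrite mxE; apply: eq_bigr => i _; rewrite mxE.
Qed.

Lemma mdot_mull m k h (M : 'M[R]_(m, h)) (A : 'M[R]_(h, k)) B :
  mdot (M *m A) B = mdot A (M^T *m B).
Proof. by rewrite !mdot_tr trmx_mul mulmxA. Qed.

Lemma mdot_mulr m k h (M : 'M[R]_(m, h)) (A : 'M[R]_(h, k)) B :
  mdot B (M *m A) = mdot (M^T *m B) A.
Proof. by rewrite mdotC mdot_mull mdotC. Qed.

Lemma mdot_trmx m k (A B : 'M[R]_(m, k)) : mdot A^T B^T = mdot A B.
Proof.
rewrite /mdot exchange_big; apply: eq_bigr => i _.
by apply: eq_bigr => j _; rewrite !mxE.
Qed.

Lemma fro_tr m k (A : 'M[R]_(m, k)) : fro A^T = fro A.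
Proof. exact: mdot_trmx. Qed.

Lemma fro_ge0 m k (A : 'M[R]_(m, k)) : 0 <= fro A.
Proof. by apply: sumr_ge0 => i _; apply: sumr_ge0 => j _; rewrite -expr2 sqr_ge0. Qed.

Lemma fro_entry m k (A : 'M[R]_(m, k)) i j : A i j ^+ 2 <= fro A.
Proof.
rewrite /fro /mdot (bigD1 i) //= (bigD1 j) //= expr2 -addrA lerDl.
apply: addr_ge0; first by apply: sumr_ge0 => j' _; rewrite -expr2 sqr_ge0.
by apply: sumr_ge0 => i' _; apply: sumr_ge0 => j' _; rewrite -expr2 sqr_ge0.
Qed.

Lemma fro_eq0 m k (A : 'M[R]_(m, k)) : fro A = 0 -> A = 0.
Proof.
move=> A0; apply/matrixP => i j; rewrite mxE; apply/eqP.
by rewrite -sqrf_eq0 eq_le sqr_ge0 andbT -A0 fro_entry.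
Qed.

Lemma fro0 m k : fro (0 : 'M[R]_(m, k)) = 0.
Proof. by rewrite /fro -(scale0r 0) mdotZl mul0r. Qed.

Lemma froZ m k a (A : 'M[R]_(m, k)) : fro (a *: A) = a ^+ 2 * fro A.
Proof. by rewrite /fro mdotZl mdotZr mulrA expr2. Qed.

Lemma froN m k (A : 'M[R]_(m, k)) : fro (- A) = fro A.
Proof. by rewrite /fro mdotNl mdotNr opprK. Qed.

Lemma froD m k (A B : 'M[R]_(m, k)) :
  fro (A + B) = fro A + 2 * mdot A B + fro B.
Proof. by rewrite /fro mdotDl !mdotDr (mdotC B A); ring. Qed.

Lemma fro_cols m k (A : 'M[R]_(m, k)) : fro A = \sum_j fro (col j A).
Proof.
rewrite /fro /mdot exchange_big; apply: eq_bigr => j _.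
by apply: eq_bigr => i _; rewrite big_ord1 !mxE.
Qed.

Lemma fro_rows m k (A : 'M[R]_(m, k)) : fro A = \sum_i fro (row i A).
Proof.
apply: eq_bigr => i _; rewrite /fro /mdot big_ord1.
by apply: eq_bigr => j _; rewrite !mxE.
Qed.

Lemma mdot_cauchy m k (A B : 'M[R]_(m, k)) : mdot A B ^+ 2 <= fro A * fro B.
Proof.
have [/fro_eq0 ->|B0] := eqVneq (fro B) 0.
  by rewrite fro0 mulr0 -(scale0r 0) mdotZr mul0r expr0n.
have Bp : 0 < fro B by rewrite lt_def B0 fro_ge0.
have := fro_ge0 (fro B *: A - mdot A B *: B).
rewrite froD froN !froZ mdotNr mdotZl mdotZr => H.
have : 0 <= fro B * (fro A * fro B - mdot A B ^+ 2) by lra.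
by rewrite pmulr_rge0 // subr_ge0.
Qed.

Lemma nF_ge0 m k (A : 'M[R]_(m, k)) : 0 <= nF A.
Proof. exact: sqrtr_ge0. Qed.

Lemma nF_sqr m k (A : 'M[R]_(m, k)) : nF A ^+ 2 = fro A.
Proof. by rewrite sqr_sqrtr // fro_ge0. Qed.

Lemma mdot_le m k (A B : 'M[R]_(m, k)) : mdot A B <= nF A * nF B.
Proof.
rewrite (le_trans (ler_norm _)) // -sqrtr_sqr -sqrtrM ?fro_ge0 //.
by rewrite ler_sqrt ?mulr_ge0 ?fro_ge0 // mdot_cauchy.
Qed.

Lemma nFD m k (A B : 'M[R]_(m, k)) : nF (A + B) <= nF A + nF B.
Proof.
rewrite -(@ler_pXn2r _ 2) ?nnegrE ?addr_ge0 ?nF_ge0 //.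
by rewrite nF_sqr froD sqrrD !nF_sqr; have := mdot_le A B; lra.
Qed.

Lemma nFN m k (A : 'M[R]_(m, k)) : nF (- A) = nF A.
Proof. by rewrite /nF froN. Qed.

Lemma nFZ m k a (A : 'M[R]_(m, k)) : nF (a *: A) = `|a| * nF A.
Proof. by rewrite /nF froZ sqrtrM ?sqr_ge0 // sqrtr_sqr. Qed.

Lemma nF_le m k (A : 'M[R]_(m, k)) c : 0 <= c -> (nF A <= c) = (fro A <= c ^+ 2).
Proof.
by move=> c0; rewrite -nF_sqr ler_pXn2r ?nnegrE ?nF_ge0.
Qed.

Lemma froD_le2 m k (A B : 'M[R]_(m, k)) :
  fro (A + B) <= 2 * fro A + 2 * fro B.
Proof.
have := fro_ge0 (A - B); rewrite !froD mdotNr froN; lra.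
Qed.

Lemma fro_col_mx m1 m2 k (A : 'M[R]_(m1, k)) (B : 'M[R]_(m2, k)) :
  fro (col_mx A B) = fro A + fro B.
Proof.
rewrite /fro /mdot big_split_ord /=; congr (_ + _);
  by apply: eq_bigr => i _; apply: eq_bigr => j _; rewrite ?col_mxEu ?col_mxEd.
Qed.

Lemma mdot_col_mx m1 m2 k (A C : 'M[R]_(m1, k)) (B D : 'M[R]_(m2, k)) :
  mdot (col_mx A B) (col_mx C D) = mdot A C + mdot B D.
Proof.
rewrite /fro /mdot big_split_ord /=; congr (_ + _);
  by apply: eq_bigr => i _; apply: eq_bigr => j _; rewrite ?col_mxEu ?col_mxEd.
Qed.

(* The squared operator norm of [M] is at most [c]. *)
Definition opb m k (M : 'M[R]_(m, k)) (c : R) : Prop :=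
  forall v : 'cV_k, fro (M *m v) <= c * fro v.

Lemma opb_mul m k h (M : 'M[R]_(m, k)) c (A : 'M[R]_(k, h)) :
  opb M c -> fro (M *m A) <= c * fro A.
Proof.
move=> Mc; rewrite (fro_cols (M *m A)) (fro_cols A) mulr_sumr.
by apply: ler_sum => j _; rewrite !colE -mulmxA.
Qed.

(** [fro (M^T *m y)] is the pairing of [y] with [M *m (M^T *m y)], so Cauchy-Schwarz bounds its
    square by itself times [c * fro y]. *)
Lemma opb_tr m k (M : 'M[R]_(m, k)) c : 0 <= c -> opb M c -> opb M^T c.
Proof.
move=> c0 Mc y; set a := fro (M^T *m y).
have H : a ^+ 2 <= a * (c * fro y).
  rewrite {1}/a {1}/fro -mdot_mulr (le_trans (mdot_cauchy _ _)) //.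
  by rewrite mulrC mulrA ler_wpM2r ?fro_ge0 // mulrC Mc.
have [->|a0] := eqVneq a 0; first by rewrite mulr_ge0 ?fro_ge0.
by move: H; rewrite expr2 ler_pM2l // lt_def a0 fro_ge0.
Qed.

Lemma opb_nF m k (M : 'M[R]_(m, k)) c (v : 'cV_k) : 0 <= c -> opb M c ->
  nF (M *m v) <= Num.sqrt c * nF v.
Proof.
by move=> c0 Mc; rewrite -sqrtrM // ler_sqrt ?mulr_ge0 ?fro_ge0 // Mc.
Qed.

End Frobenius.

(** * The ridge inverse and the bias *)

Section RidgeInverse.
Variables (R : realType) (n p : nat) (X : 'M[R]_(n, p)) (c : R).
Hypothesis c_gt0 : 0 < c.

Definition ridge_gram : 'M[R]_n := X *m X^T + c%:M.
Let B := ridge_gram.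
Let W := invmx ridge_gram.

Lemma ridge_gram_sym : B^T = B.
Proof. by rewrite /B linearD /= trmx_mul trmxK tr_scalar_mx. Qed.

Lemma mdot_ridge_gram (y : 'cV_n) :
  mdot y (B *m y) = fro (X^T *m y) + c * fro y.
Proof.
by rewrite /B mulmxDl mdotDr -mulmxA mdot_mulr mul_scalar_mx mdotZr.
Qed.

(** Coercivity, [c * fro y <= mdot y (B *m y)], with one factor [nF y] cancelled. Both the
    invertibility of the ridge matrix and the bound on its inverse follow from it. *)
Lemma ridge_gram_ge (y : 'cV_n) : c * nF y <= nF (B *m y).
Proof.
have [/eqP y0|y0] := eqVneq (nF y) 0.
  by rewrite (eqP y0) mulr0 nF_ge0.
have yp : 0 < nF y by rewrite lt_def y0 nF_ge0.
rewrite -(ler_pM2l yp) (le_trans _ (mdot_le _ _)) // mdot_ridge_gram.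
by rewrite mulrCA -expr2 nF_sqr lerDr fro_ge0.
Qed.

Lemma ridge_gram_unit : B \in unitmx.
Proof.
rewrite -row_free_unit; apply: inj_row_free => v vB.
have := ridge_gram_ge v^T.
have -> : B *m v^T = 0 by rewrite -ridge_gram_sym -trmx_mul vB trmx0.
rewrite {2}/nF fro0 sqrtr0 pmulr_rle0 // => v0.
have : fro v^T = 0.
  by rewrite -nF_sqr; apply/eqP; rewrite sqrf_eq0 eq_le v0 nF_ge0.
by move/fro_eq0 => /(congr1 trmx); rewrite trmxK trmx0.
Qed.

Lemma ridge_gramK : B *m W = 1%:M.
Proof. by rewrite mulmxV // ridge_gram_unit. Qed.

Lemma ridge_gramVK : W *m B = 1%:M.
Proof. by rewrite mulVmx // ridge_gram_unit. Qed.

Lemma ridge_inv_sym : W^T = W.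
Proof. by rewrite /W trmx_inv ridge_gram_sym. Qed.

Lemma ridge_inv_le (s : 'cV_n) : c * nF (W *m s) <= nF s.
Proof.
by rewrite (le_trans (ridge_gram_ge _)) // mulmxA ridge_gramK mul1mx.
Qed.

(** A source of variance lower bounds: a test vector [y] correlated with [s] but with a small image
    [B *m y] forces [W *m s] to be large. *)
Lemma ridge_inv_dual (s y : 'cV_n) :
  mdot s y <= nF (W *m s) * nF (B *m y).
Proof.
have -> : mdot s y = mdot (W *m s) (B *m y).
  by rewrite mdot_mull ridge_inv_sym mulmxA ridge_gramVK mul1mx.
exact: mdot_le.
Qed.

(* [th - E(estimator | X)]; its normal equations below replace the explicit inverse. *)
Definition ridge_bias (th : 'cV_p) : 'cV_p := th - X^T *m W *m X *m th.

(** Stationarity of ||X b||^2 + c ||b - th||^2, whose minimiser is the bias. The bias bounds below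
    use nothing else about it. *)
Lemma ridge_bias_normal (th : 'cV_p) :
  X^T *m (X *m ridge_bias th) + c *: ridge_bias th = c *: th.
Proof.
rewrite /ridge_bias scalerBr addrCA -[RHS]addr0; congr (_ + _).
apply/eqP; rewrite subr_eq0; apply/eqP.
(* Push-through: the hat matrix differs from the identity by [c *: W]. *)
have H : X *m (X^T *m W) = 1%:M - c *: W.
  rewrite -ridge_gramK /B /ridge_gram mulmxDl mul_scalar_mx.
  by rewrite addrK mulmxA.
have -> : X *m (th - X^T *m W *m X *m th) = c *: (W *m (X *m th)).
  have -> : X^T *m W *m X *m th = (X^T *m W) *m (X *m th) by rewrite !mulmxA.
  rewrite mulmxBr (mulmxA X (X^T *m W)) H mulmxBl mul1mx opprB addrCA subrr addr0.
  by rewrite scalemxAl.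
by rewrite -scalemxAr !mulmxA.
Qed.

End RidgeInverse.

(** * Head and tail of the bias *)

Section Bias.
Variables (R : realType) (n d q : nat).
Variables (Z1 : 'M[R]_(n, d)) (s : 'rV[R]_d) (X2 : 'M[R]_(n, q)).
Variables (sN tau K l g zeta0 : R) (b1 th1 : 'cV[R]_d) (b2 th2 : 'cV[R]_q).
Let S := diag_mx s.
Let Si := diag_mx (\row_j (s ord0 j)^-1).
Let X1 := Z1 *m S.
Let r := X1 *m b1 + X2 *m b2.
Let zeta := X2 *m th2.
Let c := sN ^+ 2 * tau.
Let beta := nF (S *m b1).
Let t := nF (Si *m th1).
Hypothesis sN_gt0 : 0 < sN.
Hypothesis tau_gt0 : 0 < tau.
Hypothesis g_gt0 : 0 < g.
Hypothesis l_ge0 : 0 <= l.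
Hypothesis K_ge0 : 0 <= K.
Hypothesis s_gt0 : forall j, 0 < s ord0 j.
Hypothesis s_ge : forall j, g <= s ord0 j ^+ 2.
Hypothesis Z1_le : opb Z1 (2 * sN ^+ 2).
Hypothesis Z1_ge : forall v : 'cV_d, sN ^+ 2 * fro v <= 2 * fro (Z1 *m v).
Hypothesis X2_le : opb X2 (K * sN ^+ 2 * l).
Hypothesis zeta0_ge0 : 0 <= zeta0.
Hypothesis zeta_le : nF zeta <= sN * zeta0.
Hypothesis normal1 : X1^T *m r + c *: b1 = c *: th1.
Hypothesis normal2 : X2^T *m r + c *: b2 = c *: th2.

Let sN_ge0 := ltW sN_gt0.
Let tau_ge0 := ltW tau_gt0.
Let g_ge0 := ltW g_gt0.
Let c_gt0 : 0 < c. Proof. by rewrite mulr_gt0 ?exprn_gt0. Qed.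

Lemma diag_invK : Si *m S = 1%:M.
Proof.
rewrite mulmx_diag -diag_const_mx; congr diag_mx.
by apply/rowP => j; rewrite !mxE mulVf // gt_eqF.
Qed.

Lemma Z1_nF k (v : 'M[R]_(d, k)) : nF (Z1 *m v) <= 2 * sN * nF v.
Proof.
rewrite nF_le ?mulr_ge0 ?nF_ge0 // (le_trans (opb_mul _ Z1_le)) //.
rewrite !exprMn nF_sqr ler_wpM2r ?fro_ge0 //.
by rewrite ler_wpM2r ?sqr_ge0 // expr2; lra.
Qed.

Lemma Z1t_nF k (v : 'M[R]_(n, k)) : nF (Z1^T *m v) <= 2 * sN * nF v.
Proof.
have H : opb Z1^T (2 * sN ^+ 2) by apply: opb_tr; rewrite ?mulr_ge0 ?sqr_ge0.
rewrite nF_le ?mulr_ge0 ?nF_ge0 // (le_trans (opb_mul _ H)) //.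
rewrite !exprMn nF_sqr ler_wpM2r ?fro_ge0 //.
by rewrite ler_wpM2r ?sqr_ge0 // expr2; lra.
Qed.

Lemma Z1_nF_ge (v : 'cV_d) : sN * nF v <= 2 * nF (Z1 *m v).
Proof.
rewrite -(@ler_pXn2r _ 2) ?nnegrE ?mulr_ge0 ?nF_ge0 // !exprMn !nF_sqr.
by have := Z1_ge v; have := fro_ge0 (Z1 *m v); lra.
Qed.

Lemma X2X2t_nF (y : 'cV_n) : nF (X2 *m (X2^T *m y)) <= K * sN ^+ 2 * l * nF y.
Proof.
have k0 : 0 <= K * sN ^+ 2 * l by rewrite !mulr_ge0 ?sqr_ge0.
rewrite (le_trans (opb_nF _ k0 X2_le)) //.
have -> : K * sN ^+ 2 * l * nF y = Num.sqrt (K * sN ^+ 2 * l) *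
    (Num.sqrt (K * sN ^+ 2 * l) * nF y).
  by rewrite mulrA -expr2 sqr_sqrtr.
rewrite ler_wpM2l ?sqrtr_ge0 //.
exact: (opb_nF _ k0 (opb_tr k0 X2_le)).
Qed.

Lemma Si_nF (v : 'cV_d) : g * nF (Si *m v) <= nF (S *m v).
Proof.
rewrite -(@ler_pXn2r _ 2) ?nnegrE ?mulr_ge0 ?nF_ge0 // exprMn !nF_sqr.
rewrite /fro /mdot mulr_sumr; apply: ler_sum => i _; rewrite !big_ord1.
rewrite /Si /S !mul_diag_mx !mxE.
have si := s_gt0 i; have gi := s_ge i.
set a := s ord0 i in si gi *; set x := v i ord0.
have -> : a * x * (a * x) = (a ^+ 2) ^+ 2 * (a^-1 * x * (a^-1 * x)).
  by field; rewrite gt_eqF.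
rewrite ler_wpM2r -?expr2 ?sqr_ge0 // ler_pXn2r ?nnegrE ?sqr_ge0 //; exact: ltW.
Qed.

(** The tail normal equation reads c (b2 - th2) = - X2^T r, so the feedback of the tail on the
    residual is at most K l / tau times the residual. *)
Lemma X2h_nF : tau * nF (X2 *m (b2 - th2)) <= K * l * nF r.
Proof.
have E : c *: (X2 *m (b2 - th2)) = - (X2 *m (X2^T *m r)).
  rewrite scalemxAr -mulmxN; congr (_ *m _).
  by rewrite scalerBr -normal2 opprD addrCA subrr addr0.
have := X2X2t_nF r; rewrite -nFN -E nFZ gtr0_norm // /c => H.
by rewrite -(@ler_pM2l _ (sN ^+ 2)) ?exprn_gt0 //; lra.
Qed.

Lemma X2b_nF : nF (X2 *m b2) <= sN * zeta0 + nF (X2 *m (b2 - th2)).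
Proof.
have -> : X2 *m b2 = zeta + X2 *m (b2 - th2).
  by rewrite mulmxBr addrCA subrr addr0.
by rewrite (le_trans (nFD _ _)) // lerD2r.
Qed.

Lemma bias_head_le : sN * beta <= 2 * nF (X1 *m b1).
Proof. by rewrite (le_trans (Z1_nF_ge _)) // mulmxA. Qed.

(** The head normal equation, divided by the head scales, splits the signal [Si *m th1]: what is no
    longer in the bias [b1] must show up in the residual [r]. *)
Lemma bias_signal : sN * tau * t * g <= 2 * g * nF r + sN * tau * beta.
Proof.
have E : c *: (Si *m th1) = Z1^T *m r + c *: (Si *m b1).
  rewrite scalemxAr -normal1 mulmxDr -scalemxAr; congr (_ + _).
  by rewrite /X1 trmx_mul tr_diag_mx !mulmxA diag_invK mul1mx.
have := nFD (Z1^T *m r) (c *: (Si *m b1)).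
rewrite -E !nFZ gtr0_norm // -/t => H.
have H1 := Z1t_nF r; have H2 := Si_nF b1; rewrite -/beta in H2.
have H3 : c * t * g <= 2 * sN * nF r * g + c * beta.
  apply: (@le_trans _ _ ((2 * sN * nF r + c * nF (Si *m b1)) * g)).
    by rewrite ler_wpM2r ?(ltW g_gt0) //; lra.
  by rewrite mulrDl lerD2l -mulrA ler_pM2l // mulrC.
rewrite /c in H3; rewrite -(ler_pM2l sN_gt0); rewrite expr2 in H3; lra.
Qed.

(** In sample the bias is the residual [r] itself, so [beta] is eliminated from [bias_signal]; half
    of the head signal absorbs the tail signal [zeta0]. *)
Lemma bias_in_lower : 4 * zeta0 <= t * g ->
  sN * tau * (t * g) <= 4 * (g + tau + K * l) * nF r.
Proof.
move=> z4; have H1 := bias_signal; have H2 := bias_head_le.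
have H3 := X2h_nF; have H4 := X2b_nF.
have H5 : nF (X1 *m b1) <= nF r + nF (X2 *m b2).
  have -> : X1 *m b1 = r - X2 *m b2 by rewrite addrK.
  by rewrite (le_trans (nFD _ _)) // nFN.
have H6 : tau * (sN * beta) <= 2 * (tau * nF r + tau * (sN * zeta0) + K * l * nF r).
  apply: (@le_trans _ _ (tau * (2 * (nF r + sN * zeta0 + nF (X2 *m (b2 - th2)))))).
    by rewrite ler_pM2l //; lra.
  lra.
have H7 : sN * tau * (4 * zeta0) <= sN * tau * (t * g) by rewrite ler_pM2l ?mulr_gt0.
lra.
Qed.

(** Out of sample the bias is seen through [beta], so here [r] is eliminated; [2 * K * l <= tau]
    makes the tail feedback at most half of [r]. *)
Lemma bias_out_lower : 2 * K * l <= tau -> 8 * g * zeta0 <= tau * (t * g) ->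
  tau * (t * g) <= 2 * (8 * g + tau) * beta.
Proof.
move=> tl z8; have H1 := bias_signal.
have H3 := X2h_nF; have H4 := X2b_nF.
have H5 : nF r <= nF (X1 *m b1) + nF (X2 *m b2) by rewrite nFD.
have H2 : nF (X1 *m b1) <= 2 * sN * beta by rewrite /X1 -mulmxA Z1_nF.
have H6 : 2 * nF (X2 *m (b2 - th2)) <= nF r.
  rewrite -(ler_pM2l tau_gt0); have := nF_ge0 r => r0.
  have : 2 * K * l * nF r <= tau * nF r by rewrite ler_wpM2r.
  lra.
have H7 : g * nF r <= g * (4 * sN * beta + 2 * sN * zeta0).
  by rewrite ler_pM2l //; lra.
have H8 : sN * (8 * g * zeta0) <= sN * (tau * (t * g)) by rewrite ler_pM2l.
rewrite -(ler_pM2l sN_gt0); lra.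
Qed.

Let h2 := b2 - th2.
Let F := X1 *m b1 + X2 *m h2.
(** The ridge quadratic form at the bias with the tail signal [th2] subtracted. After this shift the
    only sources are [c *: th1] and [X2 *m th2]; [th2] itself, of which no unweighted norm is
    controlled, disappears. *)
Definition bias_energy : R := fro F + c * (fro b1 + fro h2).

Lemma bias_energyE : bias_energy = c * mdot th1 b1 - mdot F zeta.
Proof.
have E1 : mdot (X1^T *m r) b1 + c * fro b1 = c * mdot th1 b1.
  by rewrite -!mdotZl -mdotDl normal1.
have E2 : mdot (X2^T *m r) h2 + c * fro h2 = 0.
  rewrite -mdotZl -mdotDl.
  have -> : X2^T *m r + c *: h2 = 0.
    by rewrite scalerBr addrA normal2 subrr.
  by rewrite -(scale0r 0) mdotZl mul0r.
have E3 : r = F + zeta.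
  by rewrite /F -addrA -mulmxDr subrK.
have E4 : mdot (X1^T *m r) b1 + mdot (X2^T *m r) h2 = fro F + mdot F zeta.
  rewrite !mdot_mull !trmxK -mdotDr -/F {1}E3 mdotDl.
  by rewrite (mdotC zeta).
rewrite /bias_energy; lra.
Qed.

(** The energy identity bounds the energy by its square root times known quantities, because [beta]
    is controlled by that square root; one factor then cancels. [kap] measures the tail operator
    norm against tau. *)
Lemma bias_energy_le kap : 0 <= kap -> K * l <= kap ^+ 2 * tau ->
  Num.sqrt bias_energy <= sN * (2 * tau * t * (1 + kap) + zeta0) /\
  sN * beta <= 2 * (1 + kap) * Num.sqrt bias_energy.
Proof.
move=> kap0 klt; set e := Num.sqrt _.
have E0 : 0 <= bias_energy.
  by rewrite /bias_energy addr_ge0 ?fro_ge0 // mulr_ge0 ?(ltW c_gt0) ?addr_ge0 ?fro_ge0.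
have e0 : 0 <= e by rewrite sqrtr_ge0.
have e2 : e ^+ 2 = bias_energy by rewrite sqr_sqrtr.
have Fe : nF F <= e.
  rewrite ler_sqrt // /bias_energy lerDl mulr_ge0 ?(ltW c_gt0) ?addr_ge0 ?fro_ge0 //.
have X2e : nF (X2 *m h2) <= kap * e.
  rewrite nF_le ?mulr_ge0 // (le_trans (X2_le h2)) // exprMn e2.
  apply: (@le_trans _ _ (kap ^+ 2 * (c * fro h2))).
    rewrite [leRHS]mulrA; apply: ler_wpM2r; rewrite ?fro_ge0 // /c.
    have : sN ^+ 2 * (K * l) <= sN ^+ 2 * (kap ^+ 2 * tau) by rewrite ler_wpM2l ?sqr_ge0.
    lra.
  rewrite ler_wpM2l ?sqr_ge0 // /bias_energy mulrDr addrA lerDr.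
  by rewrite addr_ge0 ?fro_ge0 // mulr_ge0 ?(ltW c_gt0) ?fro_ge0.
have be : sN * beta <= 2 * (1 + kap) * e.
  have H1 := bias_head_le.
  have H5 : nF (X1 *m b1) <= nF F + nF (X2 *m h2).
    have -> : X1 *m b1 = F - X2 *m h2 by rewrite addrK.
    by rewrite (le_trans (nFD _ _)) // nFN.
  lra.
split=> //.
have H1 : mdot th1 b1 <= t * beta.
  have -> : mdot th1 b1 = mdot (Si *m th1) (S *m b1).
    by rewrite mdot_mull tr_diag_mx mulmxA diag_invK mul1mx.
  exact: mdot_le.
have H2 : - mdot F zeta <= e * (sN * zeta0).
  rewrite -mdotNl (le_trans (mdot_le _ _)) // nFN.
  by rewrite ler_pM ?nF_ge0.
have [->|en0] := eqVneq e 0.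
  rewrite mulr_ge0 ?addr_ge0 ?mulr_ge0 ?nF_ge0 ?(ltW tau_gt0) ?(ltW sN_gt0) //; lra.
have ep : 0 < e by rewrite lt_def en0.
rewrite -(ler_pM2l ep) -expr2 e2 bias_energyE.
have H3 : c * mdot th1 b1 <= sN * tau * t * (sN * beta).
  apply: (@le_trans _ _ (c * (t * beta))); first by rewrite ler_pM2l.
  by rewrite /c le_eqVlt; apply/orP; left; apply/eqP; ring.
have H4 : sN * tau * t * (sN * beta) <= sN * tau * t * (2 * (1 + kap) * e).
  by rewrite ler_wpM2l // !mulr_ge0 ?nF_ge0 ?ltW.
lra.
Qed.

End Bias.

(** * Bounds on the variance *)

Lemma ord_sum_const (R : pzRingType) d (x : R) : d%:R * x = \sum_(i < d) x.
Proof. by rewrite sumr_const card_ord mulr_natl. Qed.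

Section Variance.
Variables (R : realType) (n d q : nat).
Variables (Z1 : 'M[R]_(n, d)) (s : 'rV[R]_d) (X2 : 'M[R]_(n, q)) (s2 : 'rV[R]_q).
Variables (sN tau K l g : R).
Let S := diag_mx s.
Let S2 := diag_mx s2.
Let X1 := Z1 *m S.
Let X := row_mx X1 X2.
Let c := sN ^+ 2 * tau.
Let B := ridge_gram X c.
Let W := invmx (ridge_gram X c).
Let a := sN ^+ 2 * (K * l + tau).
Hypothesis sN_gt0 : 0 < sN.
Hypothesis tau_gt0 : 0 < tau.
Hypothesis g_gt0 : 0 < g.
Hypothesis l_ge0 : 0 <= l.
Hypothesis K_ge0 : 0 <= K.
Hypothesis s_gt0 : forall j, 0 < s ord0 j.
Hypothesis s_ge : forall j, g <= s ord0 j ^+ 2.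
Hypothesis s2_le : forall k, s2 ord0 k ^+ 2 <= l.
Hypothesis Z1_le : opb Z1 (2 * sN ^+ 2).
Hypothesis Z1_ge : forall v : 'cV_d, sN ^+ 2 * fro v <= 2 * fro (Z1 *m v).
Hypothesis X2_le : opb X2 (K * sN ^+ 2 * l).

Let sN_ge0 := ltW sN_gt0.
Let tau_ge0 := ltW tau_gt0.
Let g_ge0 := ltW g_gt0.
Let c_gt0 : 0 < c. Proof. by rewrite mulr_gt0 ?exprn_gt0. Qed.
Let c_ge0 := ltW c_gt0.
Let a_gt0 : 0 < a.
Proof. by rewrite mulr_gt0 ?exprn_gt0 // ltr_wpDl ?mulr_ge0. Qed.
Let a_ge0 := ltW a_gt0.

Let tailB k (y : 'M[R]_(n, k)) := X2 *m (X2^T *m y) + c *: y.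

Lemma gram_split k (y : 'M[R]_(n, k)) : B *m y = X1 *m (X1^T *m y) + tailB y.
Proof.
rewrite /B /ridge_gram /X tr_row_mx mul_row_col !mulmxDl -!mulmxA.
by rewrite mul_scalar_mx addrA.
Qed.

Lemma tailB_nF (y : 'cV_n) : nF (tailB y) <= a * nF y.
Proof.
rewrite (le_trans (nFD _ _)) // nFZ gtr0_norm //.
have := X2X2t_nF sN_gt0 l_ge0 K_ge0 X2_le y.
by rewrite /a /c; lra.
Qed.

Lemma Z1_gram_unit : Z1^T *m Z1 \in unitmx.
Proof.
rewrite -row_free_unit; apply: inj_row_free => v vG.
have := Z1_ge v^T.
have -> : fro (Z1 *m v^T) = 0.
  rewrite /fro mdot_mull mulmxA.
  have -> : Z1^T *m Z1 *m v^T = 0.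
    by apply: trmx_inj; rewrite trmx_mul trmxK trmx_mul trmxK vG trmx0.
  by rewrite -(scale0r 0) mdotZr mul0r.
rewrite mulr0 pmulr_rle0 ?exprn_gt0 // fro_tr => v0.
by apply: fro_eq0; apply/eqP; rewrite eq_le v0 fro_ge0.
Qed.

(* The columns [y_j] of the dual basis satisfy [<y_j, z_i> = 1] if [i = j] and [0]
   otherwise, so testing the ridge inverse against [y_j] isolates coordinate [j]. *)
Definition dual_basis : 'M[R]_(n, d) := Z1 *m invmx (Z1^T *m Z1).
Let Y := dual_basis.

Lemma dual_basisK : Z1^T *m Y = 1%:M.
Proof. by rewrite /Y /dual_basis mulmxA mulmxV // Z1_gram_unit. Qed.

(** [Y *m v] is [Z1 *m u] with Z1^T Z1 u = v, so its squared norm is the pairing of [u] and [v], and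
    the lower isometry bound controls [u]. *)
Lemma dual_basis_nF (v : 'cV_d) : sN * nF (Y *m v) <= 2 * nF v.
Proof.
rewrite /Y /dual_basis -mulmxA; set u := invmx _ *m v.
have uv : Z1^T *m (Z1 *m u) = v.
  by rewrite /u mulmxA mulmxA mulmxV ?mul1mx // Z1_gram_unit.
have [->|u0] := eqVneq (nF (Z1 *m u)) 0; first by rewrite mulr0 mulr_ge0 ?nF_ge0.
have up : 0 < nF (Z1 *m u) by rewrite lt_def u0 nF_ge0.
rewrite -(ler_pM2l up) mulrCA -expr2 nF_sqr /fro mdot_mull uv.
have H1 := mdot_le u v; have H2 := Z1_nF_ge sN_gt0 Z1_ge u.
apply: (@le_trans _ _ (sN * nF u * nF v)); first by rewrite -mulrA ler_pM2l.
by rewrite mulrCA mulrA ler_wpM2r ?nF_ge0.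
Qed.

(** The orthogonal projection onto the span of the head columns. *)
Definition head_proj : 'M[R]_n := Y *m Z1^T.
Let P := head_proj.
(* [Q] kills the head columns, so that [B] acts on its range through the tail only. *)
Let Q := 1%:M - head_proj.

Lemma head_proj_sym : P^T = P.
Proof.
rewrite /P /head_proj /Y /dual_basis !trmx_mul trmxK trmx_inv trmx_mul trmxK.
by rewrite mulmxA.
Qed.

Lemma head_proj_idem : P *m P = P.
Proof.
by rewrite /P /head_proj mulmxA -(mulmxA Y) dual_basisK mulmx1.
Qed.

Lemma fro_head_proj : fro P = d%:R.
Proof.
rewrite /fro mdot_tr head_proj_sym head_proj_idem /P /head_proj mxtrace_mulC.
by rewrite dual_basisK mxtrace1.
Qed.

Lemma fro_cohead k (y : 'M[R]_(n, k)) : fro (Q *m y) = fro y - fro (P *m y).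
Proof.
rewrite /Q mulmxBl mul1mx froD mdotNr froN.
have -> : mdot y (P *m y) = fro (P *m y).
  by rewrite /fro mdot_mull head_proj_sym mulmxA head_proj_idem.
ring.
Qed.

Lemma mdot_cohead k (y : 'M[R]_(n, k)) : mdot y (Q *m y) = fro (Q *m y).
Proof.
have QT : Q^T = Q by rewrite /Q linearB /= trmx1 head_proj_sym.
have QQ : Q *m Q = Q.
  rewrite /Q mulmxBr mulmx1 mulmxBl mul1mx -/P head_proj_idem subrr.
  by rewrite subr0.
by rewrite [RHS]/fro mdot_mull QT mulmxA QQ.
Qed.

Lemma gram_cohead k (y : 'M[R]_(n, k)) : B *m (Q *m y) = tailB (Q *m y).
Proof.
rewrite gram_split; have -> : X1^T *m (Q *m y) = 0.
  rewrite /X1 trmx_mul -mulmxA (mulmxA Z1^T) /Q mulmxBr mulmx1.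
  by rewrite /head_proj (mulmxA Z1^T) dual_basisK mul1mx subrr mul0mx mulmx0.
by rewrite mulmx0 add0r.
Qed.

(** A projection of rank [d] keeps at most [d] times the squared operator norm. This bounds what the
    head can hide of the tail and is the loss in both tail variance lower bounds. *)
Lemma fro_head_proj_tail : fro (P *m X2) <= K * sN ^+ 2 * l * d%:R.
Proof.
have k0 : 0 <= K * sN ^+ 2 * l by rewrite !mulr_ge0 ?sqr_ge0.
rewrite -fro_tr trmx_mul head_proj_sym -fro_head_proj.
by apply: opb_mul; exact: opb_tr.
Qed.

Lemma fro_mul_diag m (M : 'M[R]_(m, q)) : fro (M *m S2) <= l * fro M.
Proof.
rewrite /fro /mdot mulr_sumr; apply: ler_sum => i _.
rewrite mulr_sumr; apply: ler_sum => j _.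
rewrite mul_mx_diag !mxE mulrACA -!expr2 mulrC ler_wpM2r ?sqr_ge0 //.
Qed.

(** Test vector [Q *m x]: it pairs with [x] to its own squared norm, and the ridge matrix acts on it
    through the tail only, with norm at most [a]. *)
Lemma cohead_le (x : 'cV_n) : nF (Q *m x) <= a * nF (W *m x).
Proof.
have [->|y0] := eqVneq (nF (Q *m x)) 0; first by rewrite mulr_ge0 ?nF_ge0.
have yp : 0 < nF (Q *m x) by rewrite lt_def y0 nF_ge0.
rewrite -(ler_pM2l yp) -expr2 nF_sqr -mdot_cohead.
rewrite (le_trans (ridge_inv_dual X c_gt0 _ _)) // -/W -/B gram_cohead.
rewrite mulrC mulrCA mulrA ler_wpM2r ?nF_ge0 // tailB_nF //.
Qed.

Lemma var_tail_out_lower :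
  fro (X2 *m S2) - K * sN ^+ 2 * l ^+ 2 * d%:R <=
  a ^+ 2 * fro (W *m (X2 *m S2)).
Proof.
have H : fro (Q *m (X2 *m S2)) <= a ^+ 2 * fro (W *m (X2 *m S2)).
  rewrite (fro_cols (Q *m _)) (fro_cols (W *m _)) mulr_sumr.
  apply: ler_sum => j _; rewrite !colE -!(mulmxA _ (X2 *m S2)).
  rewrite -!nF_sqr -exprMn ler_pXn2r ?nnegrE ?(mulr_ge0 a_ge0) ?nF_ge0 //.
  exact: cohead_le.
rewrite (le_trans _ H) // fro_cohead lerD2l lerN2 mulmxA.
rewrite (le_trans (fro_mul_diag _)) //.
have := ler_wpM2l l_ge0 fro_head_proj_tail; lra.
Qed.

(** For a head column z_j the test vector is the dual vector y_j, which the ridge matrix sends to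
    s_j^2 z_j plus a tail term. This bounds |W z_j| below by the inverse of 2 sN (s_j^2 + K l +
    tau). *)
Lemma var_head_out_lower :
  d%:R * g ^+ 2 <= 4 * sN ^+ 2 * (g + K * l + tau) ^+ 2 * fro (W *m (X1 *m S)).
Proof.
rewrite (fro_cols (W *m _)) mulr_sumr.
rewrite ord_sum_const.
apply: ler_sum => j _.
have -> : 4 * sN ^+ 2 = (2 * sN) ^+ 2 by ring.
rewrite -nF_sqr -!exprMn ler_pXn2r ?nnegrE ?mulr_ge0 ?nF_ge0 ?addr_ge0 ?mulr_ge0 //.
set e := delta_mx j 0 : 'cV[R]_d.
have Se v : S *m (v *: e) = (v * s ord0 j) *: e.
  rewrite /S -scalemxAr -scalerA; congr (_ *: _).
  apply/matrixP => i i'; rewrite mul_diag_mx !mxE.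
  by case: eqP => [->|_]; rewrite ?mulr0.
have lp : 0 < s ord0 j ^+ 2 by rewrite exprn_gt0.
have -> : col j (W *m (X1 *m S)) = s ord0 j ^+ 2 *: (W *m (Z1 *m e)).
  rewrite colE -/e -(mulmxA W) -(mulmxA X1) -[in LHS](scale1r e) Se mul1r /X1.
  by rewrite -(mulmxA Z1) Se -expr2 -!scalemxAr.
rewrite nFZ gtr0_norm //.
have H1 : 1 <= nF (W *m (Z1 *m e)) * nF (B *m (Y *m e)).
  rewrite (le_trans _ (ridge_inv_dual X c_gt0 _ _)) // mdot_mull mulmxA dual_basisK.
  rewrite mul1mx le_eqVlt; apply/orP; left; apply/eqP.
  rewrite /mdot (bigD1 j) //= !big_ord1 !mxE !eqxx mulr1 big1 ?addr0 // => i ij.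
  by rewrite big_ord1 !mxE (negbTE ij) mul0r.
have e1 : nF e = 1.
  rewrite /nF /fro /mdot (bigD1 j) //= !big_ord1 !mxE !eqxx mulr1 big1 ?addr0 ?sqrtr1 // => i ij.
  by rewrite big_ord1 !mxE (negbTE ij) mul0r.
have H2 : nF (B *m (Y *m e)) <= 2 * sN * (s ord0 j ^+ 2 + K * l + tau).
  rewrite gram_split.
  have -> : X1 *m (X1^T *m (Y *m e)) = s ord0 j ^+ 2 *: (Z1 *m e).
    have -> : X1^T *m (Y *m e) = S *m e.
      rewrite /X1 trmx_mul tr_diag_mx -(mulmxA S) (mulmxA Z1^T Y) dual_basisK.
      by rewrite mul1mx.
    by rewrite -[in LHS](scale1r e) Se mul1r /X1 -(mulmxA Z1) Se -expr2 -scalemxAr.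
  rewrite (le_trans (nFD _ _)) // nFZ gtr0_norm //.
  have h1 := Z1_nF sN_gt0 Z1_le e; have h2 := dual_basis_nF e.
  have h3 := tailB_nF (Y *m e); rewrite e1 in h1 h2.
  have h4 : s ord0 j ^+ 2 * nF (Z1 *m e) <= s ord0 j ^+ 2 * (2 * sN) by rewrite ler_pM2l //; lra.
  have h5 : a * nF (Y *m e) <= sN * (K * l + tau) * 2.
    rewrite /a expr2.
    have -> : sN * sN * (K * l + tau) * nF (Y *m e) = sN * (K * l + tau) * (sN * nF (Y *m e)) by ring.
    by rewrite ler_wpM2l ?mulr_ge0 ?addr_ge0 ?mulr_ge0 //; lra.
  lra.
set w := nF (W *m _) in H1 *; have w0 : 0 <= w by exact: nF_ge0.
have H3 : 1 <= w * (2 * sN * (s ord0 j ^+ 2 + K * l + tau)).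
  by rewrite (le_trans H1) // ler_wpM2l.
have kt : 0 <= K * l + tau by rewrite addr_ge0 ?mulr_ge0.
have gs := s_ge j; set b := s ord0 j ^+ 2 in gs lp H3 *.
have H4 : g + K * l + tau <= (g + K * l + tau) * (w * (2 * sN * (b + K * l + tau))).
  by rewrite ler_peMr // -addrA addr_ge0.
(* The ratio b / (b + K l + tau) increases with b, so the lower bound [g] on the head eigenvalues is
   the worst case. *)
have H5 : g * (b + K * l + tau) <= b * (g + K * l + tau).
  have : g * (K * l + tau) <= b * (K * l + tau) by rewrite ler_wpM2r.
  lra.
have bp : 0 < b + K * l + tau by lra.
rewrite -(ler_pM2r bp) (le_trans H5) //.
have := ler_wpM2l (ltW lp) H4; lra.
Qed.

(** A bound free of the head eigenvalues. For x = W X1 S w, the defect [del] satisfies both X1 del =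
    tailB x and c |x|^2 <= |w| |S del|; combining the two, a factor [nF x] cancels. *)
Lemma head_col_upper (w : 'cV_d) :
  sN * tau * nF (W *m (X1 *m (S *m w))) <= 2 * (K * l + tau) * nF w.
Proof.
set v := S *m w; set x := W *m (X1 *m v).
have Bx : B *m x = X1 *m v by rewrite /x mulmxA ridge_gramK ?mul1mx.
set del := v - X1^T *m x.
have Ax : X1 *m del = tailB x.
  by rewrite /del mulmxBr -Bx gram_split addrC addKr.
have [->|x0] := eqVneq (nF x) 0; first by rewrite mulr0 !mulr_ge0 ?nF_ge0 ?addr_ge0 ?mulr_ge0.
have xp : 0 < nF x by rewrite lt_def x0 nF_ge0.
have H1 : sN * nF (S *m del) <= 2 * (a * nF x).
  have := Z1_nF_ge sN_gt0 Z1_ge (S *m del); rewrite mulmxA -/X1 Ax.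
  by have := tailB_nF x; lra.
have H2 : c * fro x <= nF w * nF (S *m del).
  have -> : c * fro x = mdot x (tailB x) - fro (X2^T *m x).
    by rewrite /tailB mdotDr mdot_mulr mdotZr /fro addrAC subrr add0r.
  rewrite -Ax mdot_mulr.
  have -> : X1^T *m x = v - del by rewrite /del opprB addrC subrK.
  rewrite mdotDl mdotNl -/(fro del).
  have : mdot v del <= nF w * nF (S *m del).
    by rewrite /v mdot_mull tr_diag_mx mdot_le.
  by have := fro_ge0 del; have := fro_ge0 (X2^T *m x); lra.
rewrite -(ler_pM2l xp) -(ler_pM2l (exprn_gt0 2 sN_gt0)).
have H3 : sN * (c * fro x) <= nF w * (2 * (a * nF x)).
  rewrite (le_trans (ler_wpM2l sN_ge0 H2)) // mulrCA ler_wpM2l ?nF_ge0 //.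
by move: H3; rewrite /a /c -nF_sqr; lra.
Qed.

Lemma var_head_out_upper :
  sN ^+ 2 * tau ^+ 2 * fro (W *m (X1 *m S)) <= 4 * (K * l + tau) ^+ 2 * d%:R.
Proof.
rewrite (fro_cols (W *m _)) mulr_sumr.
rewrite [_ * d%:R]mulrC ord_sum_const.
apply: ler_sum => j _; rewrite colE.
set e := delta_mx j 0 : 'cV[R]_d.
have e1 : nF e = 1.
  rewrite /nF /fro /mdot (bigD1 j) //= !big_ord1 !mxE !eqxx mulr1 big1 ?addr0 ?sqrtr1 // => i ij.
  by rewrite big_ord1 !mxE (negbTE ij) mul0r.
have := head_col_upper e; rewrite e1 mulr1 !mulmxA -nF_sqr => H.
have -> : 4 * (K * l + tau) ^+ 2 = (2 * (K * l + tau)) ^+ 2 by ring.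
rewrite -!exprMn ler_pXn2r ?nnegrE ?mulr_ge0 ?nF_ge0 ?addr_ge0 ?mulr_ge0 //.
Qed.

Lemma ridge_inv_fro k (M : 'M[R]_(n, k)) : c ^+ 2 * fro (W *m M) <= fro M.
Proof.
rewrite (fro_cols (W *m _)) (fro_cols M) mulr_sumr.
apply: ler_sum => j _; rewrite !colE -mulmxA -!nF_sqr -exprMn.
rewrite ler_pXn2r ?nnegrE ?mulr_ge0 ?nF_ge0 //; exact: ridge_inv_le.
Qed.

(** The hat matrix, which maps Y to the fitted values. The in-sample variance is its squared
    Frobenius norm times sigma^2 / n. *)
Let KW := X *m (X^T *m W).

Lemma KWE k (z : 'M[R]_(n, k)) : KW *m z = z - c *: (W *m z).
Proof.
rewrite /KW mulmxA; have -> : X *m X^T = B - c%:M by rewrite /B /ridge_gram addrK.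
by rewrite mulmxBl ridge_gramK // mul_scalar_mx mulmxBl mul1mx -scalemxAl.
Qed.

Lemma KW_sym : KW^T = W *m (X *m X^T).
Proof. by rewrite /KW !trmx_mul trmxK ridge_inv_sym -mulmxA. Qed.

(** It suffices that [KW] keeps the proportion g / (g + 2 tau) of every head column z. As <z, KW z>
    = |z|^2 - c t with t = <z, W z>, this amounts to an upper bound on t. *)
Lemma var_head_in_lower :
  d%:R * g ^+ 2 <= 4 * (g + 2 * tau) ^+ 2 * fro KW.
Proof.
have H0 : fro (KW *m Z1) <= 2 * sN ^+ 2 * fro KW.
  rewrite -fro_tr trmx_mul -(fro_tr KW); apply: opb_mul.
  by apply: opb_tr; rewrite ?mulr_ge0 ?sqr_ge0.
have s2p : 0 < 2 * sN ^+ 2 by rewrite mulr_gt0 ?exprn_gt0.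
suff H : d%:R * (sN ^+ 2 * g ^+ 2) <= 2 * (g + 2 * tau) ^+ 2 * fro (KW *m Z1).
  rewrite -(ler_pM2l (exprn_gt0 2 sN_gt0)).
  have : 2 * (g + 2 * tau) ^+ 2 * fro (KW *m Z1) <=
         2 * (g + 2 * tau) ^+ 2 * (2 * sN ^+ 2 * fro KW).
    by rewrite ler_wpM2l // mulr_ge0 ?sqr_ge0.
  lra.
rewrite (fro_cols (KW *m _)) mulr_sumr.
rewrite ord_sum_const.
apply: ler_sum => j _.
set e := delta_mx j 0 : 'cV[R]_d.
have e1 : fro e = 1.
  rewrite /fro /mdot (bigD1 j) //= !big_ord1 !mxE !eqxx mulr1 big1 ?addr0 // => i ij.
  by rewrite big_ord1 !mxE (negbTE ij) mul0r.
rewrite colE -mulmxA; set z := Z1 *m e.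
have fz : sN ^+ 2 <= 2 * fro z by have := Z1_ge e; rewrite e1; lra.
set w := W *m z; set t := mdot z w.
have zp : 0 < fro z by have := exprn_gt0 2 sN_gt0; lra.
have gs := s_ge j; have sp := s_gt0 j; set b := s ord0 j ^+ 2 in gs.
have bp : 0 < b by rewrite exprn_gt0.
(* [B *m w = z] is paired with [w], and only coordinate [j] of the head part of X^T w is kept. *)
have Ht : b * t ^+ 2 + c * fro w <= t.
  rewrite {2}/t mdotC -[X in mdot _ X](_ : B *m w = z); last first.
    by rewrite /w mulmxA ridge_gramK // mul1mx.
  rewrite mdot_ridge_gram lerD2r /X tr_row_mx mul_col_mx fro_col_mx.
  rewrite -[leLHS]addr0 lerD ?fro_ge0 // (le_trans _ (fro_entry _ j ord0)) //.
  rewrite /X1 trmx_mul tr_diag_mx -mulmxA mul_diag_mx mxE exprMn ler_pM2l // le_eqVlt.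
  apply/orP; left; apply/eqP; congr (_ ^+ 2).
  rewrite /t /z mdot_mull /mdot (bigD1 j) //= !big_ord1 [e _ _]mxE !eqxx mul1r big1 ?addr0 // => i ij.
  by rewrite big_ord1 !mxE (negbTE ij) mul0r.
have Hc := mdot_cauchy z w; rewrite -/t in Hc.
have t0 : 0 <= t.
  by rewrite (le_trans _ Ht) // addr_ge0 // mulr_ge0 ?sqr_ge0 ?fro_ge0 // ltW.
(* Cauchy-Schwarz, t^2 <= |z|^2 |w|^2, replaces |w| and leaves an inequality that is linear in t. *)
have H1 : t * (b * fro z + c) <= fro z.
  have [->|tn] := eqVneq t 0; first by rewrite mul0r ltW.
  have tp : 0 < t by rewrite lt_def tn.
  rewrite -(ler_pM2l tp).
  have : c * t ^+ 2 <= c * (fro z * fro w) by rewrite ler_pM2l.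
  have := ler_wpM2l (ltW zp) Ht; lra.
have H2 : mdot z (KW *m z) = fro z - c * t by rewrite KWE mdotDr mdotNr mdotZr.
have g2 : 0 <= g + 2 * tau by rewrite addr_ge0 ?mulr_ge0.
have H3 : fro z * g <= (g + 2 * tau) * (fro z - c * t).
  have bz : 0 < b * fro z + c by rewrite addr_gt0 // mulr_gt0.
  rewrite -(ler_pM2r bz).
  have h1 : fro z * (b * fro z) <= (fro z - c * t) * (b * fro z + c).
    have := ler_wpM2l c_ge0 H1; lra.
  have h2 : g * c <= 2 * tau * (b * fro z).
    have : g * c <= b * c by rewrite ler_wpM2r.
    have : b * (sN ^+ 2 * tau) <= b * (2 * fro z * tau) by rewrite ler_pM2l // ler_wpM2r.
    rewrite /c; lra.
  have h3 := ler_wpM2l (ltW zp) h2.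
  have := ler_wpM2l g2 h1; lra.
have H4 := mdot_le z (KW *m z); rewrite H2 in H4.
have nz : 0 < nF z by rewrite sqrtr_gt0.
have H5 : nF z * g <= (g + 2 * tau) * nF (KW *m z).
  rewrite -(ler_pM2l nz) mulrA -expr2 nF_sqr (le_trans H3) // mulrCA ler_wpM2l //.
have H6 : fro z * g ^+ 2 <= (g + 2 * tau) ^+ 2 * fro (KW *m z).
  rewrite -!nF_sqr -!exprMn ler_pXn2r ?nnegrE ?mulr_ge0 ?nF_ge0 //.
have := ler_wpM2r (sqr_ge0 g) fz; lra.
Qed.

(** Cauchy-Schwarz in the inner product of the ridge matrix, between [W *m x] and [Q *m x]. *)
Lemma cohead_le_in (x : 'cV_n) : fro (Q *m x) <= a * mdot x (W *m x).
Proof.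
set y := Q *m x; set w := W *m x.
have Bw : B *m w = x by rewrite /w mulmxA ridge_gramK // mul1mx.
have H1 : mdot w (B *m y) ^+ 2 <= mdot w (B *m w) * mdot y (B *m y).
  (* Stacking X^T u on sqrt c u turns this inner product into a Frobenius one, so that [mdot_cauchy]
     applies. *)
  have E u v : mdot u (B *m v) = mdot (col_mx (X^T *m u) (Num.sqrt c *: u))
     (col_mx (X^T *m v) (Num.sqrt c *: v)).
    rewrite mdot_col_mx mdotZl mdotZr mulrA -expr2 sqr_sqrtr //.
    by rewrite /B mulmxDl mdotDr -mulmxA mdot_mulr mul_scalar_mx mdotZr.
  rewrite !E; exact: mdot_cauchy.
have H2 : mdot w (B *m y) = fro y.
  rewrite mdot_mulr ridge_gram_sym Bw; exact: mdot_cohead.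
have H3 : mdot y (B *m y) <= a * fro y.
  rewrite gram_cohead (le_trans (mdot_le _ _)) // -nF_sqr.
  rewrite expr2 mulrCA ler_wpM2l ?nF_ge0 // tailB_nF //.
rewrite H2 Bw mdotC in H1.
have x0 : 0 <= mdot x w by rewrite -Bw mdotC mdot_ridge_gram addr_ge0 ?mulr_ge0 ?fro_ge0.
have [->|yn] := eqVneq (fro y) 0; first by rewrite mulr_ge0.
have yp : 0 < fro y by rewrite lt_def yn fro_ge0.
rewrite -(ler_pM2l yp) -expr2 (le_trans H1) //.
by have := ler_wpM2l x0 H3; lra.
Qed.

(** The trace of the hat matrix splits into nonnegative head and tail parts. The head part is
    dropped, and [cohead_le_in] is applied to the columns of [X2]. *)
Lemma var_tail_in_lower :
  (fro X2 - K * sN ^+ 2 * l * d%:R) <= a * \tr KW.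
Proof.
have H : fro (Q *m X2) <= a * mdot X2 (W *m X2).
  rewrite (fro_cols (Q *m _)) mdot_tr /mxtrace mulr_sumr.
  apply: ler_sum => j _; rewrite colE -mulmxA -colE.
  rewrite (le_trans (cohead_le_in _)) // ler_pM2l // le_eqVlt; apply/orP; left.
  apply/eqP; rewrite /mdot !mxE; apply: eq_bigr => i _; rewrite big_ord1 !mxE.
  by congr (_ * _); apply: eq_bigr => i' _; rewrite !mxE.
have W0 k (M : 'M[R]_(n, k)) : 0 <= mdot M (W *m M).
  rewrite mdot_tr; apply: sumr_ge0 => j _.
  have -> : (M^T *m (W *m M)) j j = mdot (W *m (col j M)) (B *m (W *m col j M)).
    rewrite (mulmxA B) ridge_gramK // mul1mx mdotC /mdot !mxE.
    apply: eq_bigr => i _; rewrite big_ord1 !mxE.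
    by congr (_ * _); apply: eq_bigr => i' _; rewrite !mxE.
  by rewrite mdot_ridge_gram addr_ge0 ?mulr_ge0 ?fro_ge0.
have -> : \tr KW = mdot X1 (W *m X1) + mdot X2 (W *m X2).
  rewrite /KW mulmxA mxtrace_mulC {1}/X /X tr_row_mx mul_row_col mulmxDr mxtraceD.
  by rewrite !mdot_tr !(mulmxA W) !(mxtrace_mulC _ (_^T)) .
have := ler_wpM2l a_ge0 (W0 _ X1); have := fro_head_proj_tail.
rewrite fro_cohead in H; lra.
Qed.

Lemma trace_KW : (\tr KW) ^+ 2 <= n%:R * fro KW.
Proof.
have -> : \tr KW = mdot 1%:M KW by rewrite mdot_tr trmx1 mul1mx.
rewrite (le_trans (mdot_cauchy _ _)) // ler_wpM2r ?fro_ge0 //.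
by rewrite /fro mdot_tr trmx1 mul1mx mxtrace1.
Qed.

(** The head part of the transposed hat matrix is (W X1 S) Z1^T, which reduces it to the
    out-of-sample head variance; for the tail, the crude bound 1 / c on the inverse has the right
    order. *)
Lemma var_in_upper :
  fro KW <= 4 * sN ^+ 2 * fro (W *m (X1 *m S)) +
            2 * (K * l) ^+ 2 * n%:R / tau ^+ 2.
Proof.
rewrite -fro_tr KW_sym /X tr_row_mx mul_row_col mulmxDr.
rewrite (le_trans (froD_le2 _ _)) //; apply: lerD.
  have -> : W *m (X1 *m X1^T) = (W *m (X1 *m S)) *m Z1^T.
    by rewrite {2}/X1 trmx_mul tr_diag_mx !mulmxA.
  have : fro (W *m (X1 *m S) *m Z1^T) <= 2 * sN ^+ 2 * fro (W *m (X1 *m S)).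
    rewrite -fro_tr trmx_mul trmxK -(fro_tr (W *m _)); exact: opb_mul.
  lra.
have k0 : 0 <= K * sN ^+ 2 * l by rewrite !mulr_ge0 ?sqr_ge0.
have H1 := ridge_inv_fro (X2 *m X2^T).
have H2 : fro (X2 *m X2^T) <= (K * sN ^+ 2 * l) ^+ 2 * n%:R.
  rewrite (le_trans (opb_mul _ X2_le)) // (expr2 (K * _ * _)) -(mulrA (K * _ * _)) ler_wpM2l //.
  rewrite -[X2^T]mulmx1 (le_trans (opb_mul _ (opb_tr k0 X2_le))) // ler_wpM2l //.
  by rewrite /fro mdot_tr trmx1 mul1mx mxtrace1.
rewrite ler_pdivlMr ?exprn_gt0 // -(ler_pM2l (exprn_gt0 4 sN_gt0)).
rewrite /c in H1; lra.
Qed.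

End Variance.

(** * Order of the risk for a fixed design *)

Section ScalarBounds.
Variable R : realType.
Implicit Types (K M rho e x D : R).

Lemma sqr_le_of K (u v : R) : 0 <= u -> 0 <= v -> u <= K * v -> u ^+ 2 <= K ^+ 2 * v ^+ 2.
Proof. by move=> u0 v0 uv; rewrite -exprMn ler_pXn2r ?nnegrE // (le_trans u0 uv). Qed.

Lemma le_of_sqr (u v : R) : 0 <= v -> u ^+ 2 <= v ^+ 2 -> u <= v.
Proof.
move=> v0; rewrite -(real_normK (num_real u)) => h.
by rewrite (le_trans (ler_norm u)) // -(@ler_pXn2r _ 2) ?nnegrE.
Qed.

(* [beta] is the norm of the head bias, [VH] and [VT] are the head and tail parts of
   the variance. For [x >= 1] the bias alone is of order 1; for small [x] either the
   bias or the tail variance is large, and their geometric mean is free of [x]. *)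
Lemma out_lower_scalar K rho e x D beta VH VT V :
  1 <= K -> 0 < rho -> 0 < e -> 0 < x -> 0 <= D <= 1 ->
  e <= K -> rho <= K * e -> 8 * K ^+ 2 * rho <= 1 ->
  0 <= beta -> 0 <= VH -> 0 <= VT ->
  (8 * K ^+ 2 * rho <= x -> x <= 2 * K * (8 + x) * beta) ->
  D <= 4 * (1 + K * rho + x) ^+ 2 * VH ->
  rho ^+ 2 * (e ^+ 2 / K - K * D) <= (K * rho + x) ^+ 2 * VT ->
  beta ^+ 2 + K^-1 * (VH + VT) <= V ->
  Num.max (rho * e) D <= 648 * K ^+ 7 * V.
Proof.
move=> K1 rho0 e0 x0 /andP[D0 D1] eK reK r8 b0 VH0 VT0 Hb HH HT HV.
have K0 : 0 < K by lra.
have Kge k : 1 <= K ^+ k by rewrite exprn_ege1.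
have Kle j k : (j <= k)%N -> K ^+ j <= K ^+ k by move=> jk; rewrite ler_weXn2l.
have K2 := Kge 2.
have rho1 : K * rho <= 8^-1.
  have : K * rho <= K ^+ 2 * rho by rewrite ler_pM2r // expr2 ler_peMr // ltW.
  clear -r8; lra.
have V0 : 0 <= V.
  by rewrite (le_trans _ HV) // addr_ge0 ?sqr_ge0 // mulr_ge0 ?invr_ge0 ?addr_ge0 // ltW.
have HVH : VH <= K * V.
  have : K^-1 * VH <= V.
    have := sqr_ge0 beta; have : 0 <= K^-1 * VT by rewrite mulr_ge0 // invr_ge0 ltW.
    clear -HV; lra.
  by rewrite mulrC ler_pdivrMr // mulrC.
have HVT : VT <= K * V.
  have : K^-1 * VT <= V.
    have := sqr_ge0 beta; have : 0 <= K^-1 * VH by rewrite mulr_ge0 // invr_ge0 ltW.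
    clear -HV; lra.
  by rewrite mulrC ler_pdivrMr // mulrC.
have HVb : beta ^+ 2 <= V.
  have : 0 <= K^-1 * (VH + VT) by rewrite mulr_ge0 ?addr_ge0 // invr_ge0 ltW.
  clear -HV; lra.
have KV j k : (j <= k)%N -> K ^+ j * V <= K ^+ k * V by move=> jk; rewrite ler_wpM2r ?Kle.
have KV0 j : 0 <= K ^+ j * V by rewrite mulr_ge0 // exprn_ge0 // ltW.
have bigx : 1 <= x -> 1 <= 324 * K ^+ 2 * V.
  move=> x1; have /Hb h : 8 * K ^+ 2 * rho <= x by exact: le_trans x1.
  have h1 : 1 <= 18 * K * beta.
    have : x * 1 <= x * (18 * K * beta).
      rewrite mulr1 (le_trans h) //.
      have -> : x * (18 * K * beta) = 2 * K * (9 * x) * beta by ring.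
      by rewrite ler_wpM2r // ler_wpM2l ?mulr_ge0 ?(ltW K0) //; clear -x1; lra.
    by rewrite ler_pM2l.
  have h2 : 1 ^+ 2 <= (18 * K * beta) ^+ 2.
    by rewrite ler_pXn2r ?nnegrE //; clear -h1; lra.
  have : K ^+ 2 * beta ^+ 2 <= K ^+ 2 * V by rewrite ler_wpM2l ?sqr_ge0.
  move: h2; rewrite expr1n !exprMn; clear; lra.
have HD : D <= 324 * K ^+ 2 * V.
  have /orP[x1|x1] := le_total x 1.
    have : 4 * (1 + K * rho + x) ^+ 2 <= 4 * 3 ^+ 2.
      have Kr : 0 < K * rho by rewrite mulr_gt0.
      by rewrite ler_pM2l // ler_pXn2r ?nnegrE //; clear -Kr rho1 x1 x0; lra.
    move=> /(ler_wpM2r VH0) h; have := KV 1%N 2%N isT; rewrite expr1; clear -HH h HVH VH0; lra.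
  by have := bigx x1; clear -D1; lra.
have re0 : 0 < rho * e by rewrite mulr_gt0.
have reKe : rho * e <= K * e ^+ 2 by rewrite expr2 mulrA ler_pM2r.
rewrite ge_max; apply/andP; split; last by have := KV 2%N 7%N isT; clear -HD D0; lra.
(* When [D] dominates, [rho <= K * e] turns [rho * e] into [K * e ^+ 2], which the head bound [HD]
   covers. The factor 648 comes from this case, the exponent 7 from the next one. *)
have /orP[eD|eD] := le_total (e ^+ 2) (2 * K ^+ 2 * D).
  have h1 : K * e ^+ 2 <= K * (2 * K ^+ 2 * (324 * K ^+ 2 * V)).
    rewrite ler_pM2l // (le_trans eD) // ler_wpM2l ?mulr_ge0 ?sqr_ge0 ?(ltW K0) //.
  have -> : 648 * K ^+ 7 * V = 648 * (K ^+ 7 * V) by ring.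
  have h2 := KV 5%N 7%N isT.
  have h3 : K * (2 * K ^+ 2 * (324 * K ^+ 2 * V)) = 648 * (K ^+ 5 * V) by ring.
  clear -reKe h1 h2 h3; lra.
have HT2 : rho ^+ 2 * e ^+ 2 <= 2 * K * ((K * rho + x) ^+ 2 * VT).
  have h : e ^+ 2 <= 2 * K * (e ^+ 2 / K - K * D).
    have -> : 2 * K * (e ^+ 2 / K - K * D) = 2 * e ^+ 2 - 2 * K ^+ 2 * D.
      by field; rewrite gt_eqF.
    clear -eD; lra.
  have := ler_wpM2l (sqr_ge0 rho) h.
  have K20 : 0 <= 2 * K by rewrite mulr_ge0 // ltW.
  have := ler_wpM2l K20 HT; clear; lra.
(* For [x] below this threshold no bias bound is available, but then the tail variance is of order
   e^2, again at least rho e / K. *)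
have /orP[xr|xr] := le_total x (8 * K ^+ 2 * rho).
  have h0 : K * rho + x <= 9 * K ^+ 2 * rho.
    have : K * rho <= K ^+ 2 * rho by rewrite ler_pM2r // expr2 ler_peMr // ltW.
    clear -xr; lra.
  have Kr0 : 0 <= K * rho + x by rewrite addr_ge0 ?mulr_ge0 // ltW.
  have h1 := sqr_le_of Kr0 (ltW rho0) h0.
  have h2 : rho ^+ 2 * e ^+ 2 <= rho ^+ 2 * (162 * K ^+ 5 * VT).
    rewrite (le_trans HT2) //.
    have := ler_wpM2r VT0 h1 => h3.
    have K20 : 0 <= 2 * K by rewrite mulr_ge0 // ltW.
    have := ler_wpM2l K20 h3; rewrite !exprMn; clear; lra.
  rewrite ler_pM2l ?exprn_gt0 // in h2.
  have h3 : K * e ^+ 2 <= K * (162 * K ^+ 5 * (K * V)).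
    rewrite ler_pM2l // (le_trans h2) //.
    have := ler_wpM2l (exprn_ge0 5 (ltW K0)) HVT; clear; lra.
  have -> : 648 * K ^+ 7 * V = 648 * (K ^+ 7 * V) by ring.
  have h4 : K * (162 * K ^+ 5 * (K * V)) = 162 * (K ^+ 7 * V) by ring.
  have := KV0 7%N; clear -reKe h3 h4; lra.
have hb := Hb xr.
have /orP[x1|x1] := le_total 1 x.
  have h1 := bigx x1.
  have r1 : rho <= 1.
    have : rho <= K * rho by rewrite ler_peMl // ltW.
    clear -rho1; lra.
  have h2 : rho * e <= K by rewrite -[leRHS]mul1r ler_pM // ltW.
  have h3 : K * 1 <= K * (324 * K ^+ 2 * V) by rewrite ler_pM2l.
  have h4 := KV 3%N 7%N isT.
  have h5 : K * (324 * K ^+ 2 * V) = 324 * (K ^+ 3 * V) by ring.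
  have h6 := KV0 7%N; clear -h2 h3 h4 h5 h6; lra.
have h1 : x <= 18 * K * beta.
  rewrite (le_trans hb) // ler_wpM2r //.
  have -> : 18 * K = 2 * K * 9 by ring.
  by rewrite ler_wpM2l ?mulr_ge0 ?(ltW K0) //; clear -x1; lra.
have h2 := sqr_le_of (ltW x0) b0 h1.
have h3 : K * rho + x <= 2 * x.
  have : K * rho <= K ^+ 2 * rho by rewrite ler_pM2r // expr2 ler_peMr // ltW.
  have : 0 < K ^+ 2 * rho by rewrite mulr_gt0 ?exprn_gt0.
  clear -xr; lra.
have Kr0 : 0 <= K * rho + x by rewrite addr_ge0 ?mulr_ge0 // ltW.
have h4 := sqr_le_of Kr0 (ltW x0) h3.
have h5 : (rho * e) ^+ 2 <= x ^+ 2 * (8 * K * VT).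
  rewrite exprMn (le_trans HT2) //.
  have K20 : 0 <= 2 * K by rewrite mulr_ge0 // ltW.
  have := ler_wpM2l K20 (ler_wpM2r VT0 h4); clear; lra.
have h6 : (rho * e) ^+ 2 <= (324 * K ^+ 2 * V) ^+ 2.
  rewrite (le_trans h5) // [leRHS]expr2.
  have VT8 : 0 <= 8 * K * VT by rewrite !mulr_ge0 // ltW.
  apply: ler_pM; rewrite ?sqr_ge0 //.
    rewrite (le_trans h2) // !exprMn.
    have : K ^+ 2 * beta ^+ 2 <= K ^+ 2 * V by rewrite ler_wpM2l ?sqr_ge0.
    clear; lra.
  have : K * VT <= K * (K * V) by rewrite ler_pM2l.
  have := KV0 2%N; rewrite expr2; clear; lra.
have p324 : 0 <= 324 * K ^+ 2 * V by have := KV0 2%N; clear; lra.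
have h7 := le_of_sqr p324 h6; have h8 := KV 2%N 7%N isT; have h9 := KV0 7%N.
clear -h7 h8 h9; lra.
Qed.

(* Here the tail variance is only seen through the trace [T], hence [T ^+ 2 <= F]. *)
Lemma in_lower_scalar K rho x D r F T V :
  1 <= K -> 0 < rho -> 0 < x -> 0 <= D <= 1 ->
  4 * K ^+ 2 * rho <= 1 ->
  0 <= r -> 0 <= F ->
  x <= 4 * K * (1 + x + K * rho) * r ->
  D <= 4 * (1 + 2 * x) ^+ 2 * F ->
  rho * (K^-1 - K * D) <= (K * rho + x) * T -> T ^+ 2 <= F ->
  r ^+ 2 + K^-1 * F <= V ->
  Num.max rho D <= 648 * K ^+ 7 * V.
Proof.
move=> K1 rho0 x0 /andP[D0 D1] r4 r0 F0 Hb HH HT TF HV.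
have K0 : 0 < K by lra.
have Kge k : 1 <= K ^+ k by rewrite exprn_ege1.
have K2 := Kge 2.
have Krho : K * rho <= K ^+ 2 * rho by rewrite ler_pM2r // expr2 ler_peMr // ltW.
have rK : rho <= K * rho by rewrite ler_peMl // ltW.
have V0 : 0 <= V.
  by rewrite (le_trans _ HV) // addr_ge0 ?sqr_ge0 // mulr_ge0 ?invr_ge0 // ltW.
have HF : F <= K * V.
  have : K^-1 * F <= V by have := sqr_ge0 r; clear -HV; lra.
  by rewrite mulrC ler_pdivrMr // mulrC.
have Hr : r ^+ 2 <= V.
  have : 0 <= K^-1 * F by rewrite mulr_ge0 // invr_ge0 ltW.
  clear -HV; lra.
have KV j k : (j <= k)%N -> K ^+ j * V <= K ^+ k * V.
  by move=> jk; rewrite ler_wpM2r // ler_weXn2l.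
have KV0 j : 0 <= K ^+ j * V by rewrite mulr_ge0 // exprn_ge0 // ltW.
have bigx : 1 <= x -> 1 <= 81 * (K ^+ 2 * V).
  move=> x1.
  have h1 : 1 <= 9 * K * r.
    have : x * 1 <= x * (9 * K * r).
      rewrite mulr1 (le_trans Hb) //.
      have -> : x * (9 * K * r) = 4 * K * (9 / 4 * x) * r by field.
      by rewrite ler_wpM2r // ler_wpM2l ?mulr_ge0 ?(ltW K0) //; clear -x1 Krho r4; lra.
    by rewrite ler_pM2l.
  have h2 : 1 ^+ 2 <= (9 * K * r) ^+ 2.
    by rewrite ler_pXn2r ?nnegrE //; clear -h1; lra.
  have : K ^+ 2 * r ^+ 2 <= K ^+ 2 * V by rewrite ler_wpM2l ?sqr_ge0.
  move: h2; rewrite expr1n !exprMn; clear; lra.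
have HD : D <= 81 * (K ^+ 2 * V).
  have /orP[x1|x1] := le_total x 1.
    have : 4 * (1 + 2 * x) ^+ 2 <= 4 * 3 ^+ 2.
      by rewrite ler_pM2l // ler_pXn2r ?nnegrE //; clear -x1 x0; lra.
    move=> /(ler_wpM2r F0) h; have := KV 1%N 2%N isT; rewrite expr1; clear -HH h HF F0; lra.
  by have := bigx x1; clear -D1; lra.
rewrite ge_max; apply/andP; split; last by have := KV 2%N 7%N isT; clear -HD D0; lra.
have rho1 : rho <= 1 by clear -r4 rK Krho rho0; lra.
(* When [D] is of order 1, so is the head variance, and rho <= 1 is enough. The final constant is
   kept equal to that of [out_lower_scalar], so that one statement can serve both risks. *)
have /orP[eD|eD] := le_total 1 (2 * K ^+ 2 * D).
  have h1 : 1 <= 162 * (K ^+ 4 * V).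
    rewrite (le_trans eD) //.
    have -> : 162 * (K ^+ 4 * V) = 2 * K ^+ 2 * (81 * (K ^+ 2 * V)) by ring.
    by rewrite ler_wpM2l ?mulr_ge0 ?sqr_ge0 ?(ltW K0).
  by have := KV 4%N 7%N isT; have := KV0 7%N; clear -h1 rho1; lra.
have Kr0 : 0 < K * rho + x by rewrite addr_gt0 ?mulr_gt0.
have HT2 : rho <= 2 * K * ((K * rho + x) * T).
  have h : 1 <= 2 * K * (K^-1 - K * D).
    have -> : 2 * K * (K^-1 - K * D) = 2 - 2 * K ^+ 2 * D.
      by field; rewrite gt_eqF.
    clear -eD; lra.
  have := ler_wpM2l (ltW rho0) h.
  have K20 : 0 <= 2 * K by rewrite mulr_ge0 // ltW.
  have := ler_wpM2l K20 HT; clear; lra.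
have HT3 : rho ^+ 2 <= 4 * K ^+ 2 * ((K * rho + x) ^+ 2 * F).
  have h : rho ^+ 2 <= (2 * K * ((K * rho + x) * T)) ^+ 2.
    by rewrite ler_pXn2r ?nnegrE ?(ltW rho0) // (le_trans (ltW rho0)).
  rewrite (le_trans h) // !exprMn.
  have -> : 2 ^+ 2 = 4 :> R by ring.
  by rewrite ler_pM2l ?mulr_gt0 ?exprn_gt0 // ler_pM2l ?exprn_gt0.
have /orP[xr|xr] := le_total x rho.
  have h0 : K * rho + x <= 2 * K * rho by clear -xr rK; lra.
  have h1 := sqr_le_of (ltW Kr0) (ltW rho0) h0.
  have h2 : rho ^+ 2 * 1 <= rho ^+ 2 * (16 * (K ^+ 4 * F)).
    rewrite mulr1 (le_trans HT3) //.
    have h3 := ler_wpM2r F0 h1.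
    have K20 : 0 <= 4 * K ^+ 2 by rewrite mulr_ge0 ?sqr_ge0.
    have := ler_wpM2l K20 h3; rewrite !exprMn; clear; lra.
  rewrite ler_pM2l ?exprn_gt0 // in h2.
  have h3 : K ^+ 4 * F <= K ^+ 4 * (K * V) by rewrite ler_wpM2l ?exprn_ge0 // ltW.
  have h4 : K ^+ 4 * (K * V) = K ^+ 5 * V by ring.
  by have := KV 5%N 7%N isT; have := KV0 7%N; clear -h2 h3 h4 rho1; lra.
have /orP[x1|x1] := le_total 1 x.
  by have := bigx x1; have := KV 2%N 7%N isT; have := KV0 7%N; clear -rho1; lra.
have h1 : x <= 9 * K * r.
  rewrite (le_trans Hb) // ler_wpM2r //.
  have -> : 9 * K = 4 * K * (9 / 4) by field.
  by rewrite ler_wpM2l ?mulr_ge0 ?(ltW K0) //; clear -x1 Krho r4; lra.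
have h2 := sqr_le_of (ltW x0) r0 h1.
have Kx : x <= K * x by rewrite ler_peMl // ltW.
have Kxr : K * rho <= K * x by rewrite ler_pM2l.
have h3 : K * rho + x <= 2 * K * x by clear -Kx Kxr; lra.
have h4 := sqr_le_of (ltW Kr0) (ltW x0) h3.
have h5 : rho ^+ 2 <= x ^+ 2 * (16 * (K ^+ 4 * F)).
  rewrite (le_trans HT3) //.
  have K20 : 0 <= 4 * K ^+ 2 by rewrite mulr_ge0 ?sqr_ge0.
  have := ler_wpM2l K20 (ler_wpM2r F0 h4); rewrite !exprMn; clear; lra.
have h6 : rho ^+ 2 <= (81 * (K ^+ 5 * V)) ^+ 2.
  rewrite (le_trans h5) // [leRHS]expr2.
  apply: ler_pM (sqr_ge0 _) _ _ _; first by do 2! (apply: mulr_ge0 => //); rewrite exprn_ge0 // ltW.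
    rewrite (le_trans h2) // !exprMn.
    have : K ^+ 2 * r ^+ 2 <= K ^+ 2 * V by rewrite ler_wpM2l ?sqr_ge0.
    by have := KV 2%N 5%N isT; clear; lra.
  have h3' : K ^+ 4 * F <= K ^+ 4 * (K * V) by rewrite ler_wpM2l ?exprn_ge0 // ltW.
  have h4' : K ^+ 4 * (K * V) = K ^+ 5 * V by ring.
  have := KV0 5%N; clear -h3' h4'; lra.
have K5 : 0 <= 81 * (K ^+ 5 * V) by rewrite mulr_ge0.
have h7 := le_of_sqr K5 h6; have h8 := KV 5%N 7%N isT; have h9 := KV0 7%N.
clear -h7 h8 h9; lra.
Qed.

End ScalarBounds.

(* The conditional mean squared error given [X], with [c = n tau], [H^T H] the weight
   of the norm and [sg2] the noise variance. *)
Definition ridge_risk (R : realType) n p m (H : 'M[R]_(m, p)) (X : 'M[R]_(n, p))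
    (c : R) (th : 'cV[R]_p) (sg2 : R) : R :=
  fro (H *m ridge_bias X c th) +
  sg2 * fro (H *m (X^T *m invmx (ridge_gram X c))).

(* [s] and [s2] are the square roots of the first [d] and the last [q] eigenvalues;
   [l], [g] and [e] stand for lambda_(d+1), lambda_d and sqrt (r_d(Sigma^2) / n). *)
Record regular_params (R : realType) n d q (s : 'rV[R]_d) (s2 : 'rV[R]_q)
    (th1 : 'cV[R]_d) (th2 : 'cV[R]_q) (K l g e sg2 : R) : Prop := RegularParams {
  rp_K : 1 <= K ;
  rp_dim : (1 <= d <= n)%N ;
  rp_l : 0 < l ;
  rp_g : 0 < g ;
  rp_s : forall j, 0 < s ord0 j ;
  rp_sg : forall j, g <= s ord0 j ^+ 2 ;
  rp_s2 : forall k, s2 ord0 k ^+ 2 <= l ;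
  rp_signal : K^-1 <= nF (diag_mx (\row_j (s ord0 j)^-1) *m th1) * g <= K ;
  rp_tail : fro (diag_mx s2 *m th2) <= K * (l / g) ^+ 2 ;
  rp_noise : K^-1 <= sg2 <= K ;
  rp_e : 0 < e <= K ;
  rp_rho : l / g <= K * e ;
  rp_small : 8 * K ^+ 2 * (l / g) <= 1 }.

(* [Z1] is the whitened head of the design and [X2] its raw tail. *)
Record good_design (R : realType) n d q (Z1 : 'M[R]_(n, d)) (X2 : 'M[R]_(n, q))
    (s2 : 'rV[R]_q) (th2 : 'cV[R]_q) (K l g e : R) : Prop := GoodDesign {
  gd_head_le : opb Z1 (2 * n%:R) ;
  gd_head_ge : forall v : 'cV_d, n%:R * fro v <= 2 * fro (Z1 *m v) ;
  gd_tail_op : opb X2 (K * n%:R * l) ;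
  gd_zeta : fro (X2 *m th2) <= n%:R * (K * (l / g)) ^+ 2 ;
  gd_tail_ge : n%:R ^+ 2 * l ^+ 2 * e ^+ 2 / K <= fro (X2 *m diag_mx s2) ;
  gd_tail_le : fro (X2 *m diag_mx s2) <= K * n%:R ^+ 2 * l ^+ 2 * e ^+ 2 ;
  gd_tail_tr : n%:R ^+ 2 * l / K <= fro X2 }.

Ltac nonneg := repeat first [ assumption | by [] | exact: ltW | exact: fro_ge0
  | exact: nF_ge0 | exact: sqrtr_ge0 | exact: sqr_ge0 | apply: exprn_ge0
  | apply: mulr_ge0 | apply: addr_ge0 ].

Section RiskBounds.
Variables (R : realType) (n d q : nat).
Variables (Z1 : 'M[R]_(n, d)) (s : 'rV[R]_d) (X2 : 'M[R]_(n, q)) (s2 : 'rV[R]_q).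
Variables (th1 : 'cV[R]_d) (th2 : 'cV[R]_q) (K l g e sg2 tau : R).
Hypothesis rp : regular_params n s s2 th1 th2 K l g e sg2.
Hypothesis gd : good_design Z1 X2 s2 th2 K l g e.
Hypothesis tau_gt0 : 0 < tau.
Let N : R := n%:R.
Let sN : R := Num.sqrt N.
Let S := diag_mx s.
Let X1 := Z1 *m S.
Let X := row_mx X1 X2.
Let c := N * tau.
Let W := invmx (ridge_gram X c).
Let th := col_mx th1 th2.
Let b := ridge_bias X c th.
Let b1 := usubmx b.
Let b2 := dsubmx b.
Let Hout := diag_mx (row_mx s s2).
Let Hin := sN^-1 *: X.
Let VH := fro (W *m (X1 *m S)).
Let VT := fro (W *m (X2 *m diag_mx s2)).
Let KW := X *m (X^T *m W).
Let rho := l / g.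
Let x := tau / g.
Let D : R := d%:R / N.

Let N_gt0 : 0 < N.
Proof.
by case: rp => _ /andP[d1 dn] *; rewrite ltr0n (leq_trans d1).
Qed.
Let sN_gt0 : 0 < sN. Proof. by rewrite sqrtr_gt0. Qed.
Let sN2 : sN ^+ 2 = N. Proof. by rewrite sqr_sqrtr // ltW. Qed.
Let cE : c = sN ^+ 2 * tau. Proof. by rewrite sN2. Qed.
Let c_gt0 : 0 < c. Proof. by rewrite mulr_gt0. Qed.
Let K_ge1 := rp_K rp.
Let K_gt0 : 0 < K. Proof. exact: lt_le_trans K_ge1. Qed.
Let K_ge0 := ltW K_gt0.
Let l_gt0 := rp_l rp.
Let l_ge0 := ltW l_gt0.
Let g_gt0 := rp_g rp.
Let g_ge0 := ltW g_gt0.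
Let s_gt0 := rp_s rp.
Let s_ge := rp_sg rp.
Let s2_le := rp_s2 rp.
Let rho_gt0 : 0 < rho. Proof. by rewrite divr_gt0. Qed.
Let rho_ge0 := ltW rho_gt0.
Let x_gt0 : 0 < x. Proof. by rewrite divr_gt0. Qed.
Let rhoE : l = rho * g. Proof. by rewrite divfK // gt_eqF. Qed.
Let tauE : tau = x * g. Proof. by rewrite divfK // gt_eqF. Qed.
Let D01 : 0 <= D <= 1.
Proof.
case: rp => _ /andP[d1 dn] *; rewrite divr_ge0 ?ler0n ?(ltW N_gt0) //=.
by rewrite ler_pdivrMr // mul1r ler_nat.
Qed.
Let DE : d%:R = D * N. Proof. by rewrite divfK // gt_eqF. Qed.
Let Z1_le : opb Z1 (2 * sN ^+ 2). Proof. by rewrite sN2; case: gd. Qed.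
Let Z1_ge : forall v : 'cV_d, sN ^+ 2 * fro v <= 2 * fro (Z1 *m v).
Proof. by rewrite sN2; case: gd. Qed.
Let X2_le : opb X2 (K * sN ^+ 2 * l). Proof. by rewrite sN2; case: gd. Qed.
Let zeta0_ge0 : 0 <= K * rho. Proof. by rewrite mulr_ge0. Qed.
Let zeta_le : nF (X2 *m th2) <= sN * (K * rho).
Proof.
rewrite nF_le ?(mulr_ge0 (ltW sN_gt0)) // (exprMn _ sN) sN2; exact: gd_zeta gd.
Qed.

Let bE : b = col_mx b1 b2. Proof. by rewrite vsubmxK. Qed.
Let XbE : X *m b = X1 *m b1 + X2 *m b2. Proof. by rewrite bE mul_row_col. Qed.

Let normal : col_mx (X1^T *m (X1 *m b1 + X2 *m b2) + (sN ^+ 2 * tau) *: b1)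
      (X2^T *m (X1 *m b1 + X2 *m b2) + (sN ^+ 2 * tau) *: b2) =
      col_mx ((sN ^+ 2 * tau) *: th1) ((sN ^+ 2 * tau) *: th2).
Proof.
rewrite -add_col_mx -mul_col_mx -tr_row_mx -!scale_col_mx -cE -XbE -bE.
exact: ridge_bias_normal.
Qed.
Let normal1 := (eq_col_mx normal).1.
Let normal2 := (eq_col_mx normal).2.

Lemma ridge_risk_outE : ridge_risk Hout X c th sg2 =
  fro (S *m b1) + fro (diag_mx s2 *m b2) + sg2 * (VH + VT).
Proof.
have HE k (u : 'M[R]_(d, k)) (v : 'M[R]_(q, k)) :
    Hout *m col_mx u v = col_mx (S *m u) (diag_mx s2 *m v).
  rewrite /Hout diag_mx_row mul_block_col !mul0mx addr0 add0r //.
congr (_ + _ * _); first by rewrite -/b bE HE fro_col_mx.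
rewrite tr_row_mx mul_col_mx HE fro_col_mx -/W.
have WT : W^T = W by rewrite /W ridge_inv_sym.
by rewrite /VH /VT; congr (_ + _); rewrite -fro_tr !trmx_mul ?trmxK !tr_diag_mx WT ?mulmxA.
Qed.

Lemma ridge_risk_inE : ridge_risk Hin X c th sg2 =
  (fro (X1 *m b1 + X2 *m b2) + sg2 * fro KW) / N.
Proof.
rewrite /ridge_risk /Hin -!scalemxAl !froZ -/b XbE -/W -/KW exprVn sN2.
by rewrite mulrDl mulrC; congr (_ + _); rewrite [RHS]mulrC mulrCA.
Qed.

Let S_nF := nF (S *m b1).

(** The matrix bounds are homogeneous in n and in the eigenvalue scale [g]. Writing l = rho g, tau =
    x g and d = D n removes both scales and leaves the inequalities of [out_lower_scalar]. *)
Lemma ridge_risk_out_lower :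
  Num.max (rho * e) D <= 648 * K ^+ 7 * ridge_risk Hout X c th sg2.
Proof.
have /andP[e_gt0 eK] := rp_e rp.
have /andP[tg1 tg2] := rp_signal rp; have /andP[sg1 _] := rp_noise rp.
have sm := rp_small rp; rewrite -/rho in sm.
apply: (@out_lower_scalar _ K rho e x D S_nF VH VT) => //.
- exact: rp_rho rp.
- exact: nF_ge0.
- exact: fro_ge0.
- exact: fro_ge0.
(* The condition on [x] yields both requirements of [bias_out_lower]: a small tail feedback, and a
   head signal that dominates the tail signal [K * rho]. *)
- move=> xr.
  have K2 : K * rho <= K ^+ 2 * rho by rewrite ler_pM2r // expr2 ler_peMr.
  have h1 : 2 * K * l <= tau.
    rewrite rhoE tauE mulrA ler_pM2r //.
    have := mulr_gt0 K_gt0 rho_gt0; lra.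
  have h2 : x * K^-1 <= x * (nF (diag_mx (\row_j (s ord0 j)^-1) *m th1) * g).
    by rewrite ler_pM2l.
  have h3 : 8 * g * (K * rho) <= tau * (nF (diag_mx (\row_j (s ord0 j)^-1) *m th1) * g).
    rewrite tauE mulrAC -[leRHS]mulrA (mulrC g) [leRHS]mulrA ler_pM2r //.
    rewrite (le_trans _ h2) // ler_pdivlMr //; lra.
  have h := bias_out_lower sN_gt0 tau_gt0 g_gt0 l_ge0 K_ge0 s_gt0 s_ge Z1_le
    X2_le zeta_le normal1 normal2 h1 h3.
  rewrite -/S_nF tauE in h.
  have h4 : x * (nF (diag_mx (\row_j (s ord0 j)^-1) *m th1) * g) <=
      2 * (8 + x) * S_nF.
    rewrite -(ler_pM2r g_gt0); lra.
  have h5 : x <= K * (2 * (8 + x) * S_nF).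
    rewrite mulrC -ler_pdivrMr // (le_trans h2) //.
  by rewrite (le_trans h5) // le_eqVlt; apply/orP; left; apply/eqP; ring.
- have h := var_head_out_lower sN_gt0 tau_gt0 g_gt0 l_ge0 K_ge0 s_gt0 s_ge Z1_le
    Z1_ge X2_le.
  rewrite -cE sN2 DE rhoE tauE in h.
  rewrite -(ler_pM2r (mulr_gt0 N_gt0 (exprn_gt0 2 g_gt0))) mulrA (le_trans h) //.
  by rewrite le_eqVlt -/VH; apply/orP; left; apply/eqP; ring.
- have h := var_tail_out_lower s sN_gt0 tau_gt0 l_ge0 K_ge0 s2_le Z1_ge X2_le.
  rewrite -cE sN2 DE rhoE tauE in h.
  have h1 := gd_tail_ge gd; rewrite -/N rhoE in h1.
  rewrite -(ler_pM2r (mulr_gt0 (exprn_gt0 2 N_gt0) (exprn_gt0 2 g_gt0))).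
  apply: (@le_trans _ _ (fro (X2 *m diag_mx s2) - K * N * (rho * g) ^+ 2 * (D * N))).
    rewrite mulrBr mulrBl; apply: lerB.
      by rewrite (le_trans _ h1) // le_eqVlt; apply/orP; left; apply/eqP; ring.
    by rewrite le_eqVlt; apply/orP; left; apply/eqP; ring.
  rewrite (le_trans h) // -/VT le_eqVlt; apply/orP; left; apply/eqP.
  rewrite /VT /W /c tauE; ring.
- rewrite ridge_risk_outE nF_sqr; apply: lerD; first by rewrite lerDl fro_ge0.
  by rewrite ler_wpM2r // addr_ge0 ?fro_ge0.
Qed.

Lemma ridge_risk_in_lower :
  Num.max rho D <= 648 * K ^+ 7 * ridge_risk Hin X c th sg2.
Proof.
have /andP[tg1 tg2] := rp_signal rp; have /andP[sg1 _] := rp_noise rp.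
have sm := rp_small rp; rewrite -/rho in sm.
have r4 : 4 * K ^+ 2 * rho <= 1.
  by have := mulr_gt0 (exprn_gt0 2 K_gt0) rho_gt0; lra.
set r := nF (X1 *m b1 + X2 *m b2).
apply: (@in_lower_scalar _ K rho x D (r / sN) (fro KW / N) (\tr KW / N)) => //.
- by rewrite divr_ge0 ?nF_ge0 // ltW.
- by rewrite divr_ge0 ?fro_ge0 // ltW.
- have h3 : 4 * (K * rho) <= nF (diag_mx (\row_j (s ord0 j)^-1) *m th1) * g.
    rewrite (le_trans _ tg1) // -[leRHS]mul1r ler_pdivlMr //; lra.
  have h := bias_in_lower sN_gt0 tau_gt0 g_gt0 l_ge0 K_ge0 s_gt0 s_ge Z1_le
    Z1_ge X2_le zeta_le normal1 normal2 h3.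
  rewrite -/r rhoE tauE in h.
  have h2 : sN * (x * g) * K^-1 <= 4 * (g + x * g + K * (rho * g)) * r.
    by rewrite (le_trans _ h) // ler_pM2l // (mulr_gt0 sN_gt0 (mulr_gt0 x_gt0 g_gt0)).
  rewrite mulrA ler_pdivlMr // -(ler_pM2r g_gt0).
  rewrite ler_pdivrMr // in h2.
  lra.
- have h := var_head_in_lower X2 sN_gt0 tau_gt0 g_gt0 s_gt0 s_ge Z1_le Z1_ge.
  rewrite -cE DE tauE in h.
  rewrite mulrA ler_pdivlMr // -(ler_pM2r (exprn_gt0 2 g_gt0)) (le_trans h) //.
  rewrite le_eqVlt; apply/orP; left; apply/eqP; rewrite /KW /W /c tauE; ring.
- have h := var_tail_in_lower s sN_gt0 tau_gt0 l_ge0 K_ge0 Z1_ge X2_le.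
  rewrite -cE sN2 DE rhoE tauE in h.
  have h1 := gd_tail_tr gd; rewrite -/N rhoE in h1.
  have h2 : N * (N * g) * (rho * (K^-1 - K * D)) <= N * (K * (rho * g) + x * g) * \tr KW.
    apply: le_trans h; rewrite !mulrBr; apply: lerB.
      by rewrite (le_trans _ h1) // le_eqVlt; apply/orP; left; apply/eqP; ring.
    by rewrite le_eqVlt; apply/orP; left; apply/eqP; ring.
  rewrite mulrA ler_pdivlMr // -(ler_pM2l (mulr_gt0 N_gt0 g_gt0)); lra.
- have h := trace_KW Z1 s X2 sN tau; rewrite -cE in h.
  rewrite exprMn exprVn ler_pdivrMr ?exprn_gt0 // (le_trans h) //.
  rewrite le_eqVlt; apply/orP; left; apply/eqP.
  by rewrite -/N -/X -/W -/KW; field; rewrite gt_eqF.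
- rewrite ridge_risk_inE mulrDl; apply: lerD.
    by rewrite exprMn exprVn sN2 nF_sqr.
  by rewrite mulrA ler_pM2r ?invr_gt0 // ler_wpM2r ?fro_ge0.
Qed.

(** [M] absorbs [K] and also the distance of tau from the optimal tuning; [rho <= M * x] says that
    tau is not below order lambda_(d+1). *)
Variable M : R.
Hypothesis K_le_M : K <= M.
Hypothesis rho_le : rho <= M * x.
Let M_ge1 : 1 <= M. Proof. exact: le_trans K_le_M. Qed.
Let M_gt0 : 0 < M. Proof. exact: lt_le_trans M_ge1. Qed.
Let M_ge0 := ltW M_gt0.
Let E := bias_energy Z1 s X2 sN tau b1 b2 th2.

Lemma bias_energy_upper :
  E <= N * (25 * M ^+ 4 * x ^+ 2) /\ S_nF <= 20 * M ^+ 3 * x.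
Proof.
have /andP[tg1 tg2] := rp_signal rp.
have klt : K * l <= M ^+ 2 * tau.
  rewrite rhoE tauE (mulrA K) (mulrA (M ^+ 2)) ler_pM2r // expr2 -(mulrA M).
  exact: ler_pM.
have [h1 h2] := bias_energy_le sN_gt0 tau_gt0 s_gt0 Z1_ge X2_le zeta0_ge0 zeta_le
  normal1 normal2 M_ge0 klt.
rewrite -/E -/S_nF in h1 h2.
have MM : M <= M ^+ 2 by rewrite expr2 ler_peMr.
have h3 : Num.sqrt E <= sN * (5 * M ^+ 2 * x).
  rewrite (le_trans h1) // ler_pM2l //.
  have h4 : tau * nF (diag_mx (\row_j (s ord0 j)^-1) *m th1) <= x * M.
    by rewrite tauE -mulrA (mulrC g) ler_pM2l // (le_trans tg2).
  have h5 : K * rho <= M * (M * x) by apply: ler_pM.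
  have h6 : 2 * (tau * nF (diag_mx (\row_j (s ord0 j)^-1) *m th1)) * (1 + M)
     <= 2 * (x * M) * (1 + M).
    by rewrite ler_wpM2r ?addr_ge0 // ler_wpM2l.
  have h7 : M * x <= M ^+ 2 * x by rewrite ler_pM2r.
  lra.
have E0 : 0 <= E.
  rewrite /E /bias_energy addr_ge0 ?fro_ge0 // mulr_ge0 ?addr_ge0 ?fro_ge0 //.
  by rewrite -cE ltW.
split.
  rewrite -(sqr_sqrtr E0) -sN2.
  have -> : sN ^+ 2 * (25 * M ^+ 4 * x ^+ 2) = (sN * (5 * M ^+ 2 * x)) ^+ 2 by ring.
  by rewrite ler_pXn2r // nnegrE; nonneg.
rewrite -(ler_pM2l sN_gt0) (le_trans h2) //.
have h4 : 2 * (1 + M) * Num.sqrt E <= 4 * M * (sN * (5 * M ^+ 2 * x)).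
  apply: ler_pM => //; rewrite ?sqrtr_ge0 ?mulr_ge0 ?addr_ge0 //.
  by have := M_ge1; lra.
by rewrite (le_trans h4) // le_eqVlt; apply/orP; left; apply/eqP; ring.
Qed.

Lemma var_head_upper : VH <= 16 * M ^+ 4 * D.
Proof.
have h := var_head_out_upper s sN_gt0 tau_gt0 l_ge0 K_ge0 Z1_ge X2_le.
rewrite -cE sN2 DE in h.
have h1 : K * l + tau <= 2 * M ^+ 2 * tau.
  rewrite rhoE tauE.
  have h2 : K * rho <= M * (M * x) by apply: ler_pM.
  have h3 : 1 * x <= M ^+ 2 * x by rewrite ler_pM2r // exprn_ege1.
  have := ler_wpM2r g_ge0 h2; have := ler_wpM2r g_ge0 h3.
  lra.
have h2 : (K * l + tau) ^+ 2 <= (2 * M ^+ 2 * tau) ^+ 2.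
  by rewrite ler_pXn2r ?nnegrE ?addr_ge0 ?mulr_ge0 ?exprn_ge0 ?(ltW tau_gt0).
have D0 : 0 <= D by case/andP: D01.
rewrite -(ler_pM2l (mulr_gt0 N_gt0 (exprn_gt0 2 tau_gt0))) (le_trans h) //.
have := ler_wpM2r (mulr_ge0 D0 (ltW N_gt0)) h2.
lra.
Qed.

Lemma fro_diag_mul (v : 'cV[R]_q) : fro (diag_mx s2 *m v) <= l * fro v.
Proof.
rewrite -fro_tr trmx_mul tr_diag_mx -(fro_tr v).
exact: fro_mul_diag.
Qed.

Lemma ridge_risk_out_upper : x ^+ 2 <= M * (rho * e) -> rho * e <= M * x ^+ 2 ->
  ridge_risk Hout X c th sg2 <= 600 * M ^+ 7 * Num.max (rho * e) D.
Proof.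
move=> xre rex.
have /andP[e_gt0 eK] := rp_e rp; have /andP[_ sgK] := rp_noise rp.
have /andP[sg0 _] := rp_noise rp.
have sgp : 0 <= sg2 by rewrite (le_trans _ sg0) // invr_ge0.
have [hE hb] := bias_energy_upper; have hVH := var_head_upper.
have x0 := ltW x_gt0; have x20 := sqr_ge0 x.
have Mle j k : (j <= k)%N -> M ^+ j <= M ^+ k by move=> jk; rewrite ler_weXn2l.
have hb2 : fro (S *m b1) <= 400 * M ^+ 6 * x ^+ 2.
  rewrite -nF_sqr -/S_nF.
  have -> : 400 * M ^+ 6 * x ^+ 2 = (20 * M ^+ 3 * x) ^+ 2 by ring.
  have M3x : 0 <= 20 * M ^+ 3 * x by rewrite (mulr_ge0 (mulr_ge0 _ (exprn_ge0 _ _))).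
  by rewrite ler_pXn2r ?nnegrE ?M3x //; exact: nF_ge0.
(* The energy controls only c |b2 - th2|^2, so dividing by tau loses one power of [x]; the weight
   [l] brings a factor [rho <= M * x] that restores it. *)
have hh : l * fro (b2 - th2) <= 25 * M ^+ 5 * x ^+ 2.
  have h1 : c * fro (b2 - th2) <= E.
    rewrite /E /bias_energy -cE mulrDr addrA lerDr addr_ge0 ?fro_ge0 //.
    by rewrite mulr_ge0 ?fro_ge0 // ltW.
  have h2 := le_trans h1 hE.
  rewrite /c -mulrA ler_pM2l // tauE in h2.
  have h3 : g * fro (b2 - th2) <= 25 * M ^+ 4 * x.
    rewrite -(ler_pM2l x_gt0) mulrA (le_trans h2) //.
    by rewrite le_eqVlt; apply/orP; left; apply/eqP; ring.
  have h4 : rho * (g * fro (b2 - th2)) <= M * x * (25 * M ^+ 4 * x).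
    by apply: ler_pM => //; nonneg.
  rewrite rhoE -mulrA (le_trans h4) //.
  by rewrite le_eqVlt; apply/orP; left; apply/eqP; ring.
have hr2 : K * rho ^+ 2 <= M ^+ 3 * x ^+ 2.
  have -> : M ^+ 3 * x ^+ 2 = M * (M * x) ^+ 2 by ring.
  apply: ler_pM => //; first exact: sqr_ge0.
  by rewrite ler_pXn2r // nnegrE; nonneg.
have ht : fro (diag_mx s2 *m b2) <= 52 * M ^+ 6 * x ^+ 2.
  have -> : diag_mx s2 *m b2 = diag_mx s2 *m (b2 - th2) + diag_mx s2 *m th2.
    by rewrite mulmxBr subrK.
  rewrite (le_trans (froD_le2 _ _)) //.
  have h1 := fro_diag_mul (b2 - th2); have h2 := rp_tail rp; rewrite -/rho in h2.
  have h3 := ler_wpM2r x20 (Mle 5%N 6%N isT); have h4 := ler_wpM2r x20 (Mle 3%N 6%N isT).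
  lra.
(* The crude bound on the inverse gives (rho e / x)^2 up to constants, and [rho * e <= M * x ^+ 2]
   reduces it to rho e. *)
have hVT : VT <= M ^+ 2 * (rho * e).
  have h := ridge_inv_fro Z1 s X2 sN_gt0 tau_gt0 (X2 *m diag_mx s2).
  rewrite -cE -/X -/W -/VT in h.
  have h1 := le_trans h (gd_tail_le gd).
  rewrite -/N /c rhoE tauE in h1.
  have h2 : x ^+ 2 * VT <= K * (rho * e) ^+ 2.
    rewrite -(ler_pM2l (mulr_gt0 (exprn_gt0 2 N_gt0) (exprn_gt0 2 g_gt0))).
    lra.
  have re0 : 0 < rho * e by rewrite mulr_gt0.
  rewrite -(ler_pM2l (exprn_gt0 2 x_gt0)) (le_trans h2) //.
  have -> : x ^+ 2 * (M ^+ 2 * (rho * e)) = M * ((M * x ^+ 2) * (rho * e)) by ring.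
  rewrite ler_pM ?sqr_ge0 // expr2 ler_pM2r //.
rewrite ridge_risk_outE.
have hV : sg2 * (VH + VT) <= M * (16 * M ^+ 4 * D + M ^+ 2 * (rho * e)).
  apply: ler_pM => //; rewrite ?addr_ge0 ?fro_ge0 ?(le_trans sgK) //.
  exact: lerD.
have D0 : 0 <= D by case/andP: D01.
have re0 : 0 <= rho * e by rewrite mulr_ge0 ?(ltW e_gt0).
set m := Num.max _ _; have m1 : rho * e <= m by rewrite le_max lexx.
have m2 : D <= m by rewrite le_max lexx orbT.
have M7 : 0 <= M ^+ 7 by rewrite exprn_ge0.
have h1 : M ^+ 6 * x ^+ 2 <= M ^+ 6 * (M * (rho * e)).
  by rewrite ler_wpM2l // exprn_ge0.
have h2 := ler_wpM2r D0 (Mle 5%N 7%N isT).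
have h3 := ler_wpM2r re0 (Mle 3%N 7%N isT).
have h4 := ler_wpM2l M7 m1; have h5 := ler_wpM2l M7 m2.
have h6 : 0 <= M ^+ 7 * m by rewrite (le_trans _ h5) // mulr_ge0.
lra.
Qed.

Lemma ridge_risk_in_upper : x ^+ 2 <= M * rho -> rho <= M * x ^+ 2 ->
  ridge_risk Hin X c th sg2 <= 600 * M ^+ 7 * Num.max rho D.
Proof.
move=> xre rex.
have /andP[_ sgK] := rp_noise rp.
have /andP[sg0 _] := rp_noise rp.
have sgp : 0 <= sg2 by rewrite (le_trans _ sg0) // invr_ge0.
have [hE hb] := bias_energy_upper; have hVH := var_head_upper.
have x0 := ltW x_gt0; have x20 := sqr_ge0 x.
have Mle j k : (j <= k)%N -> M ^+ j <= M ^+ k by move=> jk; rewrite ler_weXn2l.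
have hr2 : (K * rho) ^+ 2 <= M ^+ 4 * x ^+ 2.
  have -> : M ^+ 4 * x ^+ 2 = (M * (M * x)) ^+ 2 by ring.
  rewrite ler_pXn2r ?nnegrE ?(mulr_ge0 M_ge0) ?(mulr_ge0 M_ge0 x0) //.
  exact: ler_pM.
have hR : fro (X1 *m b1 + X2 *m b2) <= N * (52 * M ^+ 4 * x ^+ 2).
  have -> : X1 *m b1 + X2 *m b2 = (X1 *m b1 + X2 *m (b2 - th2)) + X2 *m th2.
    by rewrite -addrA -mulmxDr subrK.
  rewrite (le_trans (froD_le2 _ _)) //.
  have h1 : fro (X1 *m b1 + X2 *m (b2 - th2)) <= E.
    by rewrite /E /bias_energy lerDl -cE mulr_ge0 ?addr_ge0 ?fro_ge0 // ltW.
  have h2 := gd_zeta gd; rewrite -/N -/rho in h2.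
  have h3 := ler_wpM2l (ltW N_gt0) hr2.
  lra.
have hF : fro KW <= N * (64 * M ^+ 4 * D + 2 * (M ^+ 3 * rho)).
  have h := var_in_upper s sN_gt0 tau_gt0 l_ge0 K_ge0 Z1_le X2_le.
  rewrite -cE -/N -/X -/W -/VH -/KW sN2 in h.
  rewrite (le_trans h) // mulrDr; apply: lerD.
    have := ler_wpM2l (ltW N_gt0) hVH; lra.
  rewrite ler_pdivrMr ?exprn_gt0 // rhoE tauE.
  have h1 : K ^+ 2 * rho <= M ^+ 2 * (M * x ^+ 2).
    by rewrite ler_pM ?sqr_ge0 // ler_pXn2r ?nnegrE.
  have h2 : 0 <= N * rho * g ^+ 2 by nonneg.
  have := ler_wpM2l h2 h1; lra.
rewrite ridge_risk_inE ler_pdivrMr //.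
have hV : sg2 * fro KW <= M * (N * (64 * M ^+ 4 * D + 2 * (M ^+ 3 * rho))).
  by apply: ler_pM => //; rewrite ?fro_ge0 ?(le_trans sgK).
have D0 : 0 <= D by case/andP: D01.
set m := Num.max _ _; have m1 : rho <= m by rewrite le_max lexx.
have m2 : D <= m by rewrite le_max lexx orbT.
have M7 : 0 <= M ^+ 7 by rewrite exprn_ge0.
have h1 : M ^+ 4 * x ^+ 2 <= M ^+ 4 * (M * rho).
  by rewrite ler_wpM2l // exprn_ge0.
have h2 := ler_wpM2r D0 (Mle 5%N 7%N isT).
have h3 := ler_wpM2r rho_ge0 (Mle 4%N 7%N isT).
have h3' := ler_wpM2r rho_ge0 (Mle 5%N 7%N isT).
have h4 := ler_wpM2l M7 m1; have h5 := ler_wpM2l M7 m2.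
have h6 : 0 <= M ^+ 7 * m by rewrite (le_trans _ h5) // mulr_ge0.
have h7 : 52 * M ^+ 4 * x ^+ 2 + M * (64 * M ^+ 4 * D + 2 * (M ^+ 3 * rho)) <= 600 * M ^+ 7 * m.
  lra.
have := ler_wpM2r (ltW N_gt0) h7.
lra.
Qed.

End RiskBounds.

(** * Nets of the unit ball *)

Section Net.
Variable R : realType.

Lemma bin_le_exp2 n k : ('C(n, k) <= 2 ^ n)%N.
Proof.
rewrite -[n in X in (X <= _)%N]card_ord -card_draws.
rewrite -[X in (2 ^ X)%N](card_ord n) -cardsT -card_powerset subset_leq_card //.
by apply/fintype.subsetP => A _; rewrite powersetE finset.subsetT.
Qed.

(** The coordinates of [u] are multiplied by [a], with a^2 = 16 m, and rounded towards 0. The error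
    is at most 1 / a per coordinate, in all m / a^2 = 1 / 16, and the point stays in the ball. The
    absolute values are naturals whose squares, hence also themselves, sum to at most 16 m: at most
    C(17 m, m) <= 2^(17 m) choices, times 2^m signs. *)
Lemma sphere_net m : exists (I : finType) (v : I -> 'cV[R]_m),
  [/\ (#|I| <= 2 ^ (18 * m))%N, forall i, fro (v i) <= 1 &
      forall u : 'cV_m, fro u <= 1 -> exists i, fro (u - v i) <= 16^-1].
Proof.
pose M := (16 * m)%N.
pose A := [set t : m.-tuple 'I_M.+1 | (\sum_(i < m) tnth t i ^ 2 <= M)%N].
pose a : R := 4 * Num.sqrt m%:R.
pose I := ({t | t \in A} * m.-tuple bool)%type.
pose v (ts : I) : 'cV[R]_m :=
  \col_i ((if tnth ts.2 i then 1 else -1) * (tnth (val ts.1) i)%:R / a).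
have a2 : a ^+ 2 = M%:R.
  by rewrite /a exprMn sqr_sqrtr ?ler0n // natrM; congr (_ * _); ring.
have a0 (i : 'I_m) : 0 < a.
  by rewrite mulr_gt0 // sqrtr_gt0 ltr0n (leq_trans _ (ltn_ord i)).
have M0 (i : 'I_m) : 0 < M%:R :> R by rewrite -a2 exprn_gt0 // (a0 i).
clearbody a.
exists I, v; split.
- rewrite card_prod card_sig card_tuple card_bool -[18%N]/(17 + 1)%N mulnDl mul1n expnD.
  rewrite leq_mul2r; apply/orP; right.
  rewrite -[17%N]/(1 + 16)%N mulnDl mul1n (leq_trans _ (bin_le_exp2 _ m)) //.
  rewrite -card_partial_ord_partitions subset_leq_card //.
  apply/fintype.subsetP => t; rewrite !inE => h; rewrite (leq_trans _ h) //.
  rewrite big_tuple; apply: leq_sum => i _.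
  by case: (nat_of_ord _) => // k; rewrite -mulnn leq_pmulr.
- move=> [[t tA] s]; rewrite /fro /mdot.
  case: (posnP m) => [m0|m0].
    rewrite big1 // => i; by have := ltn_ord i; rewrite {2}m0.
  have i0 := Ordinal m0.
  have -> : \sum_i \sum_j v (exist _ t tA, s) i j * v (exist _ t tA, s) i j =
      (\sum_(i < m) tnth t i ^ 2)%:R / M%:R.
    rewrite natr_sum mulr_suml; apply: eq_bigr => i _; rewrite big_ord1 !mxE /= natrX.
    rewrite -a2 -[LHS]expr2 !exprMn exprVn; congr (_ / _).
    by case: (tnth s i); rewrite ?sqrrN expr1n mul1r.
  rewrite ler_pdivrMr ?(M0 i0) // mul1r ler_nat.
  by move: tA; rewrite inE.
- move=> u u1.
  pose k i := Num.truncn (a * `|u i ord0|).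
  have kle i : (k i)%:R <= a * `|u i ord0|.
    by rewrite truncn_le mulr_ge0 // ltW // (a0 i).
  have kgt i : a * `|u i ord0| < (k i)%:R + 1.
    by rewrite natr1 -truncn_le_nat.
  have uE : fro u = \sum_i u i ord0 ^+ 2.
    by apply: eq_bigr => i _; rewrite big_ord1 expr2.
  have ksum : (\sum_(i < m) k i ^ 2 <= M)%N.
    rewrite -(ler_nat R) natr_sum -a2 -[leRHS]mulr1.
    apply: (@le_trans _ _ (a ^+ 2 * fro u)); last by rewrite ler_wpM2l ?sqr_ge0.
    rewrite uE mulr_sumr; apply: ler_sum => i _.
    rewrite natrX -[u i ord0 ^+ 2]real_normK ?num_real // -exprMn.
    by rewrite ler_pXn2r ?nnegrE ?ler0n // (le_trans _ (kle i)).
  have kM i : (k i < M.+1)%N.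
    rewrite ltnS (leq_trans _ ksum) // (bigD1 i) //= (leq_trans _ (leq_addr _ _)) //.
    by case: (k i) => // j; rewrite -mulnn leq_pmulr.
  pose t := [tuple Ordinal (kM i) | i < m].
  have tA : t \in A.
    by rewrite inE (leq_trans _ ksum) //; apply: leq_sum => i _; rewrite tnth_mktuple.
  pose s := [tuple (0 <= u i ord0) | i < m].
  exists (exist _ t tA, s).
  rewrite /fro /mdot; apply: (@le_trans _ _ (\sum_(i < m) a ^- 2)).
    apply: ler_sum => i _; rewrite big_ord1 -expr2 !mxE /= !tnth_mktuple /=.
    have h : `|u i ord0 - (if 0 <= u i ord0 then 1 else -1) * (k i)%:R / a| <= a^-1.
      have ap := a0 i.
      have h1 : `|u i ord0| - (k i)%:R / a <= a^-1.
        rewrite lerBlDl -[X in _ + X]mul1r -mulrDl ler_pdivlMr // mulrC ltW //; exact: kgt.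
      have h2 : 0 <= `|u i ord0| - (k i)%:R / a.
        by rewrite subr_ge0 ler_pdivrMr // mulrC.
      have [up|un] := leP 0 (u i ord0).
        by rewrite mul1r; move: h1 h2; rewrite (ger0_norm up) => h1 h2; rewrite ger0_norm.
      rewrite mulN1r mulNr opprK; move: h1 h2; rewrite (ltr0_norm un) => h1 h2.
      by rewrite ler0_norm ?opprD // -oppr_ge0 opprD.
    rewrite -exprVn -[leLHS]real_normK ?num_real //.
    by rewrite ler_pXn2r ?nnegrE ?invr_ge0 ?(ltW (a0 i)).
  rewrite sumr_const card_ord a2.
  case: (posnP m) => [->|m0]; first by rewrite mulr0n invr_ge0.
  have m1 : m%:R != 0 :> R by rewrite pnatr_eq0 -lt0n.
  by rewrite -[leLHS]mulr_natr /M natrM invfM mulfVK.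
Qed.

(* Iterating the second hypothesis from any bound [B] drives it down to [2 a]. *)
Lemma half_bound (T : Type) (S : T -> Prop) (f : T -> R) (a B : R) :
  (forall x, S x -> f x <= B) ->
  (forall C, (forall x, S x -> f x <= C) -> forall x, S x -> f x <= a + C / 2) ->
  forall x, S x -> f x <= 2 * a.
Proof.
move=> fB H x Sx.
pose A := [set f y | y in S]%classic.
have hA : has_sup A.
  by split; [exists (f x); exists x | exists B => _ [y Sy <-]; exact: fB].
have fs y : S y -> f y <= sup A.
  by move=> Sy; apply: sup_ubound; [exact: hA.2 | exists y].
have : sup A <= a + sup A / 2.
  by apply: ge_sup; [exact: hA.1 | move=> _ [y Sy <-]; exact: H].
have := fs x Sx; lra.
Qed.

(** Crude but finite, which is all that [half_bound] asks of its starting bound. *)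
Lemma opb_fro n m (Z : 'M[R]_(n, m)) : opb Z (fro Z).
Proof.
move=> v; rewrite (fro_rows Z) (fro_rows (Z *m v)) mulr_suml; apply: ler_sum => i _.
rewrite row_mul /fro /mdot big_ord1 big_ord1.
have -> : (row i Z *m v) ord0 ord0 = mdot (row i Z)^T v.
  by rewrite mxE; apply: eq_bigr => j _; rewrite big_ord1 !mxE.
by rewrite -expr2 (le_trans (mdot_cauchy _ _)) // fro_tr /fro /mdot big_ord1.
Qed.

Variables (n m : nat) (Z : 'M[R]_(n, m)) (I : finType) (v : I -> 'cV[R]_m).
Hypothesis v1 : forall i, fro (v i) <= 1.
Hypothesis v_net : forall u : 'cV_m, fro u <= 1 -> exists i, fro (u - v i) <= 16^-1.

(** [4 *: (u - v i)] lies in the unit ball, so passing to a net point costs a quarter of the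
    supremum. [half_bound] then gives twice the maximum over the net, and squaring makes the factor
    4. *)
Lemma net_op_bound (c : R) : (forall i, fro (Z *m v i) <= c) -> opb Z (4 * c).
Proof.
move=> Hc.
have c0 : 0 <= c.
  have [|i _] := v_net (u := 0); first by rewrite fro0.
  by rewrite (le_trans _ (Hc i)) ?fro_ge0.
have H : forall u : 'cV_m, fro u <= 1 -> nF (Z *m u) <= 2 * Num.sqrt c.
  apply: (@half_bound _ (fun u => fro u <= 1) _ _ (Num.sqrt (fro Z))).
    move=> u u1; rewrite ler_sqrt ?fro_ge0 // (le_trans (opb_fro _ _)) //.
    by rewrite ler_piMr ?fro_ge0.
  move=> C HC u u1; have [i ui] := v_net u1.
  have -> : Z *m u = Z *m v i + 4^-1 *: (Z *m (4 *: (u - v i))).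
    by rewrite -scalemxAr scalerA mulVf // scale1r mulmxBr addrCA subrr addr0.
  rewrite (le_trans (nFD _ _)) // lerD //.
    by rewrite ler_sqrt.
  rewrite nFZ ger0_norm ?invr_ge0 //.
  have h1 : nF (Z *m (4 *: (u - v i))) <= C by apply: HC; rewrite froZ; lra.
  have := nF_ge0 (Z *m (4 *: (u - v i))); lra.
move=> u; have [/fro_eq0 ->|u0] := eqVneq (fro u) 0.
  by rewrite mulmx0 !fro0 mulr0.
have up : 0 < fro u by rewrite lt_def u0 fro_ge0.
have h : fro ((nF u)^-1 *: u) <= 1 by rewrite froZ exprVn nF_sqr mulVf.
have := H _ h; rewrite -scalemxAr nF_le ?mulr_ge0 ?sqrtr_ge0 // froZ exprVn nF_sqr.
rewrite exprMn sqr_sqrtr // mulrC ler_pdivrMr //; lra.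
Qed.

(** The form [q] is not a squared norm, so the triangle inequality is replaced by polarisation: q u
    - q v is half a difference of two values of [q], and the parallelogram law keeps the total mass
    of these two points at most 1. *)
Lemma net_isometry (N del : R) : 0 <= N ->
  (forall i, `|fro (Z *m v i) - N * fro (v i)| <= del) ->
  forall u : 'cV_m, `|fro (Z *m u) - N * fro u| <= 2 * del * fro u.
Proof.
move=> N0 Hd; pose q (u : 'cV_m) := fro (Z *m u) - N * fro u.
have qZ a u : q (a *: u) = a ^+ 2 * q u.
  by rewrite /q -scalemxAr !froZ; ring.
have q0 : q 0 = 0 by rewrite /q mulmx0 !fro0 mulr0 subrr.
have homog (C : R) : (forall u, fro u <= 1 -> `|q u| <= C) -> forall u, `|q u| <= C * fro u.
  move=> HC u; have [/fro_eq0 ->|u0] := eqVneq (fro u) 0.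
    by rewrite q0 normr0 fro0 mulr0.
  have up : 0 < fro u by rewrite lt_def u0 fro_ge0.
  have h : fro ((nF u)^-1 *: u) <= 1 by rewrite froZ exprVn nF_sqr mulVf.
  have := HC _ h; rewrite qZ exprVn nF_sqr normrM gtr0_norm ?invr_gt0 //.
  by rewrite mulrC ler_pdivrMr.
apply: (homog).
apply: (@half_bound _ (fun u => fro u <= 1) _ _ (fro Z + N)).
  move=> u u1; rewrite (le_trans (ler_normB _ _)) //.
  rewrite !ger0_norm ?fro_ge0 ?mulr_ge0 ?fro_ge0 // lerD //.
    by rewrite (le_trans (opb_fro _ _)) // ler_piMr ?fro_ge0.
  by rewrite ler_piMr.
move=> C HC u u1; have [i ui] := v_net u1; have hC := homog C HC.
(* The small factor u - v is scaled up by 4 and the large factor u + v down by 2: both vectors lie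
   in the unit ball, and their product retains a factor 1 / 2. *)
set w := 4 *: (u - v i); set y := 2^-1 *: (u + v i).
have qE : q u - q (v i) = 2^-1 * (q (2^-1 *: (w + y)) - q (2^-1 *: (w - y))).
  rewrite !qZ /q !mulmxDr !mulmxN !froD !mdotNr !froN /w /y.
  rewrite -!scalemxAr !mulmxDr !mulmxN !mdotZl !mdotZr !froZ !mdotDl !mdotDr !mdotNl.
  rewrite -/(fro (Z *m u)) -/(fro (Z *m v i)) -/(fro u) -/(fro (v i)).
  rewrite (mdotC (Z *m v i)) (mdotC (v i)); by field.
have fw : fro w <= 1 by rewrite froZ; lra.
have fy : fro y <= 1.
  have := froD_le2 u (v i); have := v1 i; rewrite froZ exprVn; lra.
have pl : fro (2^-1 *: (w + y)) + fro (2^-1 *: (w - y)) = (fro w + fro y) / 2.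
  by rewrite (froZ _ (w + y)) (froZ _ (w - y)) (froD w y) (froD w (- y)) mdotNr froN; field.
have C0 : 0 <= C.
  by apply: le_trans (HC 0 _); rewrite ?fro0 // q0 normr0.
have h1 := hC (2^-1 *: (w + y)); have h2 := hC (2^-1 *: (w - y)).
have -> : q u = q (v i) + (q u - q (v i)) by rewrite addrC subrK.
rewrite (le_trans (ler_normD _ _)) // lerD ?Hd //.
rewrite qE normrM gtr0_norm ?invr_gt0 // mulrC ler_wpM2r ?invr_ge0 //.
rewrite (le_trans (ler_normB _ _)) // (le_trans (lerD h1 h2)) // -mulrDr pl.
rewrite ler_piMr //; lra.
Qed.

End Net.
Local Open Scope classical_set_scope.

(** * Independence and concentration *)

Section ProductRule.
Local Open Scope ereal_scope.
Context d (T : measurableType d) (R : realType) (P : probability T R).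

Import HBNNSimple.

(* The hypothesis says that [Y] is independent of the density [U], whose mass is [e]. *)
Lemma integral_mul_nnsfun (U Y : T -> R) (e : R) (h : {nnsfun R >-> R}) :
  measurable_fun setT U -> (forall w, (0 <= U w)%R) ->
  measurable_fun setT Y ->
  (forall C, measurable C ->
     \int[P]_w (U w * \1_(Y @^-1` C) w)%:E = e%:E * P (Y @^-1` C)) ->
  \int[P]_w (U w * h (Y w))%:E = e%:E * \int[P]_w (h (Y w))%:E.
Proof.
move=> mU U0 mY H.
have mI (r : R) : measurable (Y @^-1` (h @^-1` [set r])).
  by rewrite -[X in measurable X]setTI; apply: mY.
have hE w : h (Y w) = (\sum_(r \in range h) (r * \1_(Y @^-1` (h @^-1` [set r])) w))%R.
  by rewrite fimfunE.
have m1 r : measurable_fun setT (EFin \o (fun w => r * \1_(Y @^-1` (h @^-1` [set r])) w : R)%R).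
  by apply/measurable_EFinP; apply: measurable_funM => //; exact: measurable_indic.
have h0 r w : (0 <= r * \1_(Y @^-1` (h @^-1` [set r])) w)%R.
  rewrite indicE; have [|] := boolP (w \in _); rewrite ?mulr0 ?mulr1 //.
  by rewrite inE /= => <-.
under eq_integral.
  move=> w _; rewrite hE EFinM -fsumEFin // ge0_mule_fsumr; last by move=> r; rewrite lee_fin.
  over.
rewrite ge0_integral_fsum//; last 2 first.
- by move=> r; apply: emeasurable_funM; [exact/measurable_EFinP|exact: m1].
- by move=> r w _; rewrite mule_ge0 // lee_fin.
under [X in _ = _ * X]eq_integral.
  move=> w _; rewrite hE -fsumEFin //; over.
rewrite [X in _ = _ * X]ge0_integral_fsum//; last by move=> r w _; rewrite lee_fin.
rewrite ge0_mule_fsumr; last by move=> r; apply: integral_ge0 => w _; rewrite lee_fin.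
apply: eq_fsbigr => r /[!inE] -[y _ hy].
have r0 : (0 <= r)%R by rewrite -hy.
under eq_integral do rewrite -EFinM mulrCA EFinM.
rewrite ge0_integralZl_EFin //; last 2 first.
- by move=> w _; rewrite lee_fin mulr_ge0.
- apply/measurable_EFinP; apply: measurable_funM => //; exact: measurable_indic.
under [X in _ = _ * X]eq_integral do rewrite EFinM.
rewrite [X in _ = _ * X]ge0_integralZl_EFin //; last first.
  by apply/measurable_EFinP; exact: measurable_indic.
rewrite integral_indic // setIT H //.
by rewrite muleCA.
Qed.

Lemma integral_mul_factor (U Y : T -> R) (e : R) :
  measurable_fun setT U -> (forall w, (0 <= U w)%R) ->
  measurable_fun setT Y -> (forall w, (0 <= Y w)%R) -> (0 <= e)%R ->
  (forall C, measurable C ->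
     \int[P]_w (U w * \1_(Y @^-1` C) w)%:E = e%:E * P (Y @^-1` C)) ->
  \int[P]_w (U w * Y w)%:E = e%:E * \int[P]_w (Y w)%:E.
Proof.
move=> mU U0 mY Y0 e0 H.
(* The approximation is made for |y|, which is nonnegative on the whole line and agrees with y on
   the values of [Y]. *)
have mf : measurable_fun [set: R] (EFin \o (fun y : R => `|y| : R)%R).
  by apply/measurable_EFinP; exact: measurableT_comp.
pose h := nnsfun_approx measurableT mf.
have hcvg w : (fun n => (h n (Y w))%:E) @ \oo --> (Y w)%:E.
  have := @cvg_nnsfun_approx _ _ _ _ measurableT _ mf _ (Y w) I.
  by rewrite /= ger0_norm //; apply => y _ /=; rewrite lee_fin.
have mh n : measurable_fun setT (fun w => h n (Y w)).
  by apply: measurableT_comp.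
have ndh w : nondecreasing_seq (fun n => h n (Y w)).
  by move=> a b ab; exact/lefP/nd_nnsfun_approx.
transitivity (limn (fun n => \int[P]_w (U w * h n (Y w))%:E)).
  rewrite -monotone_convergence //=.
  - apply: eq_integral => w _; apply/esym/cvg_lim => //=.
    under eq_fun do rewrite EFinM.
    by rewrite EFinM; apply: cvgeZl => //; exact: hcvg.
  - by move=> n; apply/measurable_EFinP; exact: measurable_funM.
  - by move=> n w _; rewrite lee_fin mulr_ge0.
  - by move=> w _ a b ab; rewrite lee_fin ler_wpM2l //; exact: ndh.
rewrite (_ : \int[P]_w (Y w)%:E = limn (fun n => \int[P]_w (h n (Y w))%:E)); last first.
  rewrite -monotone_convergence//=.
  - by apply: eq_integral => w _; apply/esym/cvg_lim => //; exact: hcvg.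
  - by move=> n; exact/measurable_EFinP.
  - by move=> n w _; rewrite lee_fin.
  - by move=> w _ a b ab; rewrite lee_fin; exact: ndh.
rewrite -limeMl//.
  by congr (limn _); apply/funext => n; rewrite (integral_mul_nnsfun _ mU U0 mY H).
apply/ereal_nondecreasing_is_cvgn => a b ab; apply: ge0_le_integral => //.
- by move=> x _; rewrite lee_fin.
- exact/measurable_EFinP.
- exact/measurable_EFinP.
- by move=> x _; rewrite lee_fin; exact: ndh.
Qed.

(** Independence gives the rule for indicators, and these are replaced by the functions [Y i] one
    index at a time. In the claim [K] the indicators that remain are those of arbitrary sets, which
    is what makes the induction close. *)
Lemma integral_prod_indep n (Y : 'I_n -> T -> R) :
  (forall i, measurable_fun setT (Y i)) -> (forall i w, (0 <= Y i w)%R) ->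
  (forall i, \int[P]_w (Y i w)%:E < +oo) ->
  (forall B : 'I_n -> set R, (forall i, measurable (B i)) ->
    P [set w | forall i, B i (Y i w)] = \prod_(i < n) P (Y i @^-1` B i)) ->
  \int[P]_w (\prod_i Y i w)%:E = \prod_i \int[P]_w (Y i w)%:E.
Proof.
move=> mY Y0 fY H.
have fE i : (fine (\int[P]_w (Y i w)%:E))%:E = \int[P]_w (Y i w)%:E.
  by rewrite fineK // ge0_fin_numE // integral_ge0 // => w _; rewrite lee_fin.
pose E i := fine (\int[P]_w (Y i w)%:E).
have E0 i : (0 <= E i)%R by rewrite fine_ge0 // integral_ge0 // => w _; rewrite lee_fin.
have mYB i B : measurable B -> measurable (Y i @^-1` B).
  by move=> mB; rewrite -[X in measurable X]setTI; exact: mY.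
suff K k (B : 'I_n -> set R) : (k <= n)%N -> (forall i, measurable (B i)) ->
    \int[P]_w (\prod_(i < n) (if (i < k)%N then Y i w else \1_(Y i @^-1` B i) w))%:E =
    (\prod_(i < n) (if (i < k)%N then E i else fine (P (Y i @^-1` B i))))%:E.
  have := K n (fun=> setT) (leqnn _) (fun=> measurableT).
  under eq_integral do under eq_bigr do rewrite ltn_ord.
  move=> ->; rewrite -prodEFin; apply: eq_bigr => i _.
  by rewrite ltn_ord fE.
elim: k B => [|k IH] B kn mB.
  have -> : (fun w => (\prod_(i < n) (if (i < 0)%N then Y i w else \1_(Y i @^-1` B i) w))%:E) =
      (fun w => (\1_([set w | forall i, B i (Y i w)]) w)%:E).
    apply/funext => w; congr (_%:E); rewrite indicE.
    have [wB|wB] := boolP (w \in _).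
      rewrite big1 // => i _; rewrite indicE mem_set //.
      by move: wB; rewrite inE /=.
    have [i Bi] : exists i, ~ B i (Y i w).
      by apply/existsNP => h; move/negP: wB; apply; rewrite inE.
    by rewrite (bigD1 i) //= indicE memNset // mul0r.
  have mS : measurable [set w | forall i, B i (Y i w)].
    have -> : [set w | forall i, B i (Y i w)] = \big[setI/setT]_(i < n) (Y i @^-1` B i).
      rewrite -bigcap_seq; apply/seteqP; split=> w /= h i.
        by move=> _; exact: h.
      by apply: h; rewrite /= mem_index_enum.
    by apply: bigsetI_measurable => i _; exact: mYB.
  transitivity (P [set w | forall i, B i (Y i w)]).
    by rewrite integral_indic // setIT.
  rewrite H // -prodEFin; apply: eq_bigr => i _.
  by rewrite fineK // fin_num_measure //; exact: mYB.
pose k' : 'I_n := Ordinal kn.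
have pE (f : 'I_n -> R) : (\prod_i f i = (\prod_(i | i != k') f i) * f k')%R.
  by rewrite (bigD1 k') //= mulrC.
pose U w := (\prod_(i | i != k') (if ((i : 'I_n) < k.+1)%N then Y i w else \1_(Y i @^-1` B i) w))%R.
pose e := (\prod_(i | i != k') (if (i < k.+1)%N then E i else fine (P (Y i @^-1` B i))))%R.
have ik (i : 'I_n) : i != k' -> (i < k.+1)%N = (i < k)%N.
  by move=> ik; rewrite ltnS leq_eqVlt; move: ik; rewrite -val_eqE /= => /negbTE ->.
under eq_integral do rewrite pE ltnSn.
rewrite pE ltnSn -/e EFinM [X in _ * X]fE.
apply: integral_mul_factor => //.
- under eq_fun do rewrite big_mkcond /=.
  have mh (i : 'I_n) : measurable_fun [set: T] (fun w => (if i != k' then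
      if (i < k.+1)%N then Y i w else \1_(Y i @^-1` B i) w else 1)%R : R).
    case: (i != k') => //; case: (i < k.+1)%N; first exact: mY.
    by apply: measurable_indic; exact: mYB.
  exact: (measurable_prod (fun i _ => mh i)).
- by move=> w; apply: prodr_ge0 => i _; case: ifP.
- by apply: prodr_ge0 => i _; case: ifP => _ //; rewrite fine_ge0.
move=> C mC.
(* The induction hypothesis with an arbitrary set in slot [k'] is the independence required by
   [integral_mul_factor]. *)
pose B' i := if i == k' then C else B i.
have mB' i : measurable (B' i) by rewrite /B'; case: ifP.
have := IH B' (ltnW kn) mB'.
under eq_integral do rewrite pE ltnn.
rewrite pE ltnn {1}/B' {3}/B' eqxx EFinM fineK ?fin_num_measure //; last exact: mYB.
have -> : (\prod_(i | i != k') (if (i < k)%N then E i else fine (P (Y i @^-1` B' i))))%R = e.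
  by apply: eq_bigr => i ni; rewrite ik // /B' (negbTE ni).
move=> <-; apply: eq_integral => w _; congr (_%:E); congr (_ * _)%R; last first.
  by rewrite /B' eqxx.
by apply: eq_bigr => i ni; rewrite ik // /B' (negbTE ni).
Qed.

End ProductRule.

Section HighProbability.
Context d (T : measurableType d) (R : realType) (P : probability T R).
Implicit Types (e : R) (Q : T -> Prop).

(* [Q] itself need not be measurable. *)
Definition whp e Q := exists E : set T,
  [/\ measurable E, (P (~` E) <= e%:E)%E & forall w, E w -> Q w].

Lemma whp_imp e e' Q Q' : e <= e' -> (forall w, Q w -> Q' w) ->
  whp e Q -> whp e' Q'.
Proof.
move=> ee QQ [E [mE PE EQ]]; exists E; split => //.
  by rewrite (le_trans PE) // lee_fin.
by move=> w /EQ /QQ.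
Qed.

Lemma whp_and e1 e2 Q1 Q2 : whp e1 Q1 -> whp e2 Q2 ->
  whp (e1 + e2) (fun w => Q1 w /\ Q2 w).
Proof.
move=> [E1 [mE1 PE1 EQ1]] [E2 [mE2 PE2 EQ2]]; exists (E1 `&` E2); split.
- exact: measurableI.
- rewrite setCI EFinD (le_trans (measureU2 _ _ _)) ?leeD //; exact: measurableC.
- by move=> w [/EQ1 ? /EQ2].
Qed.

Lemma whp_forall (I : finType) e (Q : I -> T -> Prop) :
  (forall i, whp e (Q i)) -> whp (#|I|%:R * e) (fun w => forall i, Q i w).
Proof.
move=> H; have : forall s : seq I, whp ((size s)%:R * e) (fun w => forall i, i \in s -> Q i w).
  elim=> [|i s IH].
    exists setT; split => //; first by rewrite setCT measure0 mul0r.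
  have := whp_and (H i) IH; apply: whp_imp.
    by rewrite /= -addn1 natrD mulrDl mul1r addrC.
  move=> w [Qi Qs] j; rewrite inE => /orP[/eqP->//|]; exact: Qs.
move=> /(_ (enum I)); apply: whp_imp; first by rewrite cardE.
by move=> w h i; apply: h; rewrite mem_enum.
Qed.

Lemma whp_ae Q : {ae P, forall w, Q w} -> whp 0 Q.
Proof.
move=> [N [mN PN QN]]; exists (~` N); split.
- exact: measurableC.
- by rewrite setCK PN.
- by move=> w Nw; apply/not_notP => nQ; apply: Nw; exact: QN.
Qed.

Lemma whp_markov (Y : T -> R) (a b : R) : measurable_fun setT Y ->
  (forall w, 0 <= Y w) -> (\int[P]_w (Y w)%:E <= a%:E)%E -> 0 < b ->
  whp (a / b) (fun w => Y w <= b).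
Proof.
move=> mY Y0 Ya b0; exists (Y @^-1` [set y | y <= b]).
have mE : measurable (Y @^-1` [set y | y <= b]).
  rewrite -[X in measurable X]setTI; apply: mY => //.
  by rewrite -set_itvNyc; exact: measurable_itv.
split => //; have mC := measurableC mE; set C := ~` _ in mC *.
rewrite EFinM lee_pdivlMr //.
have -> : (P C * b%:E = \int[P]_w (b * \1_C w)%:E)%E.
  under eq_integral do rewrite EFinM.
  rewrite ge0_integralZl_EFin //.
  - by rewrite integral_indic // setIT muleC.
  - by apply/measurable_EFinP; exact: measurable_indic.
  - exact: ltW.
apply: le_trans Ya; apply: ge0_le_integral => //.
- by move=> w _; rewrite lee_fin mulr_ge0 // ltW.
- by apply/measurable_EFinP; apply: measurable_funM => //; exact: measurable_indic.
- exact/measurable_EFinP.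
- move=> w _; rewrite lee_fin indicE; have [|] := boolP (w \in _); rewrite ?mulr0 ?mulr1 //.
  by rewrite inE /C /= => /negP; rewrite -ltNge => /ltW.
Qed.

End HighProbability.

Section Integrals.
Context d (T : measurableType d) (R : realType) (P : probability T R).

Lemma ge0_integrable (f : T -> R) (c : R) : measurable_fun setT f ->
  (forall w, 0 <= f w) -> (\int[P]_w (f w)%:E <= c%:E)%E ->
  P.-integrable setT (EFin \o f).
Proof.
move=> mf f0 fc; apply/integrableP; split; first exact/measurable_EFinP.
rewrite (le_lt_trans _ (ltry c)) // (le_trans _ fc) // le_eqVlt; apply/orP; left.
by apply/eqP; apply: eq_integral => w _ /=; rewrite ger0_norm.
Qed.

Lemma integral_affine (f g : T -> R) (a b c F G : R) :
  P.-integrable setT (EFin \o f) -> P.-integrable setT (EFin \o g) ->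
  (\int[P]_w (f w)%:E = F%:E)%E -> (\int[P]_w (g w)%:E = G%:E)%E ->
  (\int[P]_w (a * f w + b * g w + c)%:E = (a * F + b * G + c)%:E)%E.
Proof.
move=> fi gi fF gG.
under eq_integral do rewrite !EFinD !EFinM.
have ai : P.-integrable setT (fun w => a%:E * (f w)%:E)%E by exact: integrableZl.
have bi : P.-integrable setT (fun w => b%:E * (g w)%:E)%E by exact: integrableZl.
have ci : P.-integrable setT (fun=> c%:E)%E by exact: finite_measure_integrable_cst.
rewrite integralD //; last exact: integrableD.
have -> : (\int[P]_x c%:E = c%:E)%E.
  rewrite integral_cst //.
  by rewrite [X in (_ * X)%E](probability_setT P) mule1.
rewrite integralD // !integralZl // fF gG.
by rewrite !EFinD !EFinM.
Qed.

End Integrals.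

Section ExpBounds.
Variable R : realType.

Lemma expR_ge_sqr (x : R) : 0 <= x -> x ^+ 2 <= 4 * expR x.
Proof.
move=> x0; have -> : expR x = expR (x / 2) ^+ 2 by rewrite -expRM_natl; congr expR; field.
have h := expR_ge1Dx (x / 2); have h0 := expR_ge0 (x / 2).
have : (x / 2) ^+ 2 <= expR (x / 2) ^+ 2 by rewrite ler_pXn2r ?nnegrE //; lra.
rewrite exprMn; lra.
Qed.

Lemma expR_le_quad (x : R) : 0 <= x -> expR x <= 1 + x + x ^+ 2 * expR x.
Proof.
move=> x0; have h := expR_ge1Dx (- x); have e0 := expR_gt0 x.
have h1 : expR x - 1 <= x * expR x.
  have : (1 - x) * expR x <= 1.
    by rewrite (le_trans (ler_wpM2r (ltW e0) h)) // mulrC expRxMexpNx_1.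
  lra.
have := ler_wpM2l x0 h1; lra.
Qed.

Lemma expRN_le_quad (x : R) : 0 <= x -> expR (- x) <= 1 - x + x ^+ 2.
Proof.
move=> x0; rewrite expRN.
have h := expR_ge1Dx x; have p : 0 < 1 + x by lra.
rewrite (@le_trans _ _ (1 + x)^-1) // ?lef_pV2 ?posrE ?expR_gt0 //.
rewrite -[leLHS]mul1r ler_pdivrMr //.
have : 0 <= x ^+ 3 by rewrite exprn_ge0.
lra.
Qed.

(** Taylor expansion at z = a w with remainder z^2 e^max(0, z). The exponential moment at 1 / psi is
    split in two halves: one bounds w^2, the other the exponential of the remainder, and the range
    of [a] is chosen for the latter. *)
Lemma expR_mgf_bound (a w psi : R) : 0 < psi -> 0 <= w -> `|a| <= (2 * psi)^-1 ->
  expR (a * w) <= 1 + a * w + 16 * a ^+ 2 * psi ^+ 2 * expR (w / psi).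
Proof.
move=> psi0 w0 apsi.
have hw : w ^+ 2 <= 16 * psi ^+ 2 * expR (w / psi / 2).
  have h := @expR_ge_sqr (w / psi / 2).
  have : (w / psi / 2) ^+ 2 <= 4 * expR (w / psi / 2).
    by apply: h; rewrite !divr_ge0 // ltW.
  move=> /(ler_wpM2l (_ : 0 <= 4 * psi ^+ 2)) -/(_ _)/wrap[].
    by rewrite mulr_ge0 ?sqr_ge0.
  rewrite (_ : 4 * psi ^+ 2 * (w / psi / 2) ^+ 2 = w ^+ 2); last by field; rewrite gt_eqF.
  lra.
have hq : (a * w) ^+ 2 * expR (Num.max 0 (a * w)) <= 16 * a ^+ 2 * psi ^+ 2 * expR (w / psi).
  have -> : expR (w / psi) = expR (w / psi / 2) * expR (w / psi / 2).
    by rewrite -expRD; congr expR; field; rewrite gt_eqF.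
  have h2 : expR (Num.max 0 (a * w)) <= expR (w / psi / 2).
    rewrite ler_expR ge_max !divr_ge0 ?(ltW psi0) //=.
    have : a * w <= (2 * psi)^-1 * w by rewrite ler_wpM2r // (le_trans (ler_norm a)).
    by rewrite invfM; lra.
  have h3 : (a * w) ^+ 2 <= 16 * a ^+ 2 * psi ^+ 2 * expR (w / psi / 2).
    by rewrite exprMn; have := ler_wpM2l (sqr_ge0 a) hw; lra.
  have := ler_pM (sqr_ge0 (a * w)) (expR_ge0 _) h3 h2; lra.
have [aw|aw] := leP 0 (a * w).
  have := expR_le_quad aw; rewrite (max_idPr aw) in hq; lra.
have := @expRN_le_quad (- (a * w)); rewrite opprK sqrrN => h.
have /h h' : 0 <= - (a * w) by lra.
rewrite (max_idPl (ltW aw)) expR0 in hq; lra.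
Qed.

End ExpBounds.

Section Chernoff.
Context d (T : measurableType d) (R : realType) (P : probability T R).
Variables (n : nat) (W : 'I_n -> T -> R) (psi : R).
Hypothesis mW : forall i, measurable_fun setT (W i).
Hypothesis W0 : forall i w, 0 <= W i w.
(** Independence enters Chernoff's method only through this product rule for one common [f]. *)
Hypothesis W_indep : forall f : R -> R, measurable_fun setT f ->
  (forall x, 0 <= f x) -> (forall i, \int[P]_w (f (W i w))%:E < +oo)%E ->
  (\int[P]_w (\prod_i f (W i w))%:E = \prod_i \int[P]_w (f (W i w))%:E)%E.
Hypothesis psi1 : 1 <= psi.
Hypothesis W_psi : forall i, (\int[P]_w (expR (W i w / psi))%:E <= 2%:E)%E.

Let psi0 : 0 < psi. Proof. exact: lt_le_trans psi1. Qed.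

Lemma prod_mgf_le (a b : R) :
  (forall i, \int[P]_w (expR (a * W i w))%:E <= b%:E)%E ->
  (\int[P]_w (expR (a * \sum_i W i w))%:E <= (b ^+ n)%:E)%E.
Proof.
move=> H.
have -> : (\int[P]_w (expR (a * \sum_i W i w))%:E = \int[P]_w (\prod_i expR (a * W i w))%:E)%E.
  by apply: eq_integral => w _; rewrite mulr_sumr expR_sum.
have mf : measurable_fun [set: R] (fun x : R => expR (a * x)).
  by apply: measurableT_comp => //; exact: mulrl_measurable.
rewrite (W_indep mf) //; last by move=> i; rewrite (le_lt_trans (H i)) // ltry.
have b0 i : (0 <= \int[P]_w (expR (a * W i w))%:E)%E.
  by apply: integral_ge0 => w _; rewrite lee_fin expR_ge0.
have -> : b ^+ n = \prod_(i < n) b by rewrite prodr_const card_ord.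
rewrite -prodEFin.
suff /andP[] : ((0 <= \prod_i \int[P]_w (expR (a * W i w))%:E) &&
  (\prod_i \int[P]_w (expR (a * W i w))%:E <= \prod_(i < n) b%:E))%E by [].
elim/big_rec2 : _ => [|i x y _ /andP[x0 xy]]; first by rewrite lee01 lexx.
by rewrite mule_ge0 // lee_pmul.
Qed.

Lemma whp_exp_sum : (\int[P]_w (expR (psi^-1 * \sum_i W i w))%:E <= (2 ^+ n)%:E)%E.
Proof.
apply: prod_mgf_le => i; apply: le_trans (W_psi i).
by under eq_integral do rewrite mulrC.
Qed.

Hypothesis W_mean : forall i, (\int[P]_w (W i w)%:E = 1%:E)%E.

Lemma mgf_le (a : R) i : `|a| <= (2 * psi)^-1 ->
  (\int[P]_w (expR (a * W i w))%:E <= (expR (a + 32 * a ^+ 2 * psi ^+ 2))%:E)%E.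
Proof.
move=> ap.
have me : measurable_fun [set: T] (fun w => expR (W i w / psi)).
  apply: measurableT_comp => //; apply: measurable_funM => //.
have ie := ge0_integrable me (fun w => expR_ge0 _) (W_psi i).
have iW : P.-integrable setT (EFin \o W i).
  by apply: (@ge0_integrable _ _ _ _ _ 1) => //; rewrite W_mean.
have [G GE] : exists G, (\int[P]_w (expR (W i w / psi))%:E = G%:E)%E.
  by exists (fine (\int[P]_w (expR (W i w / psi))%:E)); rewrite fineK // integrable_fin_num.
have G2 : G <= 2 by rewrite -lee_fin -GE.
apply: (@le_trans _ _ (\int[P]_w (a * W i w + 16 * a ^+ 2 * psi ^+ 2 * expR (W i w / psi) + 1)%:E)%E).
  apply: ge0_le_integral => //.
  - apply/measurable_EFinP; apply: measurableT_comp => //; exact: measurable_funM.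
  - apply/measurable_EFinP; apply: measurable_funD => //; apply: measurable_funD; exact: measurable_funM.
  - by move=> w _; rewrite lee_fin; have := expR_mgf_bound psi0 (W0 i w) ap; lra.
rewrite (integral_affine _ _ _ iW ie (W_mean i) GE) lee_fin.
have h := expR_ge1Dx (a + 32 * a ^+ 2 * psi ^+ 2).
have : 16 * a ^+ 2 * psi ^+ 2 * G <= 16 * a ^+ 2 * psi ^+ 2 * 2.
  rewrite ler_wpM2l //; apply: mulr_ge0; last exact: sqr_ge0.
  by apply: mulr_ge0; last exact: sqr_ge0.
lra.
Qed.

Lemma whp_concentration (del : R) : 0 < del <= 1 ->
  whp P (2 * expR (- (n%:R * del ^+ 2 / (128 * psi ^+ 2))))
    (fun w => `|\sum_i W i w - n%:R| <= del * n%:R).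
Proof.
move=> /andP[del0 del1].
(* Minimises - a del + 32 a^2 psi^2, with value - del^2 / (128 psi^2). Both tails use it, with b = a
   and b = - a. *)
pose a := del / (64 * psi ^+ 2).
have a0 : 0 < a by rewrite divr_gt0 ?mulr_gt0 ?exprn_gt0.
have ap : a <= (2 * psi)^-1.
  rewrite ler_pdivrMr ?mulr_gt0 ?exprn_gt0 //.
  rewrite (_ : (2 * psi)^-1 * (64 * psi ^+ 2) = 32 * psi); last by field; rewrite gt_eqF.
  by have := psi1; lra.
have half (b : R) : `|b| = a ->
    whp P (expR (- (n%:R * del ^+ 2 / (128 * psi ^+ 2))))
     (fun w => expR (b * \sum_i W i w) <= expR (b * n%:R + a * del * n%:R)).
  move=> ba.
  have := @whp_markov _ _ _ P (fun w => expR (b * \sum_i W i w))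
    (expR (b + 32 * b ^+ 2 * psi ^+ 2) ^+ n) (expR (b * n%:R + a * del * n%:R)).
  move=> /(_ _ _ _ _)/wrap[] //.
  - apply: measurableT_comp => //; apply: measurable_funM => //.
    exact: measurable_sum.
  - by apply: prod_mgf_le => i; apply: mgf_le; rewrite ba.
  - exact: expR_gt0.
  apply: whp_imp => //.
  rewrite -expRM_natl -expRN -expRD ler_expR.
  have -> : b ^+ 2 = a ^+ 2 by rewrite -ba real_normK // num_real.
  rewrite le_eqVlt; apply/orP; left; apply/eqP; rewrite /a; field.
  by rewrite gt_eqF.
have aa : `|a| = a by rewrite gtr0_norm.
have naa : `|- a| = a by rewrite normrN.
apply: whp_imp (whp_and (half _ aa) (half _ naa)); first by lra.
move=> w; rewrite !ler_expR => -[h1 h2]; rewrite ler_norml; apply/andP; split.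
  rewrite -(ler_pM2l a0); lra.
rewrite -(ler_pM2l a0); lra.
Qed.

End Chernoff.

(** * Random designs *)

Section MatrixMeasurable.
Variable R : realType.

(** These sets generate [mx_measurable]; [mxT] is the matrix type with that sigma-algebra, so that
    [measurable_fun] makes sense for matrix-valued functions and functions of a matrix. *)
Definition mx_gen m k : set (set 'M[R]_(m, k)) :=
  [set A | exists i j (B : set R), measurable B /\ A = [set M : 'M[R]_(m, k) | B (M i j)]].
Definition mxT m k := g_sigma_algebraType (@mx_gen m k).

Lemma random_mx_id m k : random_mx (fun M : mxT m k => (M : 'M[R]_(m, k))).
Proof.
move=> i j _ B mB; rewrite setTI; apply: sub_sigma_algebra.
by exists i, j, B.
Qed.

Context d (T : measurableType d).

Lemma random_mx_measurable m k (Z : T -> 'M[R]_(m, k)) :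
  random_mx Z -> measurable_fun [set: T] (Z : T -> mxT m k).
Proof.
move=> mZ; apply: (@measurability _ _ T (mxT m k) setT Z (@mx_gen m k)) => //.
move=> _ [_ [i [j [B [mB ->]]]] <-].
exact: (mZ i j measurableT B mB).
Qed.

Lemma random_mx_cst m k (A : 'M[R]_(m, k)) : random_mx (fun _ : T => A).
Proof. by move=> i j; exact: measurable_cst. Qed.

Lemma random_mxD m k (Y Z : T -> 'M[R]_(m, k)) :
  random_mx Y -> random_mx Z -> random_mx (fun w => Y w + Z w).
Proof.
move=> mY mZ i j; under eq_fun do rewrite mxE.
exact: measurable_funD.
Qed.

Lemma random_mxZ m k (f : T -> R) (Z : T -> 'M[R]_(m, k)) :
  measurable_fun setT f -> random_mx Z -> random_mx (fun w => f w *: Z w).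
Proof.
move=> mf mZ i j; under eq_fun do rewrite mxE.
exact: measurable_funM.
Qed.

Lemma random_mxN m k (Z : T -> 'M[R]_(m, k)) :
  random_mx Z -> random_mx (fun w => - Z w).
Proof.
move=> mZ; under eq_fun do rewrite -scaleN1r.
by apply: random_mxZ => //; exact: measurable_cst.
Qed.

Lemma random_mxM m h k (Y : T -> 'M[R]_(m, h)) (Z : T -> 'M[R]_(h, k)) :
  random_mx Y -> random_mx Z -> random_mx (fun w => Y w *m Z w).
Proof.
move=> mY mZ i j; under eq_fun do rewrite mxE.
apply: measurable_sum => l; exact: measurable_funM.
Qed.

Lemma random_mx_tr m k (Z : T -> 'M[R]_(m, k)) :
  random_mx Z -> random_mx (fun w => (Z w)^T).
Proof. by move=> mZ i j; under eq_fun do rewrite mxE; exact: mZ. Qed.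

Lemma random_mx_row m k (Z : T -> 'M[R]_(m, k)) i :
  random_mx Z -> random_mx (fun w => row i (Z w)).
Proof. by move=> mZ i' j; under eq_fun do rewrite mxE; exact: mZ. Qed.

Lemma random_mx_rsub m k1 k2 (Z : T -> 'M[R]_(m, k1 + k2)) :
  random_mx Z -> random_mx (fun w => rsubmx (Z w)).
Proof. by move=> mZ i' j; under eq_fun do rewrite mxE; exact: mZ. Qed.

Lemma random_mx_lsub m k1 k2 (Z : T -> 'M[R]_(m, k1 + k2)) :
  random_mx Z -> random_mx (fun w => lsubmx (Z w)).
Proof. by move=> mZ i' j; under eq_fun do rewrite mxE; exact: mZ. Qed.

Lemma random_row_mx m k1 k2 (Y : T -> 'M[R]_(m, k1)) (Z : T -> 'M[R]_(m, k2)) :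
  random_mx Y -> random_mx Z -> random_mx (fun w => row_mx (Y w) (Z w)).
Proof.
move=> mY mZ i j; case: (split_ordP j) => j' ->.
  by under eq_fun do rewrite row_mxEl; exact: mY.
by under eq_fun do rewrite row_mxEr; exact: mZ.
Qed.

Lemma measurable_fro m k (Z : T -> 'M[R]_(m, k)) :
  random_mx Z -> measurable_fun setT (fun w => fro (Z w)).
Proof.
move=> mZ; apply: measurable_sum => i; apply: measurable_sum => j.
exact: measurable_funM.
Qed.

End MatrixMeasurable.

Section SquareIntegrable.
Context d (T : measurableType d) (R : realType) (P : probability T R).

Lemma integrable_sqr (f : T -> R) (c : R) : measurable_fun setT f ->
  (\int[P]_w (f w ^+ 2)%:E = c%:E)%E ->
  P.-integrable setT (EFin \o (fun w => f w ^+ 2)).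
Proof.
move=> mf fc; apply: (@ge0_integrable _ _ _ _ _ c).
- exact: measurable_funX.
- by move=> w; exact: sqr_ge0.
- by rewrite fc.
Qed.

Lemma integrable_prod2 (f g : T -> R) : measurable_fun setT f -> measurable_fun setT g ->
  P.-integrable setT (EFin \o (fun w => f w ^+ 2)) ->
  P.-integrable setT (EFin \o (fun w => g w ^+ 2)) ->
  P.-integrable setT (EFin \o (fun w => f w * g w)).
Proof.
move=> mf mg fi gi.
have fgi : P.-integrable setT (EFin \o (fun w => f w ^+ 2 + g w ^+ 2)).
  by apply: eq_integrable (integrableD measurableT fi gi).
apply: le_integrable fgi => //.
  by apply/measurable_EFinP; exact: measurable_funM.
move=> w _ /=; rewrite lee_fin [leRHS]ger0_norm ?normrM; last by rewrite addr_ge0 ?sqr_ge0.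
have := sqr_ge0 (`|f w| - `|g w|).
rewrite -(real_normK (num_real (f w))) -(real_normK (num_real (g w))).
have := sqr_ge0 `|f w|; have := sqr_ge0 `|g w|; lra.
Qed.

Lemma integrable_of_sqr (f : T -> R) : measurable_fun setT f ->
  P.-integrable setT (EFin \o (fun w => f w ^+ 2)) ->
  P.-integrable setT (EFin \o f).
Proof.
move=> mf fi.
have -> : f = (fun w => f w * 1) by apply/funext => w; rewrite mulr1.
apply: integrable_prod2 => //.
have -> : (fun=> 1 ^+ 2) = (fun _ : T => 1 : R) by apply/funext => w; rewrite expr1n.
exact: finite_measure_integrable_cst.
Qed.

Lemma integral_fin_sum (I : finType) (f : I -> T -> R) (c : I -> R) :
  (forall i, P.-integrable setT (EFin \o f i)) ->
  (forall i, \int[P]_w (f i w)%:E = (c i)%:E)%E ->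
  (\int[P]_w (\sum_i f i w)%:E = (\sum_i c i)%:E)%E.
Proof.
move=> fi fc; under eq_integral do rewrite -sumEFin.
rewrite integral_sum //.
by rewrite -sumEFin; apply: eq_bigr => i _; exact: fc.
Qed.

Lemma integral_scale (f : T -> R) (a c : R) : P.-integrable setT (EFin \o f) ->
  (\int[P]_w (f w)%:E = c%:E)%E -> (\int[P]_w (a * f w)%:E = (a * c)%:E)%E.
Proof.
by move=> fi fc; under eq_integral do rewrite EFinM; rewrite integralZl // fc.
Qed.

Lemma integrable_scale (f : T -> R) (a : R) : P.-integrable setT (EFin \o f) ->
  P.-integrable setT (EFin \o (fun w => a * f w)).
Proof.
move=> fi; have := @integrableZl _ _ _ P setT measurableT a _ fi.
by apply: eq_integrable => // w _; rewrite /= EFinM.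
Qed.

End SquareIntegrable.

(** The tangent of the exponential at the mean [m], averaged. *)
Lemma expR_jensen (R : realType) (I : finType) (c u : I -> R) :
  (forall i, 0 <= c i) -> \sum_i c i = 1 ->
  expR (\sum_i c i * u i) <= \sum_i c i * expR (u i).
Proof.
move=> c0 c1; set m := \sum_i _.
have -> : expR m = \sum_i c i * (expR m * (1 + (u i - m))).
  transitivity (expR m * (\sum_i c i + (\sum_i c i * u i - (\sum_i c i) * m))).
    by rewrite c1 mul1r -/m subrr addr0 mulr1.
  rewrite mulr_suml -sumrB -big_split mulr_sumr; apply: eq_bigr => i _ /=; ring.
apply: ler_sum => i _; rewrite ler_wpM2l //.
have -> : expR (u i) = expR m * expR (u i - m) by rewrite -expRD addrC subrK.
by rewrite ler_pM2l ?expR_gt0 // expR_ge1Dx.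
Qed.

(** * The whitened design: moments and concentration *)

Section Model.
Context disp (T : measurableType disp) (R : realType) (P : probability T R).
Variables (n d p : nat) (lam theta : nat -> R) (sigma sigma_x : R).
Variables (X : T -> 'M[R]_(n, p)) (eps : T -> 'cV[R]_n).
Hypothesis model : regression_model P d lam theta sigma sigma_x X eps.

Let lam_gt0 (j : 'I_p) : 0 < lam j.+1.
Proof. by apply: (rm_lam_gt0 model). Qed.

Let mX i j : measurable_fun [set: T] (fun w => X w i j).
Proof. exact: (rm_X_meas model). Qed.

Definition whiten : 'M[R]_p := diag_mx (\row_j (Num.sqrt (lam j.+1))^-1).
Definition Zw (w : T) : 'M[R]_(n, p) := X w *m whiten.

Lemma ZwE w i j : Zw w i j = X w i j / Num.sqrt (lam j.+1).
Proof. by rewrite /Zw mul_mx_diag !mxE. Qed.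

Let mZ : random_mx Zw.
Proof. by apply: random_mxM; [exact: (rm_X_meas model)|exact: random_mx_cst]. Qed.

Lemma X_moment i j k : (\int[P]_w (X w i j * X w i k)%:E = (dseg 0 p lam j k)%:E)%E.
Proof.
rewrite -(rm_X_var model i) covariance.unlock !(rm_X_mean model) expectation.unlock.
apply: eq_integral => w _; congr (_%:E).
by rewrite /GRing.mul /= !subr0.
Qed.

Lemma Z_sqr i j : (\int[P]_w (Zw w i j ^+ 2)%:E = 1%:E)%E.
Proof.
have lp := lam_gt0 j.
have E : (\int[P]_w (X w i j ^+ 2)%:E = (lam j.+1)%:E)%E.
  have := X_moment i j j; rewrite /dseg !mxE eqxx mulr1n add0n => <-.
  by apply: eq_integral => w _; rewrite expr2.
have -> : (\int[P]_w (Zw w i j ^+ 2)%:E = \int[P]_w ((lam j.+1)^-1 * X w i j ^+ 2)%:E)%E.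
  apply: eq_integral => w _; congr (_%:E).
  by rewrite ZwE expr_div_n (sqr_sqrtr (ltW lp)) [LHS]mulrC.
rewrite (integral_scale _ (integrable_sqr (mX i j) E) E) mulVf // gt_eqF //.
Qed.

Lemma Z_sqr_integrable i j : P.-integrable setT (EFin \o (fun w => Zw w i j ^+ 2)).
Proof. exact: (integrable_sqr (mZ i j) (Z_sqr i j)). Qed.

Lemma Z_moment i j k : (\int[P]_w (Zw w i j * Zw w i k)%:E = ((j == k)%:R)%:E)%E.
Proof.
have [<-|jk] := eqVneq j k.
  by under eq_integral do rewrite -expr2; rewrite Z_sqr.
have E := X_moment i j k; rewrite /dseg !mxE (negbTE jk) mulr0n in E.
have Xs l : P.-integrable setT (EFin \o (fun w => X w i l ^+ 2)).
  apply: (@integrable_sqr _ _ _ _ _ (dseg 0 p lam l l)) => //.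
  by under eq_integral do rewrite expr2; exact: X_moment.
have -> : (\int[P]_w (Zw w i j * Zw w i k)%:E =
    \int[P]_w ((Num.sqrt (lam j.+1) * Num.sqrt (lam k.+1))^-1 * (X w i j * X w i k))%:E)%E.
  apply: eq_integral => w _; rewrite !ZwE; congr (_%:E); field.
  by rewrite !gt_eqF // sqrtr_gt0.
rewrite (integral_scale _ (integrable_prod2 (mX i j) (mX i k) (Xs j) (Xs k)) E).
by rewrite mulr0.
Qed.

Let Zs_sqrE i (s : 'cV[R]_p) w : fro (row i (Zw w) *m s) =
  \sum_(jk : 'I_p * 'I_p) s jk.1 ord0 * s jk.2 ord0 * (Zw w i jk.1 * Zw w i jk.2).
Proof.
rewrite /fro /mdot !big_ord1 mxE big_distrlr /= pair_big /=.
by apply: eq_bigr => -[j k] _ /=; rewrite !mxE; ring.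
Qed.

Lemma Zs_mean i (s : 'cV[R]_p) : (\int[P]_w (fro (row i (Zw w) *m s))%:E = (fro s)%:E)%E.
Proof.
under eq_integral do rewrite Zs_sqrE.
have fi (jk : 'I_p * 'I_p) : P.-integrable setT (EFin \o (fun w => Zw w i jk.1 * Zw w i jk.2)).
  by apply: integrable_prod2; [exact: mZ|exact: mZ|exact: Z_sqr_integrable|exact: Z_sqr_integrable].
rewrite (@integral_fin_sum _ _ _ _ _ _ (fun jk : 'I_p * 'I_p =>
   s jk.1 ord0 * s jk.2 ord0 * (jk.1 == jk.2)%:R)); last 2 first.
- by move=> jk; exact: integrable_scale.
- by move=> jk; apply: integral_scale => //; exact: Z_moment.
congr (_%:E); rewrite /fro /mdot.
rewrite -(pair_bigA _ (fun j k => s j ord0 * s k ord0 * (j == k)%:R)) /=.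
apply: eq_bigr => j _; rewrite big_ord1 (bigD1 j) //= eqxx mulr1 big1 ?addr0 // => k kj.
by rewrite eq_sym (negbTE kj) mulr0.
Qed.

Let whitenE (i : 'I_n) (s : 'cV[R]_p) w :
  (s^T *m (dseg 0 p (fun j => (Num.sqrt (lam j))^-1) *m (row i (X w))^T)) ord0 ord0 =
  (row i (Zw w) *m s) ord0 ord0.
Proof.
have -> : s^T *m (dseg 0 p (fun j => (Num.sqrt (lam j))^-1) *m (row i (X w))^T) =
    (row i (Zw w) *m s)^T.
  by rewrite trmx_mul /Zw row_mul trmx_mul /whiten tr_diag_mx.
by rewrite mxE.
Qed.

Let normM_nF (s : 'cV[R]_p) : normM 1%:M s = nF s.
Proof. by rewrite /normM mulmx1 /nF /fro mdot_tr /mxtrace big_ord1. Qed.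

(** The infimum in [psi2_norm] is not known to be attained, so a threshold strictly above [sigma_x]
    is spent to obtain an actual exponential moment. The vector norm is a supremum, hence this holds
    in every direction. *)
Let psi2_set i (s : 'cV[R]_p) (t : R) : s != 0 -> sigma_x < t -> exists t',
  [/\ 0 < t', t' < t &
   (\int[P]_w (expR (fro (row i (Zw w) *m s) / (fro s * t' ^+ 2)))%:E <= 2%:E)%E].
Proof.
move=> s0 st.
have h : (psi2_norm P (fun w => (row i (Zw w) *m s) ord0 ord0 / nF s)%R <= sigma_x%:E)%E.
  rewrite -(rm_subgaussian model i); apply: ereal_sup_ubound; exists s; first exact: s0.
  by congr (psi2_norm P _); apply/funext => w; rewrite whitenE normM_nF.
have /ereal_inf_lt [_ [t' /= [t'0 Ht'] <-]] : (psi2_norm P (fun w => (row i (Zw w) *m s) ord0 ord0 / nF s)%R < t%:E)%E.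
  by rewrite (le_lt_trans h) // lte_fin.
rewrite lte_fin => t't; exists t'; split => //.
rewrite expectation.unlock in Ht'; apply: le_trans Ht'.
rewrite le_eqVlt; apply/orP; left; apply/eqP; apply: eq_integral => w _ /=.
congr ((expR _)%:E); rewrite expr_div_n nF_sqr -mulrA -invfM.
by rewrite {1}/fro /mdot !big_ord1 expr2.
Qed.

Let fro_gt0 (s : 'cV[R]_p) : s != 0 -> 0 < fro s.
Proof.
move=> s0; rewrite lt_def fro_ge0 andbT; apply/eqP => /fro_eq0 h.
by rewrite h eqxx in s0.
Qed.

Let mZs i m (D : 'M[R]_(p, m)) : measurable_fun setT (fun w => fro (row i (Zw w) *m D)).
Proof.
apply: measurable_fro; apply: random_mxM; last exact: random_mx_cst.
exact: random_mx_row.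
Qed.

(** A whitened coordinate has second moment 1; by e^z >= 1 + z, an exponential moment at most 2 at
    scale t forces t >= 1. *)
Lemma sigma_x_ge1 (i : 'I_n) : 1 <= sigma_x.
Proof.
have p0 : (0 < p)%N by have /andP[d1 /(leq_ltn_trans (leq0n _))] := rm_dim model.
pose s : 'cV[R]_p := delta_mx (Ordinal p0) 0.
have s0 : s != 0.
  apply/eqP => /matrixP /(_ (Ordinal p0) 0); rewrite !mxE !eqxx => /eqP.
  by rewrite oner_eq0.
rewrite leNgt; apply/negP => s1.
have [t [t0 t1 Ht]] := psi2_set i s0 s1.
have fs := fro_gt0 s0.
have ft : 0 < fro s * t ^+ 2 by rewrite mulr_gt0 // exprn_gt0.
have h : (\int[P]_w (1 * (fro (row i (Zw w) *m s) / (fro s * t ^+ 2)) + 1)%:E <= 2%:E)%E.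
  apply: le_trans Ht; apply: ge0_le_integral => //.
  - by move=> w _; rewrite lee_fin addr_ge0 // mul1r divr_ge0 ?fro_ge0 // ltW.
  - apply/measurable_EFinP; apply: measurable_funD => //; apply: measurable_funM => //.
    exact: measurable_funM.
  - by apply/measurable_EFinP; apply: measurableT_comp => //; exact: measurable_funM.
  - by move=> w _; rewrite lee_fin mul1r addrC expR_ge1Dx.
have fi : P.-integrable setT (EFin \o (fun w => fro (row i (Zw w) *m s))).
  apply: (@ge0_integrable _ _ _ _ _ (fro s)) => //.
    by move=> w; exact: fro_ge0.
  by rewrite Zs_mean.
have E : (\int[P]_w (1 * (fro (row i (Zw w) *m s) / (fro s * t ^+ 2)) + 1)%:E =
   ((fro s * t ^+ 2)^-1 * fro s + 0 * fro s + 1)%:E)%E.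
  rewrite -(integral_affine _ _ _ fi fi (Zs_mean i s) (Zs_mean i s)).
  by apply: eq_integral => w _; congr (_%:E); ring.
move: h; rewrite E lee_fin mul0r addr0 invfM mulrAC mulVf ?mul1r ?gt_eqF // => h.
have : t ^+ 2 < 1 by rewrite expr_lt1 // ltW.
have : (t ^+ 2)^-1 <= 1 by lra.
rewrite invf_le1 ?exprn_gt0 //; lra.
Qed.

(** The scale at which squares have exponential moment at most 2. The factor 2 provides the strict
    slack sigma_x < sqrt psi that [psi2_set] asks for. *)
Definition psi := 2 * sigma_x ^+ 2.

Lemma psi_ge1 (i : 'I_n) : 1 <= psi.
Proof.
have := sigma_x_ge1 i => s1; rewrite /psi.
have : 1 <= sigma_x ^+ 2 by rewrite exprn_ege1.
lra.
Qed.

Lemma Zs_psi i (s : 'cV[R]_p) : s != 0 ->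
  (\int[P]_w (expR (fro (row i (Zw w) *m s) / (fro s * psi)))%:E <= 2%:E)%E.
Proof.
move=> s0; have s1 := sigma_x_ge1 i; have p1 := psi_ge1 i.
have ps : sigma_x < Num.sqrt psi.
  have : sigma_x ^+ 2 < Num.sqrt psi ^+ 2.
    rewrite sqr_sqrtr ?(le_trans _ p1) // /psi.
    have : 1 <= sigma_x ^+ 2 by rewrite exprn_ege1.
    lra.
  by rewrite ltr_pXn2r ?nnegrE ?sqrtr_ge0 // (le_trans _ s1).
have [t [t0 t1 Ht]] := psi2_set i s0 ps.
apply: le_trans Ht; apply: ge0_le_integral => //.
- by apply/measurable_EFinP; apply: measurableT_comp => //; exact: measurable_funM.
- by apply/measurable_EFinP; apply: measurableT_comp => //; exact: measurable_funM.
- move=> w _; rewrite lee_fin ler_expR ler_wpM2l ?fro_ge0 // lef_pV2 ?posrE ?(mulr_gt0 (fro_gt0 s0)) ?exprn_gt0 ?(lt_le_trans ltr01 p1) //.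
  rewrite ler_pM2l ?fro_gt0 // -[leRHS](@sqr_sqrtr _ psi) ?(le_trans _ p1) //.
  by rewrite ler_pXn2r ?nnegrE ?sqrtr_ge0 ?(ltW t0) // ltW.
Qed.

Section Weighted.
Variables (m : nat) (D : 'M[R]_(p, m)).
Hypothesis D0 : 0 < fro D.
(** Normalised to mean 1 for every [D], so that one Chernoff bound covers all the Frobenius norms of
    the good event. *)
Definition Wd (i : 'I_n) (w : T) : R := fro (row i (Zw w) *m D) / fro D.

Lemma Wd_meas i : measurable_fun setT (Wd i).
Proof. exact: measurable_funM. Qed.

Lemma Wd_ge0 i w : 0 <= Wd i w.
Proof. by rewrite divr_ge0 ?fro_ge0. Qed.

Let fro_mulD i w : fro (row i (Zw w) *m D) = \sum_k fro (row i (Zw w) *m col k D).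
Proof.
by rewrite fro_cols; apply: eq_bigr => k _; rewrite !colE mulmxA.
Qed.

Lemma Wd_mean i : (\int[P]_w (Wd i w)%:E = 1%:E)%E.
Proof.
have fi k : P.-integrable setT (EFin \o (fun w => fro (row i (Zw w) *m col k D))).
  apply: (@ge0_integrable _ _ _ _ _ (fro (col k D))) => //.
    by move=> w; exact: fro_ge0.
  by rewrite Zs_mean.
have -> : (\int[P]_w (Wd i w)%:E =
    \int[P]_w (\sum_k ((fro D)^-1 * fro (row i (Zw w) *m col k D)))%:E)%E.
  by apply: eq_integral => w _; rewrite /Wd fro_mulD mulrC mulr_sumr.
rewrite (@integral_fin_sum _ _ _ _ _ _ (fun k => (fro D)^-1 * fro (col k D))).
- by rewrite -mulr_sumr -fro_cols mulVf // gt_eqF.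
- by move=> k; exact: integrable_scale.
- by move=> k; apply: integral_scale => //; exact: Zs_mean.
Qed.

(** [Wd] is a convex combination of normalised squares along the columns of [D], each with
    exponential moment at most 2. Jensen's inequality tolerates any dependence between the
    coordinates of a row. *)
Lemma Wd_psi i : (\int[P]_w (expR (Wd i w / psi))%:E <= 2%:E)%E.
Proof.
have p0 : 0 < psi by rewrite (lt_le_trans _ (psi_ge1 i)).
pose c k := fro (col k D) / fro D.
have c0 k : 0 <= c k by rewrite divr_ge0 ?fro_ge0.
have c1 : \sum_k c k = 1 by rewrite -mulr_suml -fro_cols divff // gt_eqF.
pose g k w := expR (fro (row i (Zw w) *m col k D) / (fro (col k D) * psi)).
have mg k : measurable_fun [set: T] (g k).
  by apply: measurableT_comp => //; exact: measurable_funM.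
have g2 k : (\int[P]_w (g k w)%:E <= 2%:E)%E.
  (* A zero column has weight 0, and the convention on division by 0 makes its exponential equal to
     1. *)
  have [k0|k0] := eqVneq (col k D) 0; last exact: Zs_psi.
  have -> : (\int[P]_w (g k w)%:E = \int[P]_w cst 1%:E w)%E.
    by apply: eq_integral => w _; rewrite /g k0 mulmx0 !fro0 mul0r expR0.
  rewrite integral_cst // mul1e (le_trans (probability_le1 _ _)) // lee_fin; lra.
apply: (@le_trans _ _ (\int[P]_w (\sum_k c k * g k w)%:E)%E).
  apply: ge0_le_integral => //.
  - apply/measurable_EFinP; apply: measurableT_comp => //; apply: measurable_funM => //.
    exact: Wd_meas.
  - apply/measurable_EFinP; apply: measurable_sum => k; exact: measurable_funM.
  - move=> w _; rewrite lee_fin.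
    have -> : Wd i w / psi = \sum_k c k * (fro (row i (Zw w) *m col k D) / (fro (col k D) * psi)).
      rewrite /Wd fro_mulD !mulr_suml; apply: eq_bigr => k _; rewrite /c.
      have [/fro_eq0 k0|k0] := eqVneq (fro (col k D)) 0.
        by rewrite k0 mulmx0 !fro0 !mul0r.
      by field; rewrite k0 !gt_eqF.
    exact: expR_jensen.
under eq_integral do rewrite -sumEFin.
rewrite ge0_integral_sum //; last 2 first.
- by move=> k; apply/measurable_EFinP; exact: measurable_funM.
- by move=> k w _; rewrite lee_fin mulr_ge0 // expR_ge0.
apply: (@le_trans _ _ (\sum_k (c k * 2)%:E)%E).
  apply: lee_sum => k _; under eq_integral do rewrite EFinM.
  rewrite ge0_integralZl_EFin //; last 2 first.
  - by move=> w _; rewrite lee_fin expR_ge0.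
  - exact/measurable_EFinP.
  by rewrite [leRHS]EFinM; apply: lee_wpmul2l; rewrite ?lee_fin //; exact: g2.
by rewrite sumEFin -mulr_suml c1 mul1r.
Qed.

End Weighted.

Lemma rows_indep (f : 'I_n -> 'M[R]_(1, 1 + p) -> R) :
  (forall i, measurable_fun [set: mxT R 1 (1 + p)] (f i)) ->
  (forall i S, 0 <= f i S) ->
  (forall i, \int[P]_w (f i (row_mx (row i (response (X w) theta (eps w))) (row i (X w))))%:E < +oo)%E ->
  (\int[P]_w (\prod_i f i (row_mx (row i (response (X w) theta (eps w))) (row i (X w))))%:E =
  \prod_i \int[P]_w (f i (row_mx (row i (response (X w) theta (eps w))) (row i (X w))))%:E)%E.
Proof.
move=> mf f0 ff.
have mS i : measurable_fun [set: T] ((fun w => row_mx (row i (response (X w) theta (eps w)))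
     (row i (X w))) : T -> mxT R 1 (1 + p)).
  apply: random_mx_measurable; apply: random_row_mx.
    apply: random_mx_row; apply: random_mxD; last exact: (rm_eps_meas model).
    by apply: random_mxM; [exact: (rm_X_meas model)|exact: random_mx_cst].
  by apply: random_mx_row; exact: (rm_X_meas model).
apply: integral_prod_indep => //.
  by move=> i; exact: (measurableT_comp (mf i) (mS i)).
move=> B mB.
have := rm_indep model (B := fun i => f i @^-1` B i).
apply => i; have := mf i measurableT _ (mB i); by rewrite setTI.
Qed.

Lemma Wd_indep m (D : 'M[R]_(p, m)) (f : R -> R) : measurable_fun setT f ->
  (forall x, 0 <= f x) -> (forall i, \int[P]_w (f (Wd D i w))%:E < +oo)%E ->
  (\int[P]_w (\prod_i f (Wd D i w))%:E = \prod_i \int[P]_w (f (Wd D i w))%:E)%E.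
Proof.
move=> mf f0 ff.
pose h (S : 'M[R]_(1, 1 + p)) := f (fro (rsubmx S *m whiten *m D) / fro D).
have hE i w : h (row_mx (row i (response (X w) theta (eps w))) (row i (X w))) = f (Wd D i w).
  by rewrite /h row_mxKr /Wd /Zw row_mul.
have := @rows_indep (fun=> h); under eq_integral do under eq_bigr do rewrite hE.
under eq_bigr do under eq_integral do rewrite hE.
apply.
- move=> i; apply: (measurableT_comp mf); apply: measurable_funM => //.
  apply: measurable_fro; apply: random_mxM; last exact: random_mx_cst.
  apply: random_mxM; last exact: random_mx_cst.
  apply: random_mx_rsub; exact: random_mx_id.
- by move=> i S; exact: f0.
- by move=> i; under eq_integral do rewrite hE.
Qed.

Lemma sum_Wd m (D : 'M[R]_(p, m)) w : 0 < fro D ->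
  fro (Zw w *m D) = (\sum_i Wd D i w) * fro D.
Proof.
move=> D0; rewrite mulr_suml fro_rows; apply: eq_bigr => i _.
by rewrite row_mul /Wd divfK // gt_eqF.
Qed.

Lemma whp_fro (i0 : 'I_n) m (D : 'M[R]_(p, m)) (del : R) : 0 < del <= 1 ->
  whp P (2 * expR (- (n%:R * del ^+ 2 / (128 * psi ^+ 2))))
    (fun w => `|fro (Zw w *m D) - n%:R * fro D| <= del * n%:R * fro D).
Proof.
move=> hdel; have [/fro_eq0 ->|D0] := eqVneq (fro D) 0.
  exists setT; split => //.
    by rewrite setCT measure0 lee_fin mulr_ge0 // expR_ge0.
  by move=> w _; rewrite mulmx0 !fro0 !mulr0 subrr normr0.
have Dp : 0 < fro D by rewrite lt_def D0 fro_ge0.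
have := @whp_concentration _ _ _ P n (Wd D) psi (Wd_meas D) (Wd_ge0 D) (@Wd_indep _ D)
  (psi_ge1 i0) (Wd_psi Dp) (Wd_mean Dp) del hdel.
apply: whp_imp => // w; rewrite (sum_Wd _ Dp) -mulrBl normrM (gtr0_norm Dp).
by rewrite ler_pM2r.
Qed.

Lemma exp_fro_le (i0 : 'I_n) (s : 'cV[R]_p) : fro s <= 1 ->
  (\int[P]_w (expR (psi^-1 * fro (Zw w *m s)))%:E <= (2 ^+ n)%:E)%E.
Proof.
move=> s1; have p0 : 0 < psi by rewrite (lt_le_trans _ (psi_ge1 i0)).
have [/fro_eq0 ->|s0] := eqVneq (fro s) 0.
  have -> : (\int[P]_w (expR (psi^-1 * fro (Zw w *m (0 : 'cV_p))))%:E = \int[P]_w cst 1%:E w)%E.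
    by apply: eq_integral => w _; rewrite mulmx0 fro0 mulr0 expR0.
  rewrite integral_cst // mul1e (le_trans (probability_le1 _ _)) // lee_fin.
  by rewrite exprn_ege1 //; lra.
have sp : 0 < fro s by rewrite lt_def s0 fro_ge0.
have H := @whp_exp_sum _ _ _ P n (Wd s) psi (@Wd_indep _ s) (Wd_psi sp).
apply: le_trans H; apply: ge0_le_integral => //.
- apply/measurable_EFinP; apply: measurableT_comp => //; apply: measurable_funM => //.
  by apply: measurable_fro; apply: random_mxM => //; exact: random_mx_cst.
- apply/measurable_EFinP; apply: measurableT_comp => //; apply: measurable_funM => //.
  by apply: measurable_sum => i; exact: Wd_meas.
- move=> w _; rewrite lee_fin ler_expR ler_pM2l ?invr_gt0 // (sum_Wd _ sp).
  by rewrite ler_piMr //; apply: sumr_ge0 => i _; exact: Wd_ge0.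
Qed.

End Model.

(** * The good event *)

Section Blocks.
Variables (R : realType) (n q : nat).
Hypothesis n_gt0 : (0 < n)%N.

(** The columns are the unit vectors of the coordinates b n, ..., b n + n - 1, with zero columns
    past [q]. Letting [b] range over ['I_q] gives more blocks than needed; the surplus ones
    vanish. *)
Definition block (b : nat) : 'M[R]_(q, n) :=
  \matrix_(k < q, j < n) (nat_of_ord k == b * n + j)%N%:R.

Lemma block_trE m b (A : 'M[R]_(q, m)) (j : 'I_n) i :
  ((block b)^T *m A) j i = \sum_(k < q | (nat_of_ord k == b * n + j)%N) A k i.
Proof.
rewrite mxE [RHS]big_mkcond; apply: eq_bigr => k _; rewrite !mxE.
by case: eqP => _; rewrite ?mul1r ?mul0r.
Qed.

Lemma block_tr_entry (k : 'I_q) m b (A : 'M[R]_(q, m)) (j : 'I_n) i :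
  nat_of_ord k = (b * n + j)%N -> ((block b)^T *m A) j i = A k i.
Proof.
move=> kE; rewrite block_trE (big_pred1 k) // => k'.
by rewrite -kE /= -val_eqE.
Qed.

Lemma block_tr_out m b (A : 'M[R]_(q, m)) (j : 'I_n) i :
  (q <= b * n + j)%N -> ((block b)^T *m A) j i = 0.
Proof.
move=> h; rewrite block_trE big_pred0 // => k; apply/negbTE.
by rewrite neq_ltn (leq_trans (ltn_ord k) h).
Qed.

Lemma block_partition : \sum_(b < q) block b *m (block b)^T = 1%:M.
Proof.
apply/matrixP => k k'; rewrite summxE !mxE.
have kq : (k %/ n < q)%N by rewrite (leq_ltn_trans (leq_div _ _)).
pose b0 := Ordinal kq; pose j0 := Ordinal (ltn_pmod k n_gt0).
have E (b : 'I_q) (j : 'I_n) : (nat_of_ord k == b * n + j)%N = (b == b0) && (j == j0).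
  apply/eqP/andP => [kE|[/eqP -> /eqP ->]]; last by rewrite /= -divn_eq.
  split; apply/eqP/val_inj => /=.
    by rewrite kE divnMDl // divn_small // addn0.
  by rewrite kE modnMDl modn_small.
rewrite (bigD1 b0) //= big1 => [|b bb0]; last first.
  by rewrite mxE big1 // => j _; rewrite !mxE E (negbTE bb0) mul0r.
rewrite addr0 mxE (bigD1 j0) //= big1 => [|j jj0]; last first.
  by rewrite !mxE (E b0) (negbTE jj0) andbF mul0r.
by rewrite addr0 !mxE (E b0) !eqxx /= mul1r -divn_eq eq_sym -val_eqE.
Qed.

Lemma fro_block_sum m (u : 'M[R]_(q, m)) :
  \sum_(b < q) fro ((block b)^T *m u) = fro u.
Proof.
rewrite -[in RHS](mul1mx u) -block_partition /fro {2}mulmx_suml.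
transitivity (mdot u (\sum_(b < q) block b *m (block b)^T *m u)); last first.
  by rewrite -mulmx_suml block_partition mul1mx.
elim/big_rec2 : _ => [|b x y _ ->]; first by rewrite -(scale0r u) mdotZr mul0r.
by rewrite mdotDr -mulmxA [in RHS]mdot_mulr.
Qed.

Lemma fro_block (b : 'I_q) (v : 'cV[R]_n) : fro (block b *m v) <= fro v.
Proof.
have H : opb (block b)^T 1.
  move=> u; rewrite mul1r -(fro_block_sum u) (bigD1 b) //= lerDl.
  by apply: sumr_ge0 => ? _; exact: fro_ge0.
by have := opb_mul v (opb_tr ler01 H); rewrite trmxK mul1r.
Qed.

(* Extends [f] by [0] beyond [q], so that the last block may be incomplete. *)
Definition tail_at (f : 'I_q -> R) (k : nat) : R :=
  if insub k is Some k' then f k' else 0.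

Lemma tail_atE (f : 'I_q -> R) (k : 'I_q) : tail_at f k = f k.
Proof. by rewrite /tail_at valK. Qed.

Lemma tail_at_out (f : 'I_q -> R) k : (q <= k)%N -> tail_at f k = 0.
Proof. by move=> qk; rewrite /tail_at insubF // ltnNge qk. Qed.

Variable lam2 : 'I_q -> R.
Hypothesis lam2_ge0 : forall k, 0 <= lam2 k.
Hypothesis lam2_mono : forall j k : 'I_q, (j <= k)%N -> lam2 k <= lam2 j.

Lemma tail_at_ge0 k : 0 <= tail_at lam2 k.
Proof. by rewrite /tail_at; case: insubP. Qed.

Lemma tail_at_mono j k : (j <= k)%N -> tail_at lam2 k <= tail_at lam2 j.
Proof.
move=> jk; case: (ltnP k q) => kq; last by rewrite (tail_at_out _ kq) tail_at_ge0.
have jq := leq_ltn_trans jk kq.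
rewrite -[k]/(val (Ordinal kq)) -[j]/(val (Ordinal jq)) !tail_atE.
exact: lam2_mono.
Qed.

Let S2 := diag_mx (\row_k Num.sqrt (lam2 k)).

Lemma fro_block_diag b (u : 'cV[R]_q) :
  fro ((block b)^T *m (S2 *m u)) <= tail_at lam2 (b * n) * fro ((block b)^T *m u).
Proof.
rewrite /fro /mdot mulr_sumr; apply: ler_sum => j _; rewrite !big_ord1.
case: (ltnP (b * n + j) q) => h; last by rewrite !block_tr_out // !mul0r mulr0.
rewrite !(@block_tr_entry (Ordinal h)) //.
rewrite /S2 mul_diag_mx !mxE mulrACA -!expr2 sqr_sqrtr //.
rewrite ler_wpM2r ?sqr_ge0 // -(tail_atE lam2) /=.
exact: tail_at_mono (leq_addr _ _).
Qed.

Lemma block_sum : \sum_(b < q) \sum_(j < n) tail_at lam2 (b * n + j) = \sum_k lam2 k.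
Proof.
pose u : 'cV[R]_q := \col_k Num.sqrt (lam2 k).
transitivity (fro u); last first.
  by rewrite /fro /mdot; apply: eq_bigr => k _; rewrite big_ord1 !mxE -expr2 sqr_sqrtr.
rewrite -fro_block_sum; apply: eq_bigr => b _; apply: eq_bigr => j _; rewrite big_ord1.
case: (ltnP (b * n + j) q) => h; last by rewrite block_tr_out // mul0r tail_at_out.
by rewrite (@block_tr_entry (Ordinal h)) // mxE -expr2 sqr_sqrtr // -(tail_atE lam2).
Qed.

Lemma block_max_sum : (0 < q)%N ->
  n%:R * \sum_(b < q) tail_at lam2 (b * n) <= n%:R * tail_at lam2 0 + \sum_k lam2 k.
Proof.
move=> q0; rewrite -block_sum.
rewrite -(big_mkord predT (fun b => tail_at lam2 (b * n))) big_ltn // mul0n mulrDr lerD2l.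
rewrite -(big_mkord predT (fun b => \sum_(j < n) tail_at lam2 (b * n + j))).
rewrite big_add1 mulr_sumr.
apply: (@le_trans _ _ (\sum_(0 <= b < q.-1) \sum_(j < n) tail_at lam2 (b * n + j))).
  apply: ler_sum_nat => b _; rewrite -[n in n%:R]card_ord mulr_natl -sumr_const.
  apply: ler_sum => j _; apply: tail_at_mono.
  by rewrite mulSn addnC leq_add2r ltnW.
rewrite [leRHS](@big_cat_nat _ _ _ q.-1) //=; last exact: leq_pred.
by rewrite lerDl; apply: sumr_ge0 => b _; apply: sumr_ge0 => j _; exact: tail_at_ge0.
Qed.

(* Cauchy-Schwarz over the blocks; since [lam2] is nonincreasing, the first entry of
   each block is at most the average of the previous one. *)
Lemma blocks_op_bound (Z2 : 'M[R]_(n, q)) (gam : 'I_q -> R) :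
  (forall b, 0 <= gam b) ->
  (forall b : 'I_q, opb (Z2 *m block b) (gam b)) ->
  opb (Z2 *m S2) (\sum_(b < q) gam b * tail_at lam2 (b * n)).
Proof.
move=> g0 Hg u; set C := \sum_(b < q) _.
have C0 : 0 <= C by apply: sumr_ge0 => b _; rewrite mulr_ge0 ?tail_at_ge0.
pose x : 'rV[R]_q := \row_b Num.sqrt (gam b * tail_at lam2 (b * n)).
pose y : 'rV[R]_q := \row_(b < q) nF ((block b)^T *m u).
have fx : fro x = C.
  rewrite /fro /mdot big_ord1; apply: eq_bigr => b _.
  by rewrite !mxE -expr2 sqr_sqrtr // mulr_ge0 ?tail_at_ge0.
have fy : fro y = fro u.
  rewrite -fro_block_sum /fro /mdot big_ord1; apply: eq_bigr => b _.
  by rewrite !mxE -expr2 nF_sqr.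
have h : nF (Z2 *m S2 *m u) <= mdot x y.
  have -> : Z2 *m S2 *m u = \sum_(b < q) Z2 *m block b *m ((block b)^T *m (S2 *m u)).
    rewrite -[in LHS](mulmx1 Z2) -block_partition -!mulmxA mulmx_suml mulmx_sumr.
    by apply: eq_bigr => b _; rewrite !mulmxA.
  rewrite /mdot big_ord1.
  elim/big_rec2 : _ => [|b r v _ IH]; first by rewrite /nF fro0 sqrtr0.
  rewrite (le_trans (nFD _ _)) // lerD // !mxE.
  rewrite nF_le ?mulr_ge0 ?sqrtr_ge0 // exprMn nF_sqr sqr_sqrtr ?mulr_ge0 ?tail_at_ge0 //.
  rewrite (le_trans (Hg b _)) // -mulrA ler_wpM2l //; exact: fro_block_diag.
rewrite -nF_sqr -fx -fy; apply: le_trans (mdot_cauchy x y).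
by rewrite ler_pXn2r ?nnegrE ?nF_ge0 // (le_trans (nF_ge0 _) h).
Qed.

End Blocks.

Section Deviations.
Variable R : realType.
Implicit Types N K F S r a b l : R.

Lemma expR1_ge2 : 2 <= expR 1 :> R.
Proof. by have := expR_ge1Dx (1 : R); lra. Qed.

Lemma half_deviation N a b : `|a - N * b| <= 2^-1 * N * b ->
  N * b <= 2 * a /\ a <= 2 * (N * b).
Proof.
move=> h; have h0 := le_trans (normr_ge0 _) h.
by move: h h0; rewrite ler_norml => /andP[]; split; lra.
Qed.

Lemma signal_deviation N K F r a : 0 <= N -> 4 <= K -> F <= K * r ^+ 2 ->
  a <= 2 * (N * F) -> a <= N * (K * r) ^+ 2.
Proof.
move=> N0 K4 FK aF; have Kr : 0 <= K * (K - 2) * r ^+ 2.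
  by rewrite mulr_ge0 ?sqr_ge0 // mulr_ge0; lra.
have := ler_wpM2l N0 FK; have := mulr_ge0 N0 Kr; lra.
Qed.

Lemma deviation_le K S a : 0 <= S -> 4 <= K -> a <= 2 * S -> a <= K * S.
Proof. by move=> S0 K4 aS; have := ler_wpM2r S0 K4; lra. Qed.

Lemma deviation_ge K S a : 0 <= S -> 4 <= K -> S <= 2 * a -> S / K <= a.
Proof.
move=> S0 K4 aS; rewrite ler_pdivrMr; last by lra.
have a0 : 0 <= a by lra.
by have := ler_wpM2l a0 K4; lra.
Qed.

Lemma trace_deviation N l K S a : 0 <= N -> 2 * N * l / K <= S -> N * S <= 2 * a ->
  N ^+ 2 * l / K <= a.
Proof. by move=> N0 h1 h2; have := ler_wpM2l N0 h1; lra. Qed.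

End Deviations.

Section GoodDesign.
Context disp (T : measurableType disp) (R : realType) (P : probability T R).
Variables (n d q : nat) (lam theta : nat -> R) (sigma sigma_x : R).
Variables (X : T -> 'M[R]_(n, d + q)) (eps : T -> 'cV[R]_n).
Hypothesis model : regression_model P d lam theta sigma sigma_x X eps.
Hypothesis n_gt0 : (0 < n)%N.

Let i0 : 'I_n := Ordinal n_gt0.
Let q_gt0 : (0 < q)%N.
Proof. by have /andP[_] := rm_dim model; rewrite -{1}(addn0 d) ltn_add2l. Qed.
Let psi := psi sigma_x.
Let psi1 : 1 <= psi. Proof. exact: psi_ge1 model i0. Qed.
Let psi0 : 0 < psi. Proof. exact: lt_le_trans psi1. Qed.
Let Zw := Zw lam X.
Let Z1 w := lsubmx (Zw w).
Let Z2 w := rsubmx (Zw w).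
Let lam2 (k : 'I_q) := lam (d + k).+1.
Let s : 'rV[R]_d := \row_j Num.sqrt (lam j.+1).
Let s2 : 'rV[R]_q := \row_k Num.sqrt (lam2 k).

Let lam_gt0 j : (j < d + q)%N -> 0 < lam j.+1.
Proof. by move=> jp; apply: (rm_lam_gt0 model). Qed.

Lemma design_split w : X w = row_mx (Z1 w *m diag_mx s) (Z2 w *m diag_mx s2).
Proof.
have ZE i j : Zw w i j = X w i j / Num.sqrt (lam j.+1) by exact: ZwE.
apply/matrixP => i j; case: (split_ordP j) => k ->.
  rewrite row_mxEl mul_mx_diag mxE [Z1 w i k]mxE ZE mxE divfK // gt_eqF // sqrtr_gt0.
  exact: lam_gt0 (ltn_ord (lshift q k)).
rewrite row_mxEr mul_mx_diag mxE [Z2 w i k]mxE ZE mxE divfK // gt_eqF // sqrtr_gt0.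
by apply: lam_gt0; rewrite ltn_add2l.
Qed.

Let Z_head m w (v : 'M[R]_(d, m)) : Z1 w *m v = Zw w *m col_mx v 0.
Proof. by rewrite -[Zw w]hsubmxK mul_row_col mulmx0 addr0. Qed.

Let Z_tail m w (v : 'M[R]_(q, m)) : Z2 w *m v = Zw w *m col_mx 0 v.
Proof. by rewrite -[Zw w]hsubmxK mul_row_col mulmx0 add0r. Qed.

(** Deviation 1 / 4 on each point of the net has exponent n / (2048 psi^2); one half of it pays for
    the at most e^(18 d) points and the other half remains. [net_isometry] doubles 1 / 4 to 1 /
    2. *)
Lemma whp_head : 18 * d%:R <= n%:R / (4096 * psi ^+ 2) ->
  whp P (2 * expR (- (n%:R / (4096 * psi ^+ 2))))
    (fun w => forall v : 'cV_d, `|fro (Z1 w *m v) - n%:R * fro v| <= 2^-1 * n%:R * fro v).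
Proof.
move=> dn; have [I [v [cI v1 vn]]] := sphere_net R d.
have h4 : 0 < (4^-1 : R) <= 1 by rewrite invr_gt0 invf_le1 ?ltr0n // ler1n.
have := @whp_forall _ _ _ P I _ _ (fun i => whp_fro model i0 (col_mx (v i) 0) h4).
apply: whp_imp.
  have n0 : 0 <= n%:R / (4096 * psi ^+ 2) :> R.
    apply: divr_ge0 (ler0n _ _) (ltW _).
    by have := exprn_gt0 2 psi0; lra.
  have cI' : #|I|%:R <= expR (18 * d%:R) :> R.
    have -> : 18 * d%:R = (18 * d)%:R * 1 :> R by rewrite natrM mulr1.
    rewrite expRM_natl (@le_trans _ _ (2 ^+ (18 * d))) //.
      by rewrite -natrX ler_nat.
    have e2 := @expR1_ge2 R.
    by rewrite lerXn2r // ?nnegrE ?expR_ge0 ?ler0n.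
  rewrite mulrCA ler_pM2l //.
  rewrite (@le_trans _ _ (expR (18 * d%:R) * expR (- (n%:R * 4^-1 ^+ 2 / (128 * psi ^+ 2))))) //.
    by rewrite ler_wpM2r ?expR_ge0.
  rewrite -expRD ler_expR.
  have -> : n%:R * 4^-1 ^+ 2 / (128 * psi ^+ 2) = 2 * (n%:R / (4096 * psi ^+ 2)).
    by field; rewrite gt_eqF.
  lra.
move=> w H u.
have := @net_isometry R n d (Z1 w) I v v1 vn n%:R (4^-1 * n%:R) (ler0n _ _).
move=> /(_ _ u)/wrap[].
  move=> i; rewrite Z_head; have := H i; rewrite fro_col_mx fro0 addr0 => h.
  rewrite (le_trans h) // ler_piMr // mulr_ge0 ?ler0n // invr_ge0 //.
by move=> h; rewrite (le_trans h) // le_eqVlt; apply/orP; left; apply/eqP; field.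
Qed.

(* The logarithms of the exponential moments are averaged with weights proportional
   to the block maxima, and Jensen's inequality reduces this to one Markov bound. *)
Lemma whp_tail_op :
  whp P (expR (- n%:R))
   (fun w => opb (rsubmx (X w)) (80 * psi * (n%:R * lam d.+1 + \sum_k lam2 k))).
Proof.
have [I [v [cI v1 vn]]] := sphere_net R n.
have l2 k : 0 <= lam2 k by apply: ltW; apply: lam_gt0; rewrite ltn_add2l.
have lm (j k : 'I_q) : (j <= k)%N -> lam2 k <= lam2 j.
  move=> jk; apply: (rm_lam_mono model) => //; first by rewrite ltnS leq_add2l.
  by rewrite ltn_add2l.
pose Lam (b : 'I_q) := tail_at lam2 (b * n).
have Lam0 b : 0 <= Lam b by exact: tail_at_ge0.
pose L := \sum_b Lam b.
have l0 : tail_at lam2 0 = lam d.+1.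
  by rewrite -[0%N]/(val (Ordinal q_gt0)) tail_atE /lam2 /= addn0.
have Lp : 0 < L.
  rewrite /L (bigD1 (Ordinal q_gt0)) //= ltr_pwDl ?sumr_ge0 // /Lam /= mul0n l0.
  by apply: lam_gt0; rewrite -{1}(addn0 d) ltn_add2l.
(* One variable per block: its logarithm, times [psi], bounds the values at all net points of the
   block at once. *)
pose Gam (b : 'I_q) w := \sum_(i : I) expR (psi^-1 * fro (Z2 w *m (block R n q b *m v i))).
have me (b : 'I_q) i :
    measurable_fun setT (fun w => expR (psi^-1 * fro (Z2 w *m (block R n q b *m v i)))).
  apply: measurableT_comp => //; apply: measurable_funM => //.
  apply: measurable_fro; apply: random_mxM; last exact: random_mx_cst.
  apply: random_mx_rsub; apply: random_mxM; last exact: random_mx_cst.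
  exact: (rm_X_meas model).
have mG b : measurable_fun setT (Gam b) by exact: measurable_sum.
have Gam0 b w : 0 <= Gam b w by apply: sumr_ge0 => i _; exact: expR_ge0.
have EGam b : (\int[P]_w (Gam b w)%:E <= (2 ^+ (19 * n))%:E)%E.
  under eq_integral do rewrite /Gam -sumEFin.
  rewrite ge0_integral_sum //; last by move=> i; exact/measurable_EFinP.
  apply: (@le_trans _ _ (\sum_(i : I) (2 ^+ n)%:E)%E).
    apply: lee_sum => i _; under eq_integral do rewrite Z_tail.
    apply: (exp_fro_le model i0); rewrite fro_col_mx fro0 add0r.
    by rewrite (le_trans (fro_block n_gt0 _ _)).
  rewrite sumEFin lee_fin sumr_const -(mulr_natl (2 ^+ n)).
  have -> : (19 * n)%N = (18 * n + n)%N by rewrite -[19%N]/(18 + 1)%N mulnDl mul1n.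
  by rewrite exprD ler_wpM2r ?exprn_ge0 // -natrX ler_nat.
pose Y w := \sum_b (Lam b / L) * Gam b w.
have mY : measurable_fun setT Y.
  by apply: measurable_sum => b; exact: measurable_funM.
have Y0 w : 0 <= Y w by apply: sumr_ge0 => b _; rewrite mulr_ge0 ?divr_ge0 // ltW.
have EY : (\int[P]_w (Y w)%:E <= (2 ^+ (19 * n))%:E)%E.
  under eq_integral do rewrite /Y -sumEFin.
  rewrite ge0_integral_sum //; last 2 first.
  - by move=> b; apply/measurable_EFinP; exact: measurable_funM.
  - by move=> b w _; rewrite lee_fin mulr_ge0 ?divr_ge0 // ltW.
  apply: (@le_trans _ _ (\sum_(b < q) (Lam b / L * 2 ^+ (19 * n))%:E)%E).
    apply: lee_sum => b _; under eq_integral do rewrite EFinM.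
    rewrite ge0_integralZl_EFin //; last 3 first.
    - by move=> w _; rewrite lee_fin.
    - exact/measurable_EFinP.
    - by rewrite divr_ge0 // ltW.
    rewrite [leRHS]EFinM; apply: lee_wpmul2l; first by rewrite lee_fin divr_ge0 // ltW.
    exact: EGam.
  by rewrite sumEFin lee_fin -mulr_suml -mulr_suml -/L divff ?mul1r // gt_eqF.
(* The mean is at most 2^(19 n), from 2^(18 n) net points and a moment 2^n for each. The level e^(20
   n) leaves a failure probability e^(-n); with the 4 of [net_op_bound] it makes the constant 80. *)
have := whp_markov mY Y0 EY (expR_gt0 (20 * n%:R)).
apply: whp_imp.
  rewrite ler_pdivrMr ?expR_gt0 // -expRD.
  have -> : - n%:R + 20 * n%:R = (19 * n)%:R * 1 :> R by rewrite natrM; ring.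
  have e2 := @expR1_ge2 R.
  by rewrite expRM_natl lerXn2r // ?nnegrE ?expR_ge0 ?ler0n.
move=> w Yw.
have -> : rsubmx (X w) = Z2 w *m diag_mx s2 by rewrite design_split row_mxKr.
(* The net is nonempty and every term is at least 1, so the logarithms [y b] are nonnegative. *)
have Gam1 b : 1 <= Gam b w.
  have [|i _] := vn 0; first by rewrite fro0.
  rewrite /Gam (bigD1 i) //= -[leLHS]addr0 lerD ?sumr_ge0 //.
  by rewrite -expR0 ler_expR mulr_ge0 ?fro_ge0 // invr_ge0 ltW.
have Gamp b : 0 < Gam b w by rewrite (lt_le_trans _ (Gam1 b)).
pose y b := ln (Gam b w).
have y0 b : 0 <= y b by rewrite ln_ge0.
have Hb (b : 'I_q) : opb (Z2 w *m block R n q b) (4 * (psi * y b)).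
  apply: (net_op_bound vn) => i.
  rewrite -mulmxA -ler_pdivrMl // -ler_expR /y lnK ?posrE //.
  rewrite /Gam (bigD1 i) //= lerDl; apply: sumr_ge0 => j _; exact: expR_ge0.
have Hop := blocks_op_bound n_gt0 l2 lm (gam := fun b => 4 * (psi * y b)) _ Hb.
have {}Hop : opb (Z2 w *m diag_mx s2) (\sum_(b < q) 4 * (psi * y b) * tail_at lam2 (b * n)).
  by apply: Hop => b; rewrite mulr_ge0 // mulr_ge0 // ltW.
move=> u; rewrite (le_trans (Hop u)) // ler_wpM2r ?fro_ge0 //.
have hj : \sum_b Lam b / L * y b <= 20 * n%:R.
  rewrite -ler_expR (le_trans _ Yw) //.
  apply: (@le_trans _ _ (\sum_b Lam b / L * expR (y b))).
    apply: expR_jensen => [b|]; first by rewrite divr_ge0 // ltW.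
    by rewrite -mulr_suml divff // gt_eqF.
  by rewrite le_eqVlt; apply/orP; left; apply/eqP; apply: eq_bigr => b _; rewrite /y lnK ?posrE.
have hs : \sum_(b < q) 4 * (psi * y b) * tail_at lam2 (b * n) = 4 * psi * (L * \sum_b Lam b / L * y b).
  rewrite !mulr_sumr; apply: eq_bigr => b _; rewrite -/(Lam b); field.
  by rewrite gt_eqF.
have hm := block_max_sum n_gt0 l2 lm q_gt0; rewrite l0 -/L in hm.
rewrite hs; apply: (@le_trans _ _ (4 * psi * (L * (20 * n%:R)))).
  apply: ler_wpM2l; first by have := psi0; lra.
  by apply: ler_wpM2l => //; exact: ltW.
have := ler_wpM2l (ltW psi0) hm; lra.
Qed.

Variables (K K1 e sg2 : R).
Let l := lam d.+1.
Let g := lam d.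
Let th1 := vseg 0 d theta.
Let th2 := vseg d q theta.
Hypothesis rp : regular_params n s s2 th1 th2 K l g e sg2.
Hypothesis K4 : 4 <= K.
Hypothesis K_op : 80 * psi * (1 + K1) <= K.
Hypothesis sum1_ge : 2 * n%:R * l / K <= \sum_k lam2 k.
Hypothesis sum1_le : \sum_k lam2 k <= K1 * n%:R * l.
Hypothesis sum2E : \sum_k lam2 k ^+ 2 = n%:R * l ^+ 2 * e ^+ 2.
Hypothesis d_small : 18 * d%:R <= n%:R / (4096 * psi ^+ 2).

Lemma whp_good_design :
  whp P (9 * expR (- (n%:R / (4096 * psi ^+ 2))))
    (fun w => good_design (Z1 w) (rsubmx (X w)) s2 th2 K l g e).
Proof.
have l2 k : 0 <= lam2 k by apply: ltW; apply: lam_gt0; rewrite ltn_add2l.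
have hh : 0 < (2^-1 : R) <= 1 by rewrite invr_gt0 invf_le1 ?ltr0n // ler1n.
(* The three choices of [D] give the tail signal X2 th2, the tail weighted by [s2], and the tail
   itself. They contribute 2 each to the factor 9, the head 2 and the operator norm 1. *)
have W3 := whp_fro model i0 (col_mx 0 (diag_mx s2 *m th2)) hh.
have W4 := whp_fro model i0 (col_mx 0 (diag_mx s2 *m diag_mx s2)) hh.
have W5 := whp_fro model i0 (col_mx 0 (diag_mx s2)) hh.
have := whp_and (whp_head d_small) (whp_and whp_tail_op (whp_and W3 (whp_and W4 W5))).
apply: whp_imp.
  set a := n%:R / (4096 * psi ^+ 2).
  have p2 : 1 <= psi ^+ 2 by rewrite exprn_ege1.
  have a0 : 0 <= a by apply: divr_ge0 (ler0n _ _) (ltW _); lra.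
  have h1 : expR (- n%:R) <= expR (- a).
    have p4 : 1 <= 4096 * psi ^+ 2 by lra.
    rewrite ler_expR; have : a <= n%:R; last by lra.
    by rewrite /a; apply: ler_piMr (ler0n _ _) _; rewrite invf_le1 ?(lt_le_trans ltr01).
  have h2 : expR (- (n%:R * 2^-1 ^+ 2 / (128 * psi ^+ 2))) <= expR (- a).
    rewrite ler_expR lerN2.
    have -> : n%:R * 2^-1 ^+ 2 / (128 * psi ^+ 2) = 8 * a.
      by rewrite /a; field; rewrite gt_eqF.
    lra.
  lra.
move=> w [H1 [H2 [H3 [H4 H5]]]].
have nR : 0 < n%:R :> R by rewrite ltr0n.
have l0 : 0 < l by exact: rp_l rp.
have X2E m (M : 'M[R]_(q, m)) : rsubmx (X w) *m M = Zw w *m col_mx 0 (diag_mx s2 *m M).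
  by rewrite -Z_tail mulmxA design_split row_mxKr.
have f2 : fro (diag_mx s2 *m diag_mx s2) = n%:R * l ^+ 2 * e ^+ 2.
  rewrite -sum2E /fro /mdot; apply: eq_bigr => k _.
  rewrite (bigD1 k) //= big1 => [|j jk].
    rewrite addr0 mul_diag_mx !mxE eqxx mulr1n -expr2 -[_ * _]expr2 sqr_sqrtr //.
  by rewrite mul_diag_mx !mxE eq_sym (negbTE jk) mulr0n mulr0 mul0r.
have f1 : fro (diag_mx s2) = \sum_k lam2 k.
  rewrite /fro /mdot; apply: eq_bigr => k _.
  rewrite (bigD1 k) //= big1 => [|j jk].
    by rewrite addr0 !mxE eqxx mulr1n -expr2 sqr_sqrtr.
  by rewrite !mxE eq_sym (negbTE jk) mulr0n mul0r.
have K0 : 0 < K by have := K4; lra.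
have [H4a H4b] := half_deviation H4; have [H5a _] := half_deviation H5.
have [_ H3b] := half_deviation H3.
rewrite fro_col_mx fro0 add0r f2 in H4a H4b; rewrite fro_col_mx fro0 add0r f1 in H5a.
rewrite fro_col_mx fro0 add0r in H3b.
set S := n%:R * (n%:R * l ^+ 2 * e ^+ 2) in H4a H4b.
have S0 : 0 <= S by apply: mulr_ge0 (ltW nR) _; do 2! apply: mulr_ge0 (sqr_ge0 _); exact: ltW.
have SE : S = n%:R ^+ 2 * l ^+ 2 * e ^+ 2 by rewrite /S expr2 !mulrA.
split.
- by move=> v; have [_] := half_deviation (H1 v); rewrite mulrA.
- by move=> v; have [] := half_deviation (H1 v).
- move=> v; rewrite (le_trans (H2 v)) // ler_wpM2r ?fro_ge0 // -/l.
  apply: (@le_trans _ _ (80 * psi * (1 + K1) * (n%:R * l))).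
    have h0 : 0 <= 80 * psi by rewrite mulr_ge0 // ltW.
    rewrite -(mulrA (80 * psi)) ler_wpM2l // mulrDl mul1r lerD2l mulrA; exact: sum1_le.
  by rewrite -(mulrA K) ler_wpM2r // mulr_ge0 // ltW.
- by rewrite X2E; exact: signal_deviation (ltW nR) K4 (rp_tail rp) H3b.
- by rewrite X2E -SE; exact: deviation_ge S0 K4 H4a.
- by rewrite X2E -2!(mulrA K) -SE; exact: deviation_le S0 K4 H4b.
- have -> : rsubmx (X w) = rsubmx (X w) *m 1%:M by rewrite mulmx1.
  by rewrite X2E mulmx1; exact: trace_deviation (ltW nR) sum1_ge H5a.
Qed.

End GoodDesign.

(** * Conditional expectation given the design *)

Section Mean.
Context d (T : measurableType d) (R : realType) (P : probability T R).
Implicit Types (f g : T -> R).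

(** Bundling integrability with the value lets linearity be used without side conditions. *)
Definition mean f (c : R) :=
  P.-integrable setT (EFin \o f) /\ (\int[P]_w (f w)%:E = c%:E)%E.

Lemma mean_measurable f c : mean f c -> measurable_fun setT f.
Proof. by move=> [/measurable_int/measurable_EFinP]. Qed.

Lemma eq_mean f g c : (forall w, f w = g w) -> mean f c -> mean g c.
Proof. by move=> fg; have -> : f = g by apply/funext. Qed.

Lemma mean_unique f c c' : mean f c -> mean f c' -> c = c'.
Proof. by move=> [_ fc] [_]; rewrite fc => -[]. Qed.

Lemma mean_integrable f : P.-integrable setT (EFin \o f) -> exists c, mean f c.
Proof.
move=> fi; exists (fine (\int[P]_w (f w)%:E)); split => //.
by rewrite fineK //; exact: integrable_fin_num.
Qed.

Lemma mean_ge0_le f (a : R) : measurable_fun setT f -> (forall w, 0 <= f w) ->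
  (\int[P]_w (f w)%:E = a%:E)%E -> mean f a.
Proof. by move=> mf f0 fa; split => //; apply: (@ge0_integrable _ _ _ _ _ a); rewrite ?fa. Qed.

Lemma mean_dominated f g c : measurable_fun setT f -> (forall w, `|f w| <= g w) ->
  mean g c -> exists a, mean f a.
Proof.
move=> mf fg [gi _]; apply: mean_integrable; apply: le_integrable gi => //.
  exact/measurable_EFinP.
by move=> w _ /=; rewrite lee_fin (le_trans (fg w)) // ler_norm.
Qed.

Lemma mean_cst (c : R) : mean (fun=> c) c.
Proof.
split; first exact: finite_measure_integrable_cst.
by rewrite integral_cst // [X in (_ * X)%E](probability_setT P) mule1.
Qed.

Lemma meanZ f (a c : R) : mean f c -> mean (fun w => a * f w) (a * c).
Proof. by move=> [fi fc]; split; [exact: integrable_scale|exact: integral_scale]. Qed.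

Lemma meanD f g (a b : R) : mean f a -> mean g b -> mean (fun w => f w + g w) (a + b).
Proof.
move=> [fi fa] [gi gb]; split; first by apply: eq_integrable (integrableD measurableT fi gi).
by under eq_integral do rewrite EFinD; rewrite integralD // fa gb.
Qed.

Lemma meanB f g (a b : R) : mean f a -> mean g b -> mean (fun w => f w - g w) (a - b).
Proof.
move=> fa gb; have := meanD fa (meanZ (-1) gb); rewrite mulN1r.
by apply: eq_mean => w; rewrite mulN1r.
Qed.

Lemma mean_sum (I : finType) (f : I -> T -> R) (c : I -> R) :
  (forall i, mean (f i) (c i)) -> mean (fun w => \sum_i f i w) (\sum_i c i).
Proof.
move=> H; elim: (index_enum I) => [|i s IH].
  by rewrite big_nil; apply: eq_mean (mean_cst 0) => w; rewrite big_nil.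
by rewrite big_cons; apply: eq_mean (meanD (H i) IH) => w; rewrite big_cons.
Qed.

End Mean.

Section Noise.
Context disp (T : measurableType disp) (R : realType) (P : probability T R).
Variables (n d p : nat) (lam theta : nat -> R) (sigma sigma_x : R).
Variables (X : T -> 'M[R]_(n, p)) (eps : T -> 'cV[R]_n).
Hypothesis model : regression_model P d lam theta sigma sigma_x X eps.

Let mX := rm_X_meas model.
Let meps i : measurable_fun [set: T] (fun w => eps w i ord0).
Proof. exact: (rm_eps_meas model). Qed.

Let mXT : measurable_fun [set: T] (X : T -> mxT R n p).
Proof. exact: random_mx_measurable. Qed.

Let measurable_pre d1 (T1 : measurableType d1) d2 (T2 : measurableType d2) (f : T1 -> T2) B :
  measurable_fun [set: T1] f -> measurable B -> measurable (f @^-1` B).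
Proof. by move=> mf mB; rewrite -[_ @^-1` _]setTI; exact: mf. Qed.

Let mrow i : measurable_fun [set: mxT R n p] ((fun M : mxT R n p => row i M) : _ -> mxT R 1 p).
Proof. by apply: random_mx_measurable; apply: random_mx_row; exact: random_mx_id. Qed.

(** The model assumes independence of the pairs (y_i, x_i). The noise is a function of its pair, y_i
    minus the product of x_i and theta, and inside one pair [rm_noise_indep] separates it from
    x_i. *)
Lemma rectangle_indep (B : 'I_n -> set 'M[R]_(1, p)) (D : 'I_n -> set R) :
  (forall i, mx_measurable (B i)) -> (forall i, measurable (D i)) ->
  P [set w | forall i, B i (row i (X w)) /\ D i (eps w i ord0)] =
  (\prod_i P [set w | B i (row i (X w))] * \prod_i P [set w | D i (eps w i ord0)])%E.
Proof.
move=> mB mD.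
pose B' i : set 'M[R]_(1, 1 + p) := [set S | B i (rsubmx S) /\
  D i ((lsubmx S - rsubmx S *m vseg 0 p theta) ord0 ord0)].
have SE i w : B' i (row_mx (row i (response (X w) theta (eps w))) (row i (X w))) =
    (B i (row i (X w)) /\ D i (eps w i ord0)).
  rewrite /B' /= row_mxKl row_mxKr /response; congr (_ /\ D i _).
  by rewrite linearD /= row_mul addrAC subrr add0r mxE.
have mB' i : mx_measurable (B' i).
  have r1 : measurable_fun [set: mxT R 1 (1 + p)]
      ((fun S : mxT R 1 (1 + p) => rsubmx (S : 'M[R]_(1, 1 + p))) : _ -> mxT R 1 p).
    by apply: random_mx_measurable; apply: random_mx_rsub; exact: random_mx_id.
  have r2 : measurable_fun [set: mxT R 1 (1 + p)] (fun S : mxT R 1 (1 + p) =>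
      (lsubmx (S : 'M[R]_(1, 1 + p)) - rsubmx (S : 'M[R]_(1, 1 + p)) *m vseg 0 p theta) ord0 ord0).
    apply: random_mxD; first by apply: random_mx_lsub; exact: random_mx_id.
    apply: random_mxN; apply: random_mxM; last exact: random_mx_cst.
    by apply: random_mx_rsub; exact: random_mx_id.
  have h1 := r1 measurableT _ (mB i); have h2 := r2 measurableT _ (mD i).
  rewrite setTI in h1; rewrite setTI in h2.
  exact: (measurableI _ _ h1 h2).
have := rm_indep model mB'.
under [X in P [set w | X w]]eq_fun do under eq_forall do rewrite SE.
move=> ->; rewrite -big_split /=; apply: eq_bigr => i _.
have mD' : mx_measurable [set M : 'M[R]_1 | D i (M ord0 ord0)].
  have := (@random_mx_id R 1 1 ord0 ord0) measurableT _ (mD i).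
  by rewrite setTI.
transitivity (P ([set w | B i (row i (X w))] `&` [set w | D i (eps w i ord0)])).
  by congr (P _); apply/funext => w; rewrite /= SE.
have := rm_noise_indep model i (mB i) mD'.
rewrite /preimage /=; under [X in P (_ `&` [set w | X w])]eq_fun do rewrite mxE.
by move=> ->; congr (_ * P _)%E; apply/funext => w /=; rewrite mxE.
Qed.

Lemma row_indep (B : 'I_n -> set 'M[R]_(1, p)) : (forall i, mx_measurable (B i)) ->
  P [set w | forall i, B i (row i (X w))] = (\prod_i P [set w | B i (row i (X w))])%E.
Proof.
move=> mB; have := @rectangle_indep B (fun=> setT) mB (fun=> measurableT).
rewrite [X in (_ * X)%E]big1 ?mule1 => [|i _]; last exact: probability_setT.
move=> <-; congr (P _); apply/funext => w; apply/propext; split => h i; first by split.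
by case: (h i).
Qed.

(** Both sides are finite measures in [C], and by [rectangle_indep] they agree on row rectangles. *)
Lemma noise_indep (D : 'I_n -> set R) : (forall i, measurable (D i)) ->
  forall C : set (mxT R n p), measurable C ->
  P (X @^-1` C `&` [set w | forall i, D i (eps w i ord0)]) =
  (\prod_i P [set w | D i (eps w i ord0)] * P (X @^-1` C))%E.
Proof.
move=> mD C mC; set E := [set w | forall i, _].
have mE : measurable E.
  have -> : E = \bigcap_(i in [set: 'I_n]) [set w | D i (eps w i ord0)].
    by apply/seteqP; split => w h i; [move=> _|]; exact: h.
  by apply: fin_bigcap_measurable => // i _; apply: measurable_pre (meps i) (mD i).
set e := (\prod_i _)%E.
have [r er r0] : exists2 r : R, e = r%:E & 0 <= r.
  exists (fine e); last by apply: fine_ge0; apply: prode_ge0 => i _; exact: measure_ge0.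
  rewrite fineK //; apply: (big_ind (fun x : \bar R => x \is a fin_num)) => //.
    by move=> x y; exact: fin_numM.
  move=> i _; apply: fin_num_measure; exact: measurable_pre (meps i) (mD i).
(* Row rectangles: they are closed under intersection, and they generate because an entry is a
   function of its row. *)
pose G := [set A : set (mxT R n p) | exists2 B : 'I_n -> set 'M[R]_(1, p),
  (forall i, mx_measurable (B i)) & A = [set M : 'M[R]_(n, p) | forall i, B i (row i M)]].
pose m1 : {measure set (mxT R n p) -> \bar R} := pushforward (mrestr P mE) (X : T -> mxT R n p).
pose m2 : {measure set (mxT R n p) -> \bar R} := mscale (NngNum r0) (pushforward P (X : T -> mxT R n p)).
rewrite er; apply: (measure_unique G (fun=> setT) _ _ _ _ (m1 mXT) (m2 mXT)) => //.
- apply/seteqP; split; last first.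
    apply: smallest_sub; first exact: sigma_algebra_measurable.
    move=> _ [B mB ->].
    have -> : [set M : 'M[R]_(n, p) | forall i, B i (row i M)] =
        \bigcap_(i in [set: 'I_n]) ((fun M : mxT R n p => row i M) @^-1` B i).
      by apply/seteqP; split => w h i; [move=> _|]; exact: h.
    apply: fin_bigcap_measurable => // i _.
    by have := mrow i measurableT (mB i); rewrite setTI.
  apply: smallest_sub; first exact: smallest_sigma_algebra.
  move=> _ [i [j [B [mB ->]]]]; apply: sub_sigma_algebra.
  exists (fun i' => if i' == i then [set S | B (S ord0 j)] else setT) => [i'|].
    case: (i' == i); last exact: (@measurableT _ (mxT R 1 p)).
    by have := (@random_mx_id R 1 p ord0 j) measurableT _ mB; rewrite setTI.
  apply/funext => M /=; apply/propext; split => [h i'|/(_ i)].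
    by case: eqP => // ->; rewrite /= mxE.
  by rewrite eqxx /= mxE.
- move=> _ _ [B mB ->] [B' mB' ->]; exists (fun i => B i `&` B' i).
    by move=> i; exact: (@measurableI _ (mxT R 1 p) _ _ (mB i) (mB' i)).
  apply/seteqP; split => M; first by move=> [h h'] i; split.
  by move=> h; split => i; case: (h i).
- move=> _; exists (fun=> setT); first by move=> i; exact: (@measurableT _ (mxT R 1 p)).
  by apply/esym/seteqP; split.
- by apply/seteqP; split => // M _; exists 0%N.
- move=> _ [B mB ->]; rewrite /m1 /m2 /= /mscale /= /pushforward /mrestr -er.
  have := rectangle_indep mB mD; rewrite -row_indep // => h.
  rewrite muleC; apply: etrans h.
  congr (P _); apply/seteqP; split => w /=; first by move=> [h1 h2] i; split.
  by move=> h1; split => i; case: (h1 i).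
- move=> _; rewrite /m1 /= /pushforward /mrestr.
  by rewrite preimage_setT setTI (le_lt_trans (probability_le1 _ mE)) ?ltry.
Qed.

(** [h (X w)] is treated as one more independent variable, placed at index [ord0], so that
    [integral_prod_indep] applies. *)
Lemma noise_prod (h : mxT R n p -> R) (g : 'I_n -> R -> R) :
  measurable_fun setT h -> (forall x, 0 <= h x) ->
  (\int[P]_w (h (X w))%:E < +oo)%E ->
  (forall i, measurable_fun setT (g i)) -> (forall i x, 0 <= g i x) ->
  (forall i, \int[P]_w (g i (eps w i ord0))%:E < +oo)%E ->
  (\int[P]_w (h (X w) * \prod_i g i (eps w i ord0))%:E =
   \int[P]_w (h (X w))%:E * \prod_i \int[P]_w (g i (eps w i ord0))%:E)%E.
Proof.
move=> mh h0 hoo mg g0 goo.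
pose Y (i : 'I_n.+1) w := if unlift ord0 i is Some j then g j (eps w j ord0) else h (X w).
have Y0 w : Y ord0 w = h (X w) by rewrite /Y unlift_none.
have YS i w : Y (lift ord0 i) w = g i (eps w i ord0) by rewrite /Y liftK.
have mgi i : measurable_fun [set: T] (fun w => g i (eps w i ord0)).
  exact: measurableT_comp (mg i) (meps i).
have mhX : measurable_fun [set: T] (fun w => h (X w)) by exact: measurableT_comp mh mXT.
have := @integral_prod_indep _ _ _ P n.+1 Y.
under eq_integral do rewrite big_ord_recl Y0.
under eq_integral do under eq_bigr do rewrite YS.
rewrite big_ord_recl; under [X in (X * _)%E]eq_integral do rewrite Y0.
under [X in (_ * X)%E]eq_bigr do under eq_integral do rewrite YS.
apply.
- move=> i; case: (unliftP ord0 i) => [j ->|->].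
    by have -> : Y (lift ord0 j) = (fun w => g j (eps w j ord0)) by apply/funext.
  by have -> : Y ord0 = (fun w => h (X w)) by apply/funext.
- by move=> i w; rewrite /Y; case: (unlift ord0 i).
- move=> i; case: (unliftP ord0 i) => [j ->|->].
    by under eq_integral do rewrite YS.
  by under eq_integral do rewrite Y0.
move=> B mB.
pose D i := g i @^-1` B (lift ord0 i).
have mD i : measurable (D i) by exact: measurable_pre (mg i) (mB _).
have mC : measurable (h @^-1` B ord0) by exact: measurable_pre mh (mB _).
rewrite big_ord_recl.
have E0 : Y ord0 @^-1` B ord0 = X @^-1` (h @^-1` B ord0).
  by apply/funext => w; rewrite /preimage /= Y0.
have ES i : Y (lift ord0 i) @^-1` B (lift ord0 i) = [set w | D i (eps w i ord0)].
  by apply/funext => w; rewrite /preimage /= YS.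
rewrite E0; under eq_bigr do rewrite ES.
rewrite muleC -noise_indep //; congr (P _); apply/funext => w; apply/propext; split.
  move=> H; split; first by have := H ord0; rewrite Y0.
  by move=> i; have := H (lift ord0 i); rewrite YS.
move=> [H1 H2] i; case: (unliftP ord0 i) => [j ->|->]; last by rewrite Y0.
by rewrite YS; exact: H2.
Qed.

Lemma eps_mean i : mean P (fun w => eps w i ord0) 0.
Proof.
have he := rm_eps_mean model i; have := rm_eps_var model i.
rewrite /variance covariance.unlock he expectation.unlock => hv.
rewrite expectation.unlock in he; split => //; apply: integrable_of_sqr => //.
apply: (@integrable_sqr _ _ _ _ _ (sigma ^+ 2)) => //.
by rewrite -hv; apply: eq_integral => w _; rewrite expr2 /GRing.mul /= !subr0.
Qed.

Lemma eps_sqr_mean i : mean P (fun w => eps w i ord0 ^+ 2) (sigma ^+ 2).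
Proof.
have := rm_eps_var model i; rewrite /variance covariance.unlock (rm_eps_mean model i).
rewrite expectation.unlock => hv.
apply: mean_ge0_le; [exact: measurable_funX|by move=> w; exact: sqr_ge0|].
by rewrite -hv; apply: eq_integral => w _; rewrite expr2 /GRing.mul /= !subr0.
Qed.

Lemma noise_prod_mean (h : mxT R n p -> R) (g : 'I_n -> R -> R) (m : R) (c : 'I_n -> R) :
  measurable_fun setT h -> (forall x, 0 <= h x) -> mean P (fun w => h (X w)) m ->
  (forall i, measurable_fun setT (g i)) -> (forall i x, 0 <= g i x) ->
  (forall i, mean P (fun w => g i (eps w i ord0)) (c i)) ->
  mean P (fun w => h (X w) * \prod_i g i (eps w i ord0)) (m * \prod_i c i).
Proof.
move=> mh h0 hm mg g0 gc; apply: mean_ge0_le.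
- apply: measurable_funM; first exact: mean_measurable hm.
  by apply: measurable_prod => i _; exact: mean_measurable (gc i).
- by move=> w; rewrite mulr_ge0 ?prodr_ge0.
rewrite noise_prod //; last 2 first.
- by rewrite hm.2 ltry.
- by move=> i; rewrite (gc i).2 ltry.
rewrite hm.2 EFinM -prodEFin; congr (_ * _)%E.
by apply: eq_bigr => i _; exact: (gc i).2.
Qed.

(* For [G] a function of the noise: [E(G | X) = c]. *)
Definition noise_uncorr (G : T -> R) (c : R) := forall (h : mxT R n p -> R) (C m : R),
  measurable_fun setT h -> (forall x, `|h x| <= C) -> mean P (fun w => h (X w)) m ->
  mean P (fun w => h (X w) * G w) (m * c).

(** A bounded [h] is h + C minus the constant C, and h + C is nonnegative. *)
Lemma noise_uncorr_ge0 G c : mean P G c ->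
  (forall (h : mxT R n p -> R) m, measurable_fun setT h -> (forall x, 0 <= h x) ->
    mean P (fun w => h (X w)) m -> mean P (fun w => h (X w) * G w) (m * c)) ->
  noise_uncorr G c.
Proof.
move=> Gc H h C m mh hC hm.
have h0 x : 0 <= h x + C by have := hC x; rewrite ler_norml => /andP[]; lra.
have mhC : measurable_fun [set: mxT R n p] (fun x => h x + C) by exact: measurable_funD.
have := meanB (H _ _ mhC h0 (meanD hm (mean_cst P C))) (meanZ C Gc).
rewrite mulrDl addrK; apply: eq_mean => w; ring.
Qed.

Lemma noise_uncorrB G G' c c' : noise_uncorr G c -> noise_uncorr G' c' ->
  noise_uncorr (fun w => G w - G' w) (c - c').
Proof.
move=> H H' h C m mh hC hm; have := meanB (H _ _ _ mh hC hm) (H' _ _ _ mh hC hm).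
by rewrite -mulrBr; apply: eq_mean => w; rewrite mulrBr.
Qed.

Lemma eq_noise_uncorr G G' c c' : (forall w, G w = G' w) -> c = c' ->
  noise_uncorr G c -> noise_uncorr G' c'.
Proof. by move=> GG <-; have -> : G = G' by apply/funext. Qed.

Lemma noise_uncorr1 i (a : R -> R) (c : R) : measurable_fun setT a -> (forall x, 0 <= a x) ->
  mean P (fun w => a (eps w i ord0)) c -> noise_uncorr (fun w => a (eps w i ord0)) c.
Proof.
move=> ma a0 ac; apply: noise_uncorr_ge0 => // h m mh h0 hm.
have := @noise_prod_mean h (fun k => if k == i then a else cst 1) m
  (fun k => if k == i then c else 1) mh h0 hm.
have -> : \prod_k (if k == i then c else 1) = c.
  by rewrite (bigD1 i) //= eqxx big1 ?mulr1 // => k /negbTE ->.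
have E w : \prod_k (if k == i then a else cst 1) (eps w k ord0) = a (eps w i ord0).
  by rewrite (bigD1 i) //= eqxx big1 ?mulr1 // => k /negbTE ->.
move=> H; apply: eq_mean (H _ _ _) => [w|k|k x|k]; first by rewrite E.
- by case: (k == i).
- by case: (k == i).
- by case: eqP => [->//|_]; exact: mean_cst.
Qed.

Lemma noise_uncorr2 i j (a b : R -> R) (c e : R) : i != j ->
  measurable_fun setT a -> (forall x, 0 <= a x) -> measurable_fun setT b -> (forall x, 0 <= b x) ->
  mean P (fun w => a (eps w i ord0)) c -> mean P (fun w => b (eps w j ord0)) e ->
  noise_uncorr (fun w => a (eps w i ord0) * b (eps w j ord0)) (c * e).
Proof.
move=> ij ma a0 mb b0 ac be.
pose g k := if k == i then a else if k == j then b else cst 1.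
pose f k := if k == i then c else if k == j then e else 1.
have gE w : \prod_k g k (eps w k ord0) = a (eps w i ord0) * b (eps w j ord0).
  rewrite (bigD1 i) //= (bigD1 j) 1?eq_sym //= /g eqxx (eq_sym j) (negbTE ij) eqxx.
  by rewrite big1 ?mulr1 // => k /andP[/negbTE -> /negbTE ->].
have fE : \prod_k f k = c * e.
  rewrite (bigD1 i) //= (bigD1 j) 1?eq_sym //= /f eqxx (eq_sym j) (negbTE ij) eqxx.
  by rewrite big1 ?mulr1 // => k /andP[/negbTE -> /negbTE ->].
have H (h : mxT R n p -> R) m : measurable_fun setT h -> (forall x, 0 <= h x) ->
  mean P (fun w => h (X w)) m ->
  mean P (fun w => h (X w) * (a (eps w i ord0) * b (eps w j ord0))) (m * (c * e)).
  move=> mh h0 hm; rewrite -fE.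
  apply: eq_mean (@noise_prod_mean h g m f mh h0 hm _ _ _) => [w|k|k x|k].
  - by rewrite gE.
  - by rewrite /g; case: (k == i) => //; case: (k == j).
  - by rewrite /g; case: (k == i) => //; case: (k == j).
  - by rewrite /g /f; case: eqP => [->//|_]; case: eqP => [->//|_]; exact: mean_cst.
apply: (noise_uncorr_ge0 _ H).
have := H (cst 1) 1 (measurable_cst _) (fun=> ler01) (mean_cst P 1).
by rewrite mul1r; apply: eq_mean => w; rewrite mul1r.
Qed.

(** The product rule is for nonnegative functions, so the noise is split into its positive and
    negative parts. *)
Let pos (x : R) := Num.max x 0.
Let neg (x : R) := Num.max (- x) 0.
Let pos_neg x : x = pos x - neg x.
Proof. by rewrite /pos /neg; case: (leP x 0); case: (leP (- x) 0); lra. Qed.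
Let pos0 x : 0 <= pos x. Proof. by rewrite /pos le_max lexx orbT. Qed.
Let neg0 x : 0 <= neg x. Proof. by rewrite /neg le_max lexx orbT. Qed.
Let mpos : measurable_fun setT pos. Proof. exact: measurable_maxr. Qed.
Let mneg : measurable_fun setT neg.
Proof. by apply: measurable_maxr => //; exact: measurable_funN. Qed.

Let eps_parts i : exists a, mean P (fun w => pos (eps w i ord0)) a /\
  mean P (fun w => neg (eps w i ord0)) a.
Proof.
have Ha := mean_measurable (eps_mean i).
have sq (x : R) : `|x| <= x ^+ 2 + 1.
  by rewrite -(real_normK (num_real x)); have := sqr_ge0 (`|x| - 1); have := normr_ge0 x; lra.
have hd := meanD (eps_sqr_mean i) (mean_cst P 1).
have [a ha] : exists a, mean P (fun w => pos (eps w i ord0)) a.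
  apply: mean_dominated hd => [|w]; first exact: measurableT_comp mpos (meps i).
  rewrite (le_trans _ (sq _)) // ger0_norm // /pos ge_max normr_ge0 andbT.
  exact: ler_norm.
have [b hb] : exists a, mean P (fun w => neg (eps w i ord0)) a.
  apply: mean_dominated hd => [|w]; first exact: measurableT_comp mneg (meps i).
  rewrite (le_trans _ (sq _)) // ger0_norm // /neg ge_max normr_ge0 andbT -normrN.
  exact: ler_norm.
have hab : mean P (fun w => eps w i ord0) (a - b).
  by apply: eq_mean (meanB ha hb) => w; rewrite -pos_neg.
have := mean_unique hab (eps_mean i) => /eqP; rewrite subr_eq0 => /eqP ab.
by exists a; split => //; rewrite ab.
Qed.

Lemma noise_uncorr_eps i : noise_uncorr (fun w => eps w i ord0) 0.
Proof.
have [a [ha hb]] := eps_parts i.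
apply: eq_noise_uncorr (noise_uncorrB (noise_uncorr1 mpos pos0 ha) (noise_uncorr1 mneg neg0 hb)).
  by move=> w; rewrite -pos_neg.
by rewrite subrr.
Qed.

Lemma noise_uncorr_eps2 i j :
  noise_uncorr (fun w => eps w i ord0 * eps w j ord0) (if i == j then sigma ^+ 2 else 0).
Proof.
case: eqVneq => [<-|ij].
  apply: eq_noise_uncorr (@noise_uncorr1 i (fun x => x ^+ 2) _ _ _ (eps_sqr_mean i)) => //.
  by move=> x; exact: sqr_ge0.
have [a [ha ha']] := eps_parts i; have [b [hb hb']] := eps_parts j.
have H := noise_uncorrB
  (noise_uncorrB (noise_uncorr2 ij mpos pos0 mpos pos0 ha hb) (noise_uncorr2 ij mpos pos0 mneg neg0 ha hb'))
  (noise_uncorrB (noise_uncorr2 ij mneg neg0 mpos pos0 ha' hb) (noise_uncorr2 ij mneg neg0 mneg neg0 ha' hb')).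
apply: eq_noise_uncorr H; last by ring.
by move=> w; rewrite [in RHS](pos_neg (eps w i ord0)) [in RHS](pos_neg (eps w j ord0)); ring.
Qed.

End Noise.

Section NullSet.
Context d (T : measurableType d) (R : realType) (P : probability T R).

Lemma integral_indic_mul (A : set T) (f : T -> R) :
  (\int[P]_(w in A) (f w)%:E = \int[P]_w (\1_A w * f w)%:E)%E.
Proof.
rewrite integral_mkcond; apply: eq_integral => w _; rewrite patchE indicE.
by case: ifPn => _; rewrite ?mul1r ?mul0r.
Qed.

(** Boundedness on [A] makes both integrals finite, so they can be subtracted: g - f is positive on
    [A] with integral 0. *)
Lemma lt_integral_null (f g : T -> R) (A : set T) (k : R) : measurable A ->
  measurable_fun setT f -> measurable_fun setT g ->
  (forall w, A w -> [/\ `|f w| <= k, `|g w| <= k & f w < g w]) ->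
  (\int[P]_(w in A) (f w)%:E = \int[P]_(w in A) (g w)%:E)%E -> P A = 0%E.
Proof.
move=> mA mf mg H; rewrite (integral_indic_mul A f) (integral_indic_mul A g) => E.
have m1 : measurable_fun setT (\1_A : T -> R) by exact: measurable_indic.
have [a fa] : exists a, mean P (fun w => \1_A w * f w) a.
  apply: mean_dominated (mean_cst P `|k|) => [|w]; first exact: measurable_funM.
  rewrite indicE; case: (boolP (w \in A)) => [|_]; last by rewrite mul0r normr0.
  by rewrite inE mul1r => /H[h _ _]; rewrite (le_trans h) // ler_norm.
have [b gb] : exists a, mean P (fun w => \1_A w * g w) a.
  apply: mean_dominated (mean_cst P `|k|) => [|w]; first exact: measurable_funM.
  rewrite indicE; case: (boolP (w \in A)) => [|_]; last by rewrite mul0r normr0.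
  by rewrite inE mul1r => /H[_ h _]; rewrite (le_trans h) // ler_norm.
have [hi h0] := meanB gb fa.
move: E; rewrite fa.2 gb.2 => -[ab]; rewrite ab subrr in h0.
set F := (fun w => _ - _) in hi h0.
have F0 w : 0 <= F w.
  rewrite /F -mulrBr indicE; case: (boolP (w \in A)) => [|_]; last by rewrite mul0r.
  by rewrite inE mul1r subr_ge0 => /H[_ _ /ltW].
have mF := measurable_int _ hi.
have : (\int[P]_(w in setT) `|(EFin \o F) w| = 0)%E.
  by rewrite -[RHS]h0; apply: eq_integral => w _ /=; rewrite ger0_norm.
move/(ae_eq_integral_abs _ measurableT mF) => [N [mN N0 HN]].
apply/eqP; rewrite -measure_le0 -N0; apply: le_measure; rewrite ?inE //.
move=> w Aw; apply: HN => /= /(_ I) [] /eqP; apply/negP; rewrite gt_eqF //.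
have [_ _ h] := H w Aw.
by rewrite /F -mulrBr indicE mem_set // mul1r subr_gt0.
Qed.

End NullSet.

Section ConditionalRisk.
Context disp (T : measurableType disp) (R : realType) (P : probability T R).
Variables (n d p : nat) (lam theta : nat -> R) (sigma sigma_x : R).
Variables (X : T -> 'M[R]_(n, p)) (eps : T -> 'cV[R]_n).
Hypothesis model : regression_model P d lam theta sigma sigma_x X eps.
Variables (m : nat) (b : 'M[R]_(n, p) -> 'cV[R]_m) (L : 'M[R]_(n, p) -> 'M[R]_(m, n)).
Hypothesis mb : random_mx (b : mxT R n p -> _).
Hypothesis mL : random_mx (L : mxT R n p -> _).

Let mXT : measurable_fun [set: T] (X : T -> mxT R n p).
Proof. exact: random_mx_measurable (rm_X_meas model). Qed.

Let meps i : measurable_fun [set: T] (fun w => eps w i ord0).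
Proof. exact: (rm_eps_meas model). Qed.

Let Z w := fro (b (X w) + L (X w) *m eps w).
Let V (x : mxT R n p) := fro (b x) + sigma ^+ 2 * fro (L x).
Let c1 (x : mxT R n p) := (L x)^T *m b x.
Let c2 (x : mxT R n p) := (L x)^T *m L x.
(** Dominates every coefficient of the expanded square, through |z| <= z^2 + 1, so all of them are
    bounded where Q <= k. *)
Let Q x := V x + fro (c1 x) + fro (c2 x).

Let mc1 : random_mx c1. Proof. by apply: random_mxM => //; exact: random_mx_tr. Qed.
Let mc2 : random_mx c2. Proof. by apply: random_mxM => //; exact: random_mx_tr. Qed.
Let mV : measurable_fun setT V.
Proof.
apply: measurable_funD; first exact: measurable_fro.
by apply: measurable_funM => //; exact: measurable_fro.
Qed.
Let mQ : measurable_fun setT Q.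
Proof. by do 2! [apply: measurable_funD; last exact: measurable_fro]. Qed.

Let V0 x : 0 <= V x.
Proof. exact: addr_ge0 (fro_ge0 _) (mulr_ge0 (sqr_ge0 _) (fro_ge0 _)). Qed.

Let bounded_mean (h : mxT R n p -> R) (C : R) : measurable_fun setT h ->
  (forall x, `|h x| <= C) -> mean P (fun w => h (X w)) (fine (\int[P]_w (h (X w))%:E)).
Proof.
move=> mh hC; have [a ha] : exists a, mean P (fun w => h (X w)) a.
  by apply: mean_dominated (mean_cst P C) => //; exact: measurableT_comp mh mXT.
by have -> : (\int[P]_w (h (X w))%:E = a%:E)%E by exact: ha.2.
Qed.

Let Z_expand w : Z w = fro (b (X w)) + \sum_j 2 * (c1 (X w) j ord0 * eps w j ord0)
  + \sum_(jk : 'I_n * 'I_n) c2 (X w) jk.1 jk.2 * (eps w jk.1 ord0 * eps w jk.2 ord0).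
Proof.
rewrite /Z froD mdot_mulr -/(c1 (X w)) -mulr_sumr; congr (_ + 2 * _ + _).
  by apply: eq_bigr => j _; rewrite big_ord1.
rewrite /fro mdot_mull mulmxA -/(c2 (X w)) /mdot.
rewrite -(pair_bigA _ (fun j k => c2 (X w) j k * (eps w j ord0 * eps w k ord0))) /=.
apply: eq_bigr => j _; rewrite big_ord1 mxE mulr_sumr.
by apply: eq_bigr => k _; ring.
Qed.

(** The square is expanded in the noise. The linear terms and the off-diagonal products average to 0
    given X, and the diagonal ones leave sigma^2 times the trace of L^T L. *)
Let integral_risk (C : set (mxT R n p)) (k : R) : measurable C -> (forall x, C x -> Q x <= k) ->
  (\int[P]_(w in X @^-1` C) (Z w)%:E = \int[P]_(w in X @^-1` C) (V (X w))%:E)%E.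
Proof.
move=> mC Qk; rewrite (integral_indic_mul _ _ Z) (integral_indic_mul _ _ (fun w => V (X w))).
pose i (x : mxT R n p) : R := \1_C x.
have mi : measurable_fun setT i by exact: measurable_indic.
have ib (f : mxT R n p -> R) (c : R) : 0 <= c -> (forall x, C x -> `|f x| <= c) -> forall x, `|i x * f x| <= c.
  move=> c0 fc x; rewrite /i indicE; case: (boolP (x \in C)) => [|_]; last by rewrite mul0r normr0.
  by rewrite inE mul1r; exact: fc.
have sq (x : R) : `|x| <= x ^+ 2 + 1.
  by rewrite -(real_normK (num_real x)); have := sqr_ge0 (`|x| - 1); have := normr_ge0 x; lra.
have b1 j x : `|i x * c1 x j ord0| <= `|k| + 1.
  apply: (ib (fun x => c1 x j ord0)) => [|y Cy]; first by rewrite addr_ge0.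
  rewrite (le_trans (sq _)) // lerD2r (le_trans (fro_entry _ _ _)) //.
  rewrite (le_trans _ (ler_norm k)) // (le_trans _ (Qk y Cy)) // /Q.
  by have := V0 y; have := fro_ge0 (c2 y); lra.
have b2 j l x : `|i x * c2 x j l| <= `|k| + 1.
  apply: (ib (fun x => c2 x j l)) => [|y Cy]; first by rewrite addr_ge0.
  rewrite (le_trans (sq _)) // lerD2r (le_trans (fro_entry _ _ _)) //.
  rewrite (le_trans _ (ler_norm k)) // (le_trans _ (Qk y Cy)) // /Q.
  by have := V0 y; have := fro_ge0 (c1 y); lra.
have b0 x : `|i x * fro (b x)| <= `|k|.
  apply: (ib (fun x => fro (b x))) => // y Cy; rewrite ger0_norm ?fro_ge0 //.
  rewrite (le_trans _ (ler_norm k)) // (le_trans _ (Qk y Cy)) // /Q /V.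
  have := fro_ge0 (c1 y); have := fro_ge0 (c2 y).
  have := mulr_ge0 (sqr_ge0 sigma) (fro_ge0 (L y)); lra.
have mh0 : measurable_fun setT (fun x => i x * fro (b x)).
  by apply: measurable_funM => //; exact: measurable_fro.
have mh1 j : measurable_fun setT (fun x => i x * c1 x j ord0) by exact: measurable_funM.
have mh2 j l : measurable_fun setT (fun x => i x * c2 x j l) by exact: measurable_funM.
have m0 := bounded_mean mh0 b0.
have m1 j := bounded_mean (mh1 j) (b1 j).
have m2 (jl : 'I_n * 'I_n) := bounded_mean (mh2 jl.1 jl.2) (b2 jl.1 jl.2).
have e1 j := noise_uncorr_eps model j (mh1 j) (b1 j) (m1 j).
have e2 (jl : 'I_n * 'I_n) := noise_uncorr_eps2 model jl.1 jl.2 (mh2 jl.1 jl.2)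
  (b2 jl.1 jl.2) (m2 jl).
have HZ := meanD (meanD m0 (mean_sum (fun j => meanZ 2 (e1 j)))) (mean_sum e2).
have HV := meanD m0 (meanZ (sigma ^+ 2) (mean_sum (fun j => m2 (j, j)))).
have HZ' : mean P (fun w => \1_(X @^-1` C) w * Z w) (fine (\int[P]_w (i (X w) * fro (b (X w)))%:E) + sigma ^+ 2 * \sum_j fine (\int[P]_w (i (X w) * c2 (X w) j j)%:E)).
  move: HZ; rewrite [X in _ + X + _]big1 => [|j _]; last by rewrite !mulr0.
  rewrite addr0 [X in _ + X](_ : _ = sigma ^+ 2 * \sum_j fine (\int[P]_w (i (X w) * c2 (X w) j j)%:E)).
    apply: eq_mean => w; rewrite Z_expand !mulrDr !mulr_sumr.
    congr (_ + _ + _); apply: eq_bigr => j _; rewrite /i /indic; ring.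
  rewrite -(pair_bigA _ (fun j l => fine (\int[P]_w (i (X w) * c2 (X w) j l)%:E) * (if j == l then sigma ^+ 2 else 0))) /=.
  rewrite mulr_sumr; apply: eq_bigr => j _; rewrite (bigD1 j) //= eqxx big1 ?addr0 1?mulrC // => l lj.
  by rewrite eq_sym (negbTE lj) mulr0.
rewrite HZ'.2 -HV.2; apply: eq_integral => w _; congr (_%:E).
rewrite /V mulrDr; congr (_ + _).
have -> : fro (L (X w)) = \sum_j c2 (X w) j j.
  by rewrite /fro mdot_tr.
rewrite !mulr_sumr; apply: eq_bigr => j _; rewrite /i /indic; ring.
Qed.

(* On [Q <= k] all coefficients are bounded, so [b] and [L] need not be integrable;
   [W <> V] is covered by countably many such sets in the sigma-algebra of [X]. *)
Lemma cond_expectation_risk (W : T -> R) : cond_expectation P (sigma_mx X) Z W ->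
  {ae P, forall w, W w = V (X w)}.
Proof.
move=> [mW EW].
have pre (B : set R) : measurable B -> exists2 C : set (mxT R n p), measurable C & W @^-1` B = X @^-1` C.
  by move=> /mW [C mC <-]; exists C => //; rewrite setTI.
have sigX (C : set (mxT R n p)) : measurable C -> sigma_mx X (X @^-1` C).
  by move=> mC; exists C => //; rewrite setTI.
have mpre (C : set (mxT R n p)) : measurable C -> measurable (X @^-1` C).
  by move=> mC; have := mXT measurableT mC; rewrite setTI.
have mWT : measurable_fun setT W.
  by move=> _ B mB; rewrite setTI; have [C mC ->] := pre B mB; exact: mpre.
have mVX : measurable_fun setT (fun w => V (X w)) by exact: measurableT_comp mV mXT.
have mI (B : set R) f : measurable B -> measurable_fun setT f -> measurable ((f : mxT R n p -> R) @^-1` B).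
  by move=> mB mf; have := mf measurableT _ mB; rewrite setTI.
have bnd k : measurable (Q @^-1` `]-oo, k]) by apply: mI => //; exact: measurable_itv.
have null (C : set (mxT R n p)) (k : R) : measurable C ->
    (\int[P]_(w in X @^-1` (C `&` Q @^-1` `]-oo, k])) (W w)%:E =
     \int[P]_(w in X @^-1` (C `&` Q @^-1` `]-oo, k])) (V (X w))%:E)%E.
  move=> mC; have mC' := measurableI _ _ mC (bnd k).
  rewrite EW; last exact: sigX.
  by apply: (integral_risk mC' (k := k)) => x [_]; rewrite /= in_itv.
have Wk (k : R) : exists2 C : set (mxT R n p), measurable C & W @^-1` `[- k, k] = X @^-1` C.
  by apply: pre; exact: measurable_itv.
have VQ x k : Q x <= k -> `|V x| <= k.
  rewrite ger0_norm //; apply: le_trans.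
  by rewrite /Q; have := fro_ge0 (c1 x); have := fro_ge0 (c2 x); lra.
(* The set W < V has to be a preimage under [X] for [EW] to apply. [W] is not given as a function of
   [X], so the set is written as a union over rationals q of the sets W < q < V. *)
have ltWV : exists2 C : set (mxT R n p), measurable C & [set w | W w < V (X w)] = X @^-1` C.
  have /choice[C HC] (q : rat) : exists C : set (mxT R n p),
      measurable C /\ W @^-1` `]-oo, ratr q[ = X @^-1` C.
    by have [C ? ?] := pre `]-oo, (ratr q : R)[%classic (measurable_itv _); exists C.
  exists (\bigcup_(q : rat) (C q `&` V @^-1` `](ratr q : R), +oo[)).
    apply: bigcupT_measurable_rat => q; apply: measurableI; first by case: (HC q).
    by apply: mI => //; exact: measurable_itv.
  rewrite preimage_bigcup; apply/seteqP; split => w /=.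
    move=> WV; have [q] := rat_in_itvoo WV; rewrite in_itv /= => /andP[h1 h2].
    exists q => //; rewrite preimage_setI -(HC q).2 /=; split => /=; by rewrite in_itv /= ?andbT.
  move=> [q _]; rewrite preimage_setI -(HC q).2 /= !in_itv /= andbT => -[]; exact: lt_trans.
have ltVW : exists2 C : set (mxT R n p), measurable C & [set w | V (X w) < W w] = X @^-1` C.
  have /choice[C HC] (q : rat) : exists C : set (mxT R n p),
      measurable C /\ W @^-1` `](ratr q : R), +oo[ = X @^-1` C.
    by have [C ? ?] := pre `](ratr q : R), +oo[%classic (measurable_itv _); exists C.
  exists (\bigcup_(q : rat) (C q `&` V @^-1` `]-oo, (ratr q : R)[)).
    apply: bigcupT_measurable_rat => q; apply: measurableI; first by case: (HC q).
    by apply: mI => //; exact: measurable_itv.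
  rewrite preimage_bigcup; apply/seteqP; split => w /=.
    move=> WV; have [q] := rat_in_itvoo WV; rewrite in_itv /= => /andP[h1 h2].
    exists q => //; rewrite preimage_setI -(HC q).2 /=; split => /=; by rewrite in_itv /= ?andbT.
  move=> [q _]; rewrite preimage_setI -(HC q).2 /= !in_itv /= andbT => -[h1 h2]; exact: lt_trans h2 h1.
have [Cl mCl El] := ltWV; have [Cg mCg Eg] := ltVW; have [B HB] := choice (fun k : nat => let: ex_intro2 C h1 h2 := Wk k%:R in ex_intro _ C (conj h1 h2)).
(* Both functions are bounded by k on these sets, as [lt_integral_null] requires, and their union
   over k is all of the set in question. *)
pose N k C := X @^-1` (C `&` B k `&` Q @^-1` `]-oo, k%:R]).
have mN k C : measurable C -> measurable (N k C).
  by move=> mC; apply: mpre; apply: measurableI => //; apply: measurableI => //; exact: (HB k).1.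
have Nk k C w : N k C w -> [/\ `|W w| <= k%:R, `|V (X w)| <= k%:R & C (X w)].
  move=> [[h1 h2]]; rewrite /= in_itv /= => /VQ h3; split => //.
  have : (X @^-1` B k) w by [].
  by rewrite -(HB k).2 /= in_itv /= ler_norml.
have Nl k : P (N k Cl) = 0%E.
  apply: (lt_integral_null (mN k _ mCl) mWT mVX (k := k%:R)) => [w Nw|].
    have [h1 h2 h3] := Nk _ _ _ Nw; split => //.
    by have : (X @^-1` Cl) w by []; rewrite -El.
  by apply: null; apply: measurableI => //; exact: (HB k).1.
have Ng k : P (N k Cg) = 0%E.
  apply: (lt_integral_null (mN k _ mCg) mVX mWT (k := k%:R)) => [w Nw|].
    have [h1 h2 h3] := Nk _ _ _ Nw; split => //.
    by have : (X @^-1` Cg) w by []; rewrite -Eg.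
  by apply/esym/null; apply: measurableI => //; exact: (HB k).1.
have neg : P.-negligible (\bigcup_k (N k Cl `|` N k Cg)).
  apply: negligible_bigcup => k; apply: negligibleU.
    by exists (N k Cl); split; [exact: (mN k _ mCl)|exact: Nl|by []].
  by exists (N k Cg); split; [exact: (mN k _ mCg)|exact: Ng|by []].
apply: negligibleS neg => w /= WV.
have [k hk] : exists k : nat, `|Q (X w)| + `|W w| <= k%:R.
  exists (Num.bound (`|Q (X w)| + `|W w|)); apply: ltW.
  by have := archi_boundP (addr_ge0 (normr_ge0 (Q (X w))) (normr_ge0 (W w))).
exists k => //.
have Qk : Q (X w) <= k%:R by have := ler_norm (Q (X w)); have := normr_ge0 (W w); lra.
have Bk : B k (X w).
  have : (W @^-1` `[- k%:R, k%:R]) w.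
    by rewrite /= in_itv /= -ler_norml; have := normr_ge0 (Q (X w)); lra.
  by rewrite (HB k).2.
have : W w != V (X w) by apply/eqP.
rewrite neq_lt => /orP[h|h]; [left|right]; split; rewrite /= ?in_itv //; split => //.
  by have : [set w | W w < V (X w)] w by []; rewrite El.
by have : [set w | V (X w) < W w] w by []; rewrite Eg.
Qed.

End ConditionalRisk.

Section RandomInverse.
Context d (T : measurableType d) (R : realType).

Lemma measurable_det k (Z : T -> 'M[R]_k) : random_mx Z -> measurable_fun setT (fun w => \det (Z w)).
Proof.
move=> mZ; apply: measurable_sum => s; apply: measurable_funM => //.
by apply: measurable_prod => i _; exact: mZ.
Qed.

(* [powR] is known to be measurable but inverts nonnegative reals only, hence [f ^+ 2]. *)
Lemma measurable_invr (f : T -> R) : measurable_fun setT f -> measurable_fun setT (fun w => (f w)^-1).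
Proof.
move=> mf; have -> : (fun w => (f w)^-1) = (fun w => f w * (f w ^+ 2) `^ (-1)).
  apply/funext => w; rewrite powR_inv1 ?sqr_ge0 //.
  have [->|f0] := eqVneq (f w) 0; first by rewrite invr0 mul0r.
  by rewrite expr2 invfM mulVKf.
apply: measurable_funM => //.
by apply: (measurableT_comp (measurable_powR (-1))); exact: measurable_funX.
Qed.

Lemma random_invmx k (Z : T -> 'M[R]_k) : random_mx Z -> (forall w, Z w \in unitmx) ->
  random_mx (fun w => invmx (Z w)).
Proof.
move=> mZ uZ i j; rewrite /invmx; under eq_fun do rewrite uZ !mxE.
apply: measurable_funM; first by apply: measurable_invr; exact: measurable_det.
apply: measurable_funM => //; apply: measurable_det => i' j'.
by under eq_fun do rewrite !mxE; exact: mZ.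
Qed.

End RandomInverse.

Lemma normM_gram (R : realType) m p (H : 'M[R]_(m, p)) (v : 'cV[R]_p) :
  normM (H^T *m H) v ^+ 2 = fro (H *m v).
Proof.
have -> : normM (H^T *m H) v = nF (H *m v).
  by rewrite /normM /nF /fro mdot_tr /mxtrace big_ord1 trmx_mul !mulmxA.
exact: nF_sqr.
Qed.

Section RegularVersion.
Context disp (T : measurableType disp) (R : realType) (P : probability T R).
Variables (n d p : nat) (lam theta : nat -> R) (sigma sigma_x : R).
Variables (X : T -> 'M[R]_(n, p)) (eps : T -> 'cV[R]_n).
Hypothesis model : regression_model P d lam theta sigma sigma_x X eps.
Hypothesis n_gt0 : (0 < n)%N.
Variables (m : nat) (H : 'M[R]_(n, p) -> 'M[R]_(m, p)) (S : T -> 'M[R]_p).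
Hypothesis mH : random_mx (H : mxT R n p -> _).
Hypothesis SE : forall w, S w = (H (X w))^T *m H (X w).
Variable M : R -> T -> R.
Hypothesis mse : is_MSE P S theta X eps M.

Let risk tau w := ridge_risk (H (X w)) (X w) (n%:R * tau) (vseg 0 p theta) (sigma ^+ 2).

Lemma MSE_ridge_risk tau : 0 < tau -> {ae P, forall w, M tau w = risk tau w}.
Proof.
move=> t0; have c0 : 0 < n%:R * tau by rewrite mulr_gt0 // ltr0n.
have mid : random_mx (fun x : mxT R n p => (x : 'M[R]_(n, p))) by exact: random_mx_id.
have mG : random_mx (fun x : mxT R n p => invmx (ridge_gram x (n%:R * tau))).
  apply: random_invmx => [|x]; last exact: ridge_gram_unit.
  apply: random_mxD; last exact: random_mx_cst.
  by apply: random_mxM => //; exact: random_mx_tr.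
have mL : random_mx (fun x : mxT R n p => (x : 'M[R]_(n, p))^T *m invmx (ridge_gram x (n%:R * tau))).
  by apply: random_mxM => //; exact: random_mx_tr.
pose b (x : 'M[R]_(n, p)) := - (H x *m ridge_bias x (n%:R * tau) (vseg 0 p theta)).
pose L (x : 'M[R]_(n, p)) := H x *m (x^T *m invmx (ridge_gram x (n%:R * tau))).
have mb : random_mx (b : mxT R n p -> _).
  apply: random_mxN; apply: random_mxM => //; apply: random_mxD; first exact: random_mx_cst.
  apply: random_mxN; apply: random_mxM; last exact: random_mx_cst.
  by apply: random_mxM.
have mL' : random_mx (L : mxT R n p -> _) by exact: random_mxM.
have := cond_expectation_risk model mb mL' (W := M tau).
have -> : (fun w => fro (b (X w) + L (X w) *m eps w)) = (fun w => normM (S w)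
    (ridge (X w) (response (X w) theta (eps w)) tau - vseg 0 p theta) ^+ 2).
  apply/funext => w; rewrite SE normM_gram /ridge t0 /ridge_pos /response; congr fro.
  rewrite /b /L -mulmxN -mulmxA -mulmxDr; congr (_ *m _).
  rewrite mulmxDr /ridge_bias opprB /ridge_gram !mulmxA.
  by rewrite addrAC.
move=> /(_ (mse.1 tau (ltW t0))); apply: filterS => w ->.
by rewrite /b froN.
Qed.

(** The enumeration of the rationals by [unpickle] turns their null sets into a sequence, hence into
    one null set. *)
Let ae_rat : {ae P, forall w, forall q : rat, 0 < ratr q :> R -> M (ratr q) w = risk (ratr q) w}.
Proof.
have h (k : nat) : {ae P, forall w, if unpickle k is Some q then
    (0 < ratr (q : rat) :> R -> M (ratr q) w = risk (ratr q) w) else True}.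
  case: (unpickle k) => [q|]; last exact: aeW.
  case: (ltP 0 (ratr q : R)) => q0; last by apply: aeW => w.
  by apply: filterS (MSE_ridge_risk q0) => w ->.
apply: filterS (ae_foralln h) => w H' q q0.
by have := H' (pickle q); rewrite pickleK; apply.
Qed.

(** A violation at tau persists, by continuity, at rationals just to the right of tau. These are
    positive even for tau = 0, so the limit that defines the estimator there is never computed. *)
Lemma whp_MSE_ge e (L : T -> R) :
  whp P e (fun w => forall tau, 0 < tau -> L w <= risk tau w) ->
  whp P e (fun w => forall tau, 0 <= tau -> L w <= M tau w).
Proof.
move=> h; have := whp_and h (whp_and (whp_ae ae_rat) (whp_ae mse.2)).
apply: whp_imp; first by rewrite !addr0.
move=> w [h1 [h2 h3]] tau t0; rewrite leNgt; apply/negP => MtL.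
have /subspace_continuousP/(_ tau) := h3.
rewrite /= in_itv /= andbT t0 => /(_ isT).
move=> /(_ [set y | y < L w]) [|].
  by apply: open_nbhs_nbhs; split => //; exact: open_lt.
move=> r /= r0 Hr.
have tr : tau < tau + r by rewrite ltrDl.
have [q] := rat_in_itvoo tr; rewrite in_itv /= => /andP[q1 q2].
have q0 : 0 < ratr q :> R by exact: le_lt_trans q1.
have := Hr (ratr q); rewrite /= in_itv /= andbT (ltW q0) /from_subspace /= => /(_ _ isT) h4.
have : M (ratr q) w < L w by apply: h4; rewrite ltr_norml; lra.
by rewrite h2 // ltNge h1.
Qed.

Lemma whp_optimal_ge e (L : T -> R) :
  whp P e (fun w => forall tau, 0 < tau -> L w <= risk tau w) ->
  whp P e (fun w => L w <= optimal M w).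
Proof.
move=> /whp_MSE_ge; apply: whp_imp => // w h.
apply: lb_le_inf; first by exists (M 0 w), 0 => /=.
by move=> _ [tau /= t0 <-]; exact: h.
Qed.

Lemma optimal_le tau : 0 < tau -> whp P 0 (fun w => optimal M w <= risk tau w).
Proof.
move=> t0.
(* The infimum lies below the values only if these are bounded below, which has to be shown for the
   version [M]; the bound 0 is transferred from the explicit risk. *)
have h : whp P 0 (fun w => forall tau, 0 < tau -> 0 <= risk tau w).
  exists setT; split => //; first by rewrite setCT measure0.
  by move=> w _ ? _; exact: addr_ge0 (fro_ge0 _) (mulr_ge0 (sqr_ge0 _) (fro_ge0 _)).
have := whp_and (whp_MSE_ge h) (whp_ae (MSE_ridge_risk t0)).
apply: whp_imp; first by rewrite addr0.
move=> w [h1 <-]; apply: ge_inf; last by exists tau => //; exact: ltW.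
by exists 0 => _ [t /= ? <-]; exact: h1.
Qed.

End RegularVersion.

(** * Order of the mean squared errors *)

(** The asymptotic hypotheses at one fixed n, with every implicit constant replaced by [K]. The rank
    keeps its own upper constant [K1] because [rg_op] asks [K] to exceed a multiple of 1 + K1. *)
Record regime (R : realType) (n d p : nat) (lam theta : nat -> R)
    (sigma sigma_x K K1 : R) : Prop := Regime {
  rg_n : (0 < n)%N ;
  rg_d : (d <= n)%N ;
  rg_K : 4 <= K ;
  rg_op : 80 * psi sigma_x * (1 + K1) <= K ;
  rg_head : 300 * sigma_x ^+ 2 * Num.sqrt (d%:R / n%:R) < 2^-1 ;
  rg_rank : 2 * n%:R / K <= eff_rank d p lam <= K1 * n%:R ;
  rg_noise : K^-1 <= sigma ^+ 2 <= K ;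
  rg_signal : K^-1 <= normM (invmx (dseg 0 d lam)) (vseg 0 d theta) ^+ 2 * lam d ^+ 2 <= K ;
  rg_tail : normM (dseg d (p - d) lam) (vseg d (p - d) theta) ^+ 2 <=
    K * (lam d.+1 / lam d) ^+ 2 ;
  rg_rho : lam d.+1 / lam d <= K * Num.sqrt (eff_rank d p (fun j => lam j ^+ 2) / n%:R) ;
  rg_small : 8 * K ^+ 2 * (lam d.+1 / lam d) <= 1 }.

Definition fail_prob (R : realType) (n : nat) (sigma_x : R) :=
  9 * expR (- (n%:R / (4096 * psi sigma_x ^+ 2))).

(** Common form of the result for both risks: the tail rate [y] is rho e out of sample and rho in
    sample. The constant [L] in the last clause is free because tau is prescribed only up to
    constants. *)
Definition order_bounds (R : realType) disp (T : measurableType disp) (P : probability T R)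
    n (sigma_x K rho g D y : R) (M : R -> T -> R) :=
  [/\ whp P (fail_prob n sigma_x) (fun w => Num.max y D <= 648 * K ^+ 7 * optimal M w),
      whp P (fail_prob n sigma_x) (fun w => forall tau, 0 <= tau ->
        Num.max y D <= 648 * K ^+ 7 * M tau w) &
      forall tau L, 0 < tau -> K <= L -> rho <= L * (tau / g) ->
        (tau / g) ^+ 2 <= L * y -> y <= L * (tau / g) ^+ 2 ->
        whp P (fail_prob n sigma_x) (fun w =>
          M tau w <= 600 * L ^+ 7 * Num.max y D /\ optimal M w <= 600 * L ^+ 7 * Num.max y D)].

Lemma order_bounds_of_risk (R : realType) disp (T : measurableType disp) (P : probability T R)
    n d p (lam theta : nat -> R) (sigma sigma_x : R) (X : T -> 'M[R]_(n, p)) (eps : T -> 'cV[R]_n)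
    m (H : 'M[R]_(n, p) -> 'M[R]_(m, p)) (S : T -> 'M[R]_p) (M : R -> T -> R)
    (G : T -> Prop) (K rho g D y : R) :
  regression_model P d lam theta sigma sigma_x X eps -> (0 < n)%N ->
  random_mx (H : mxT R n p -> _) -> (forall w, S w = (H (X w))^T *m H (X w)) ->
  is_MSE P S theta X eps M -> 0 < K -> whp P (fail_prob n sigma_x) G ->
  let risk tau w := ridge_risk (H (X w)) (X w) (n%:R * tau) (vseg 0 p theta) (sigma ^+ 2) in
  (forall w tau, G w -> 0 < tau -> Num.max y D <= 648 * K ^+ 7 * risk tau w) ->
  (forall w tau L, G w -> 0 < tau -> K <= L -> rho <= L * (tau / g) ->
     (tau / g) ^+ 2 <= L * y -> y <= L * (tau / g) ^+ 2 ->
     risk tau w <= 600 * L ^+ 7 * Num.max y D) ->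
  order_bounds P n sigma_x K rho g D y M.
Proof.
move=> model n0 mH SE mse K0 whpG risk lower upper.
have cK : 0 < 648 * K ^+ 7 by have := exprn_gt0 7 K0; lra.
have low : whp P (fail_prob n sigma_x) (fun w => forall tau, 0 < tau ->
    Num.max y D / (648 * K ^+ 7) <= risk tau w).
  apply: whp_imp whpG => // w Gw tau t0.
  by rewrite ler_pdivrMr // [leRHS]mulrC; exact: lower.
split.
- have := whp_optimal_ge model n0 mH SE mse low.
  by apply: whp_imp => // w; rewrite ler_pdivrMr // [leRHS]mulrC.
- have := whp_MSE_ge model n0 mH SE mse low.
  by apply: whp_imp => // w h tau t0; have := h tau t0; rewrite ler_pdivrMr // [leRHS]mulrC.
move=> tau L t0 KL h1 h2 h3.
have := whp_and whpG (whp_and (whp_ae (MSE_ridge_risk model n0 mH SE mse t0))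
  (optimal_le model n0 mH SE mse t0)).
apply: whp_imp; first by rewrite !addr0.
move=> w [Gw [-> h4]]; have h := upper w tau L Gw t0 KL h1 h2 h3.
by split => //; exact: le_trans h.
Qed.

Lemma eff_rankE (R : realType) d q (f : nat -> R) :
  eff_rank d (d + q) f = (\sum_(k < q) f (d + k).+1) / f d.+1.
Proof.
rewrite /eff_rank -{1}[d.+1]add0n big_addn subSS addKn big_mkord.
by congr (_ / _); apply: eq_bigr => k _; rewrite addnS addnC.
Qed.

Lemma eff_rank_ge1 (R : realType) d q (f : nat -> R) : (0 < q)%N ->
  (forall k, (k < q)%N -> 0 < f (d + k).+1) -> 1 <= eff_rank d (d + q) f.
Proof.
move=> q0 f0; have := f0 0%N q0; rewrite addn0 => f00.
rewrite eff_rankE ler_pdivlMr // mul1r (bigD1 (Ordinal q0)) //= addn0 lerDl.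
by apply: sumr_ge0 => k _; exact/ltW/f0.
Qed.

Lemma dseg_gram (R : realType) a m (f : nat -> R) : (forall i : 'I_m, 0 <= f (a + i).+1) ->
  dseg a m f = (diag_mx (\row_i Num.sqrt (f (a + i).+1)))^T *m diag_mx (\row_i Num.sqrt (f (a + i).+1)).
Proof.
move=> f0; rewrite tr_diag_mx mulmx_diag /dseg; congr diag_mx.
by apply/rowP => i; rewrite !mxE -expr2 sqr_sqrtr.
Qed.

Lemma invmx_dseg (R : realType) a m (f : nat -> R) : (forall i : 'I_m, 0 < f (a + i).+1) ->
  invmx (dseg a m f) =
  (diag_mx (\row_i (Num.sqrt (f (a + i).+1))^-1))^T *m diag_mx (\row_i (Num.sqrt (f (a + i).+1))^-1).
Proof.
move=> f0; set B := RHS.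
have AB : dseg a m f *m B = 1%:M.
  rewrite /B tr_diag_mx !mulmx_diag -diag_const_mx; congr diag_mx.
  apply/rowP => i; rewrite !mxE -invfM -expr2 sqr_sqrtr ?divff ?gt_eqF //; exact: ltW.
have [uA _] := mulmx1_unit AB.
by rewrite -[LHS]mulmx1 -AB mulKmx.
Qed.

Section FixedSize.
Context disp (T : measurableType disp) (R : realType) (P : probability T R).
Variables (n d q : nat) (lam theta : nat -> R) (sigma sigma_x K K1 : R).
Variables (X : T -> 'M[R]_(n, d + q)) (eps : T -> 'cV[R]_n).
Hypothesis model : regression_model P d lam theta sigma sigma_x X eps.
Hypothesis rg : regime n d (d + q) lam theta sigma sigma_x K K1.

Let l := lam d.+1.
Let g := lam d.
Let rho := l / g.
Let r2 := eff_rank d (d + q) (fun j => lam j ^+ 2).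
Let e := Num.sqrt (r2 / n%:R).
Let D : R := d%:R / n%:R.
Let s : 'rV[R]_d := \row_j Num.sqrt (lam j.+1).
Let s2 : 'rV[R]_q := \row_k Num.sqrt (lam (d + k).+1).
Let th1 := vseg 0 d theta.
Let th2 := vseg d q theta.
Let sg2 := sigma ^+ 2.
Let i0 : 'I_n := Ordinal (rg_n rg).
Let nR : 0 < n%:R :> R. Proof. by rewrite ltr0n (rg_n rg). Qed.
Let d1 : (1 <= d)%N. Proof. by have /andP[] := rm_dim model. Qed.
Let q1 : (1 <= q)%N.
Proof. by have /andP[_] := rm_dim model; rewrite -{1}(addn0 d) ltn_add2l. Qed.
Let lam_gt0 j : (j < d + q)%N -> 0 < lam j.+1.
Proof. by move=> jp; apply: (rm_lam_gt0 model). Qed.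
Let l0 : 0 < l. Proof. by apply: lam_gt0; rewrite -{1}(addn0 d) ltn_add2l. Qed.
Let g0 : 0 < g.
Proof. by apply: (rm_lam_gt0 model) => //; rewrite leq_addr. Qed.
Let K0 : 0 < K. Proof. by have := rg_K rg; lra. Qed.
Let lam2_gt0 (k : 'I_q) : 0 < lam (d + k).+1.
Proof. by apply: lam_gt0; rewrite ltn_add2l. Qed.
Let lam2_le (k : 'I_q) : lam (d + k).+1 <= l.
Proof. by apply: (rm_lam_mono model); rewrite ?ltnS ?leq_addr // ltn_add2l. Qed.

Let sum1E : \sum_(k < q) lam (d + k).+1 = eff_rank d (d + q) lam * l.
Proof. by rewrite eff_rankE divfK // gt_eqF. Qed.

Let r2_bounds : 1 <= r2 <= eff_rank d (d + q) lam.
Proof.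
apply/andP; split.
  by apply: eff_rank_ge1 => // k kq; rewrite exprn_gt0 // lam_gt0 // ltn_add2l.
rewrite /r2 !eff_rankE -/l ler_pdivrMr ?exprn_gt0 // mulr_suml mulr_suml; apply: ler_sum => k _.
rewrite !expr2 mulrA divfK ?gt_eqF // ler_wpM2l //; exact: ltW.
Qed.

Let e_sqr : e ^+ 2 = r2 / n%:R.
Proof.
rewrite sqr_sqrtr //; apply: divr_ge0 (ltW nR).
by have /andP[h _] := r2_bounds; rewrite (le_trans ler01).
Qed.

(** The ratios lambda_j / lambda_(d+1) are at most 1 for j > d, so e^2 is at most r_d(Sigma) / n <=
    K1, and K1 <= K <= K^2. *)
Lemma tail_ratio_bounds : 0 < e <= K.
Proof.
have /andP[h1 h2] := r2_bounds; have /andP[_ h3] := rg_rank rg.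
have K4 := rg_K rg; have p1 := psi_ge1 model i0.
apply/andP; split; first by rewrite sqrtr_gt0 divr_gt0 // (lt_le_trans ltr01).
have K10 : 0 <= K1.
  have : 0 < K1 * n%:R by rewrite (lt_le_trans ltr01) // (le_trans h1) // (le_trans h2).
  by rewrite pmulr_lgt0 // => /ltW.
have K1K : K1 <= K.
  have := rg_op rg; have := ler_wpM2r (addr_ge0 ler01 K10) p1; lra.
have KK : K <= K ^+ 2 by rewrite expr2 ler_peMr ?(ltW K0) //; lra.
rewrite -(@ler_pXn2r _ 2) ?nnegrE ?sqrtr_ge0 ?(ltW K0) // e_sqr.
rewrite ler_pdivrMr // (le_trans h2) // (le_trans h3) // ler_pM2r //.
exact: le_trans KK.
Qed.

Let sum2E : \sum_(k < q) lam (d + k).+1 ^+ 2 = n%:R * l ^+ 2 * e ^+ 2.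
Proof.
rewrite e_sqr /r2 eff_rankE -/l; field; rewrite !gt_eqF //.
Qed.

Lemma regime_params : regular_params n s s2 th1 th2 K l g e sg2.
Proof.
have K4 := rg_K rg; have Kge0 := ltW K0.
have K1' : 1 <= K by lra.
split => //.
- by rewrite d1 (rg_d rg).
- by move=> j; rewrite mxE sqrtr_gt0; apply: lam_gt0; rewrite ltn_addr.
- move=> j; rewrite mxE sqr_sqrtr.
    by apply: (rm_lam_mono model) => //; rewrite leq_addr.
  by apply: ltW; apply: lam_gt0; rewrite ltn_addr.
- by move=> k; rewrite mxE sqr_sqrtr // ltW.
- have := rg_signal rg; rewrite invmx_dseg => [|i]; last first.
    by apply: lam_gt0; rewrite add0n ltn_addr.
  rewrite normM_gram -nF_sqr -exprMn.
  have -> : \row_i (Num.sqrt (lam (0 + i).+1))^-1 = \row_j (s ord0 j)^-1 :> 'rV_d.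
    by apply/rowP => j; rewrite !mxE add0n.
  set y := nF _ * _; have y0 : 0 <= y by rewrite mulr_ge0 ?nF_ge0 // ltW.
  move=> /andP[h1 h2]; apply/andP; split.
    rewrite -(@ler_pXn2r _ 2) ?nnegrE ?invr_ge0 // (le_trans _ h1) //.
    by rewrite expr2 ler_piMr ?invr_ge0 // invf_le1.
  rewrite -(@ler_pXn2r _ 2) ?nnegrE // (le_trans h2) //.
  by rewrite expr2 ler_peMr.
- have := rg_tail rg; rewrite addKn dseg_gram => [|i]; last exact: ltW.
  by rewrite normM_gram.
- exact: rg_noise rg.
- exact: tail_ratio_bounds.
- exact: rg_rho rg.
- exact: rg_small rg.
Qed.

Lemma whp_regime_good_design : whp P (fail_prob n sigma_x)
  (fun w => good_design (lsubmx (Zw lam X w)) (rsubmx (X w)) s2 th2 K l g e).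
Proof.
have /andP[h1 h2] := rg_rank rg; have K4 := rg_K rg.
apply: (whp_good_design model (rg_n rg) regime_params K4 (rg_op rg)).
- by rewrite sum1E mulrAC; apply: ler_wpM2r h1; exact: ltW.
- by rewrite sum1E ler_wpM2r // ltW.
- exact: sum2E.
have sx1 := sigma_x_ge1 model i0.
(* The net of the head needs 18 * 4096 * 4 sigma_x^4 d / n <= 1, where 4 sigma_x^4 = psi^2. The
   product is 294912, and squaring the hypothesis gives 4 * 300^2 = 360000 in its place. *)
have hd : (300 * sigma_x ^+ 2 * Num.sqrt D) ^+ 2 <= 2^-1 ^+ 2.
  have := rg_head rg; rewrite -/D; set y := Num.sqrt D; have y0 : 0 <= y by exact: sqrtr_ge0.
  set z := _ * y => /ltW hz; have z0 : 0 <= z.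
    by rewrite /z; have := mulr_ge0 (sqr_ge0 sigma_x) y0; lra.
  have h0 : 0 <= (2^-1 : R) by rewrite invr_ge0 ler0n.
  exact: (lerXn2r 2 z0 h0 hz).
have D0 : 0 <= D by exact: divr_ge0 (ler0n _ _) (ltW nR).
rewrite exprMn (sqr_sqrtr D0) in hd.
have p2 : 0 < psi sigma_x ^+ 2 by rewrite exprn_gt0 // (lt_le_trans ltr01) // (psi_ge1 model i0).
have -> : d%:R = D * n%:R :> R by rewrite divfK // gt_eqF.
rewrite ler_pdivlMr; last by lra.
have : 18 * D * (4096 * psi sigma_x ^+ 2) <= 1.
  rewrite /psi; have := mulr_ge0 D0 (sqr_ge0 (sigma_x ^+ 2)); lra.
move=> h; have := ler_wpM2r (ltW nR) h; lra.
Qed.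

Variables Mout Min : R -> T -> R.
Hypothesis mse_out : is_MSE_out P lam theta X eps Mout.
Hypothesis mse_in : is_MSE_in P theta X eps Min.

Let Hout (x : 'M[R]_(n, d + q)) : 'M[R]_(d + q) := diag_mx (row_mx s s2).
Let Hin (x : 'M[R]_(n, d + q)) : 'M[R]_(n, d + q) := (Num.sqrt n%:R)^-1 *: x.
Let mHout : random_mx (Hout : mxT R n (d + q) -> _). Proof. exact: random_mx_cst. Qed.
Let mHin : random_mx (Hin : mxT R n (d + q) -> _).
Proof. by apply: random_mxZ; [exact: measurable_cst|exact: random_mx_id]. Qed.

Let SoutE w : (fun=> dseg 0 (d + q) lam) w = (Hout (X w))^T *m Hout (X w).
Proof.
rewrite dseg_gram => [|i]; last by apply: ltW; apply: lam_gt0; rewrite add0n.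
have -> : \row_i Num.sqrt (lam (0 + i).+1) = row_mx s s2; last by [].
apply/rowP => j; case: (split_ordP j) => k ->; rewrite mxE add0n.
  by rewrite row_mxEl mxE.
by rewrite row_mxEr mxE.
Qed.

Let SinE w : n%:R^-1 *: ((X w)^T *m X w) = (Hin (X w))^T *m Hin (X w).
Proof.
rewrite /Hin; set a := (Num.sqrt n%:R)^-1.
have -> : (a *: X w)^T = a *: (X w)^T by apply/matrixP => i j; rewrite !mxE.
rewrite -scalemxAl -scalemxAr scalerA; congr (_ *: _).
by rewrite /a -invfM -expr2 sqr_sqrtr // ltW.
Qed.

Let thE : vseg 0 (d + q) theta = col_mx th1 th2.
Proof.
apply/colP => j; case: (split_ordP j) => k ->; rewrite mxE add0n.
  by rewrite col_mxEu mxE.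
by rewrite col_mxEd mxE.
Qed.

Let XE w : X w = row_mx (lsubmx (Zw lam X w) *m diag_mx s) (rsubmx (X w)).
Proof. by rewrite [in RHS](design_split model) row_mxKr; exact: (design_split model). Qed.

Let rp := regime_params.

Lemma out_order_bounds : order_bounds P n sigma_x K rho g D (rho * e) Mout.
Proof.
apply: (order_bounds_of_risk model (rg_n rg) mHout SoutE mse_out K0 whp_regime_good_design).
  by move=> w tau gd t0; rewrite thE XE; exact: (ridge_risk_out_lower rp gd t0).
by move=> w tau L gd t0 KL h1 h2 h3; rewrite thE XE; exact: (ridge_risk_out_upper rp gd t0 KL).
Qed.

Lemma in_order_bounds : order_bounds P n sigma_x K rho g D rho Min.
Proof.
apply: (order_bounds_of_risk model (rg_n rg) mHin SinE mse_in K0 whp_regime_good_design).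
  by move=> w tau gd t0; rewrite thE XE; exact: (ridge_risk_in_lower rp gd t0).
by move=> w tau L gd t0 KL h1 h2 h3; rewrite thE XE; exact: (ridge_risk_in_upper rp gd t0 KL).
Qed.

End FixedSize.

(** From e^x >= x; [harmonic n] is 1 / (n + 1), and n + 1 <= 2 n doubles the 9 to 18. *)
Lemma fail_prob_le (R : realType) n (sigma_x : R) : 1 <= psi sigma_x -> (0 < n)%N ->
  fail_prob n sigma_x <= 18 * (4096 * psi sigma_x ^+ 2) * harmonic n.
Proof.
move=> p1 n0; set k := psi sigma_x ^+ 2.
have k0 : 0 < 4096 * k by have : 1 <= k by [rewrite exprn_ege1]; lra.
have nR : 1 <= n%:R :> R by rewrite ler1n.
have nR0 : 0 < n%:R :> R by lra.
have n1 : 0 < n.+1%:R :> R by rewrite ltr0n.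
have a0 : 0 < n%:R / (4096 * k) by rewrite divr_gt0.
have h1 : expR (- (n%:R / (4096 * k))) <= 4096 * k / n%:R.
  rewrite expRN -[leRHS]invf_div lef_pV2 ?posrE ?expR_gt0 //.
  by rewrite (le_trans _ (expR_ge1Dx _)) // lerDr.
have h2 : n%:R^-1 <= 2 * n.+1%:R^-1 :> R.
  rewrite -div1r ler_pdivrMr // mulrAC ler_pdivlMr // mul1r -natr1; clear -nR; lra.
rewrite /fail_prob /harmonic -/k /=.
have := ler_wpM2l (ltW k0) h2; move: h1.
move: (4096 * k) (expR _) (n.+1%:R^-1) (n%:R^-1) => c E u v; clear; lra.
Qed.

Lemma lesssim_prob_whp (R : realType) (disp : nat -> measure_display)
    (T : forall n, measurableType (disp n)) (P : forall n, probability (T n) R)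
    (a b : forall n, T n -> R) (c A : R) : 0 < c ->
  (\forall n \near \oo, whp (P n) (A * harmonic n) (fun w => a n w <= c * b n w)) ->
  lesssim_prob P a b.
Proof.
move=> c0 H; exists c => //.
have [N _ HN] := H.
(* [lesssim_prob] wants an event for every [n]; below the threshold the whole space is taken. *)
have HE (n : nat) : {E : set (T n) | measurable E /\ ((N <= n)%N ->
    (P n (~` E) <= (A * harmonic n)%:E)%E /\ forall w, E w -> a n w <= c * b n w)}.
  apply: cid; have [nN|nN] := leqP N n; last by exists setT; split.
  by have [E [mE PE EQ]] := HN n nN; exists E; split.
pose E n := sval (HE n); have mE n : measurable (E n) by exact: (svalP (HE n)).1.
exists E; split => //; last first.
  by exists N => // n nN; exact: ((svalP (HE n)).2 nN).2.
apply: (@squeeze_cvge _ _ _ _ (fun n => (1 - A * harmonic n)%:E) _ (fun=> 1%E)).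
- exists N => // n nN; apply/andP; split; last exact: probability_le1.
  have [h _] := (svalP (HE n)).2 nN; move: h; rewrite -/(E n) => h.
  have -> : P n (E n) = (1 - P n (~` E n))%E by rewrite -probability_setC ?setCK //; exact: measurableC.
  by rewrite EFinB leeB.
- apply: cvg_EFin; first by near=> n.
  rewrite -[X in _ --> X]subr0 -[X in _ - X](mulr0 A).
  by apply: cvgB; [exact: cvg_cst|apply: cvgM; [exact: cvg_cst|exact: cvg_harmonic]].
- exact: cvg_cst.
Unshelve. all: by end_near.
Qed.

(** Turns a window for x^2 / y into the hypotheses on [L] in [order_bounds]. The bound on [rho]
    comes from rho^2 <= K y <= K x^2 / k1. *)
Lemma tuning_window (R : realType) (rho y x K k1 k2 : R) : 0 < rho -> 0 < y -> 0 < x ->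
  1 <= K -> 0 < k1 -> 0 < k2 -> rho ^+ 2 <= K * y -> k1 * y <= x ^+ 2 <= k2 * y ->
  let M := K + k2 + k1^-1 in [/\ K <= M, rho <= M * x, x ^+ 2 <= M * y & y <= M * x ^+ 2].
Proof.
move=> r0 y0 x0 K1 k10 k20 ry /andP[h1 h2] M.
have ik : 0 < k1^-1 by rewrite invr_gt0.
have MK : K <= M by rewrite /M; lra.
have M1 : 1 <= M * k1.
  by rewrite -ler_pdivrMr // div1r /M; lra.
have M0 : 0 < M by lra.
split => //.
- rewrite -(@ler_pXn2r _ 2) ?nnegrE ?(ltW r0) ?(ltW (mulr_gt0 M0 x0)) //.
  rewrite (le_trans ry) // exprMn.
  have e1 := ler_wpM2l (sqr_ge0 M) h1.
  have e2 := ler_wpM2l (mulr_ge0 (ltW M0) (ltW y0)) M1.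
  have e3 := ler_wpM2r (ltW y0) MK; lra.
- by rewrite (le_trans h2) // ler_pM2r // /M; lra.
- have e1 := ler_wpM2l (ltW M0) h1; have e2 := ler_wpM2l (ltW y0) M1; lra.
Qed.

Section AnySize.
Context disp (T : measurableType disp) (R : realType) (P : probability T R).
Variables (n d p : nat) (lam theta : nat -> R) (sigma sigma_x K K1 : R).
Variables (X : T -> 'M[R]_(n, p)) (eps : T -> 'cV[R]_n).
Hypothesis model : regression_model P d lam theta sigma sigma_x X eps.

Let l := lam d.+1.
Let g := lam d.
Let r2 := eff_rank d p (fun j => lam j ^+ 2).
Let e := Num.sqrt (r2 / n%:R).
Let D : R := d%:R / n%:R.

(** The block decomposition needs the number of columns in the form d + q. As the type of [X]
    depends on [p], the equation is substituted rather than rewritten. *)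
Let split_dim : exists q, p = (d + q)%N.
Proof. by have /andP[_ dp] := rm_dim model; exists (p - d)%N; rewrite subnKC // ltnW. Qed.

Lemma model_lam_pos : 0 < l /\ 0 < g.
Proof.
have /andP[d1 dp] := rm_dim model.
by split; apply: (rm_lam_gt0 model) => //; exact: ltnW.
Qed.

Lemma model_eff_rank_ge1 (f : nat -> R) : (forall j, (1 <= j <= p)%N -> 0 < f j) ->
  1 <= eff_rank d p f.
Proof.
move=> f0; have [q pq] := split_dim; have /andP[_ dp] := rm_dim model.
move: dp f0; rewrite pq => dp f0; apply: eff_rank_ge1.
  by move: dp; rewrite -{1}(addn0 d) ltn_add2l.
by move=> k kq; apply: f0; rewrite ltn_add2l.
Qed.

Hypothesis rg : regime n d p lam theta sigma sigma_x K K1.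

Lemma regime_tail_ratio : 0 < e <= K.
Proof.
rewrite /e /r2; clear e r2; have [q pq] := split_dim; subst p.
exact: tail_ratio_bounds model rg.
Qed.

Variables Mout Min : R -> T -> R.

Lemma regime_out : is_MSE_out P lam theta X eps Mout ->
  order_bounds P n sigma_x K (l / g) g D (l / g * e) Mout.
Proof.
rewrite /e /r2; clear e r2; have [q pq] := split_dim; subst p => mse.
exact: out_order_bounds model rg _ mse.
Qed.

Lemma regime_in : is_MSE_in P theta X eps Min ->
  order_bounds P n sigma_x K (l / g) g D (l / g) Min.
Proof.
have [q pq] := split_dim; subst p => mse; exact: in_order_bounds model rg _ mse.
Qed.

End AnySize.

Section Sequence.
Variables (R : realType) (disp : nat -> measure_display)
  (T : forall n, measurableType (disp n)) (P : forall n, probability (T n) R)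
  (d p : nat -> nat) (lam theta : nat -> nat -> R) (sigma : nat -> R)
  (X : forall n, T n -> 'M[R]_(n, p n)) (eps : forall n, T n -> 'cV[R]_n)
  (MSEout MSEin : forall n, R -> T n -> R) (sigma_x delta1 : R).
Hypothesis model : forall n, regression_model (P n) (d n) (lam n) (theta n)
  (sigma n) sigma_x (@X n) (@eps n).

Let l n := lam n (d n).+1.
Let g n := lam n (d n).
Let rho n := l n / g n.
Let r1 n := eff_rank (d n) (p n) (lam n).
Let r2 n := eff_rank (d n) (p n) (fun j => lam n j ^+ 2).
Let e n := Num.sqrt (r2 n / n%:R).
Let D n : R := (d n)%:R / n%:R.
Let sig n := normM (invmx (dseg 0 (d n) (lam n))) (vseg 0 (d n) (theta n)) ^+ 2.

Hypothesis head_small : \forall n \near \oo, (d n <= n)%N /\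
  300 * sigma_x ^+ 2 * Num.sqrt (D n) < 2^-1.
Hypothesis delta1_bounds : 0 < delta1 < 1.
Hypothesis tail_small : \forall n \near \oo,
  normM (dseg (d n) (p n - d n) (lam n)) (vseg (d n) (p n - d n) (theta n)) ^+ 2 / sig n
    <= delta1 / (4 * (1 + sigma_x ^+ 2)) * l n ^+ 2.
Hypothesis noise_order : asymp (fun n => sigma n ^+ 2) (fun=> 1).
Hypothesis signal_order : asymp (fun n => sig n * g n ^+ 2) (fun=> 1).
Hypothesis rank_order : asymp r1 (fun n => n%:R).
Hypothesis rho_le_e : lesssim (fun n => l n * Num.sqrt (n%:R / r2 n)) g.
Hypothesis rho_to0 : dominates g l.

Let l0 n : 0 < l n. Proof. by have [] := model_lam_pos (model n). Qed.
Let g0 n : 0 < g n. Proof. by have [] := model_lam_pos (model n). Qed.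
Let rho0 n : 0 < rho n. Proof. exact: divr_gt0. Qed.
Let lam0 n j : (1 <= j <= p n)%N -> 0 < lam n j.
Proof. by move=> /andP[? ?]; apply: (rm_lam_gt0 (model n)). Qed.
Let r10 n : 1 <= r1 n. Proof. by apply: (model_eff_rank_ge1 (model n)) => j; exact: lam0. Qed.
Let r20 n : 1 <= r2 n.
Proof. by apply: (model_eff_rank_ge1 (model n)) => j hj; rewrite exprn_gt0 // lam0. Qed.
Let psi1 : 1 <= psi sigma_x. Proof. exact: psi_ge1 (model 1%N) ord0. Qed.

Lemma ratio_to0 (a : R) : 0 < a -> \forall n \near \oo, rho n <= a.
Proof.
move=> a0; have h0 : rho @ \oo --> (0 : R) by exact: rho_to0.
by apply: filterS (cvgr_lt _ h0 _ a0) => n /ltW.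
Qed.

Lemma eventually_regime : exists K K1, \forall n \near \oo,
  regime n (d n) (p n) (lam n) (theta n) (sigma n) sigma_x K K1.
Proof.
have [[c1 c10 h1] [c2 c20 h2]] := noise_order.
have [[c3 c30 h3] [c4 c40 h4]] := signal_order.
have [[c5 c50 h5] [c6 c60 h6]] := rank_order.
have [c7 c70 h7] := rho_le_e.
have ps0 : 0 <= 80 * psi sigma_x * (1 + c5).
  by have := psi1 => h; apply: mulr_ge0; lra.
(* A sum of nonnegative terms, so that it dominates each of them. *)
pose K := 4 + c1 + c2 + c3 + c4 + 2 * c6 + c7 + 80 * psi sigma_x * (1 + c5).
have K0 : 0 < K by rewrite /K; lra.
have [K4 K1 K2 K3 K4'] : [/\ 4 <= K, c1 <= K, c2 <= K, c3 <= K & c4 <= K].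
  by rewrite /K; split; lra.
have [K6 K7 K8] : [/\ 2 * c6 <= K, c7 <= K & 80 * psi sigma_x * (1 + c5) <= K].
  by rewrite /K; split; lra.
have inv_le (c y : R) : c <= K -> 0 <= y -> 1 <= c * y -> K^-1 <= y.
  by move=> cK y0 cy; rewrite -div1r ler_pdivrMr // mulrC (le_trans cy) // ler_wpM2r.
have k8 : 0 < 8 * K ^+ 2 by rewrite mulr_gt0 // exprn_gt0.
have dl : delta1 / (4 * (1 + sigma_x ^+ 2)) <= 1.
  have := sqr_ge0 sigma_x; case/andP: delta1_bounds => d0 d1 s2.
  by rewrite ler_pdivrMr; lra.
have e8 : 0 < (8 * K ^+ 2)^-1 by rewrite invr_gt0.
clearbody K.
exists K, c5.
have h8 := ratio_to0 e8.
have h9 : \forall n \near \oo, (0 < n)%N by exists 1%N.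
near=> n.
have n0 : (0 < n)%N by near: n.
have nR : 0 < n%:R :> R by rewrite ltr0n.
have [dn hd] : (d n <= n)%N /\ 300 * sigma_x ^+ 2 * Num.sqrt (D n) < 2^-1 by near: n.
have H1 : sigma n ^+ 2 <= c1 * 1 by near: n.
have H2 : 1 <= c2 * sigma n ^+ 2 by near: n.
have H3 : sig n * g n ^+ 2 <= c3 * 1 by near: n.
have H4 : 1 <= c4 * (sig n * g n ^+ 2) by near: n.
have H5 : r1 n <= c5 * n%:R by near: n.
have H6 : n%:R <= c6 * r1 n by near: n.
have H7 : l n * Num.sqrt (n%:R / r2 n) <= c7 * g n by near: n.
have H8 : rho n <= (8 * K ^+ 2)^-1 by near: n.
have Ht : normM (dseg (d n) (p n - d n) (lam n)) (vseg (d n) (p n - d n) (theta n)) ^+ 2 / sig n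
    <= delta1 / (4 * (1 + sigma_x ^+ 2)) * l n ^+ 2 by near: n.
rewrite mulr1 in H1; rewrite mulr1 in H3.
have s20 := sqr_ge0 (sigma n).
have sg0 : 0 <= sig n * g n ^+ 2 by apply: mulr_ge0 (sqr_ge0 _); exact: sqr_ge0.
split => //.
- apply/andP; split => //; rewrite ler_pdivrMr // -/(r1 n) (le_trans (ler_wpM2l _ H6)) //.
  by rewrite mulrA mulrC ler_wpM2l // (le_trans ler01).
- by rewrite (inv_le c2) //= (le_trans H1).
- by rewrite (inv_le c4) //= (le_trans H3).
(* [signal_order] excludes [sig n = 0], for which the quotient in [tail_small] would be 0 by
   convention and say nothing. It also converts sig l^2 into a multiple of (l / g)^2. *)
- have s0 : 0 < sig n.
    rewrite lt_def sqr_ge0 andbT; apply/eqP => s0; move: H4.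
    by rewrite s0 mul0r mulr0 ler10.
  move: Ht; rewrite ler_pdivrMr // => Ht; apply: (le_trans Ht).
  have ls0 : 0 <= l n ^+ 2 * sig n by apply: mulr_ge0 (sqr_ge0 _) (ltW s0).
  rewrite -(mulrA _ (l n ^+ 2)) (le_trans (ler_wpM2r ls0 dl)) // mul1r.
  have -> : l n ^+ 2 * sig n = (sig n * g n ^+ 2) * (l n / g n) ^+ 2.
    by field; rewrite gt_eqF.
  by apply: ler_wpM2r; [exact: sqr_ge0|exact: le_trans K3].
- rewrite -/(r2 n) -/(e n) -/(rho n).
  have r2p : 0 < r2 n by rewrite (lt_le_trans ltr01).
  have e0 : 0 < e n by rewrite sqrtr_gt0 divr_gt0.
  (* Hence [rho_le_e] says that rho is at most a multiple of e. *)
  have eV : Num.sqrt (n%:R / r2 n) = (e n)^-1.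
    by rewrite -[n%:R / _]invf_div sqrtrV // divr_ge0 // ltW.
  move: H7; rewrite eV ler_pdivrMr // => H7.
  have : rho n <= c7 * e n by rewrite ler_pdivrMr // mulrAC.
  move=> h; apply: le_trans h _; by apply: ler_wpM2r => //; exact: ltW.
- rewrite -/(rho n); move: H8; rewrite -[(_)^-1]div1r ler_pdivlMr //.
  by rewrite mulrC.
Unshelve. all: by end_near.
Qed.

Let lesssim_fail (a b : forall n, T n -> R) (m c : R) : 0 <= m -> 0 < c ->
  (\forall n \near \oo, whp (P n) (m * fail_prob n sigma_x) (fun w => a n w <= c * b n w)) ->
  lesssim_prob P a b.
Proof.
move=> m0 c0 H; apply: (lesssim_prob_whp (A := m * (18 * (4096 * psi sigma_x ^+ 2))) c0).
have h9 : \forall n \near \oo, (0 < n)%N by exists 1%N.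
near=> n; have n0 : (0 < n)%N by near: n.
have : whp (P n) (m * fail_prob n sigma_x) (fun w => a n w <= c * b n w) by near: n.
by apply: whp_imp => //; rewrite -mulrA ler_wpM2l // fail_prob_le.
Unshelve. all: by end_near.
Qed.

Section Rate.
Variables (M : forall n, R -> T n -> R) (y : nat -> R) (K : R).
Hypothesis K1 : 1 <= K.
Hypothesis y_gt0 : \forall n \near \oo, 0 < y n.
Hypothesis rho_y : \forall n \near \oo, rho n ^+ 2 <= K * y n.
Hypothesis bounds : \forall n \near \oo,
  order_bounds (P n) n sigma_x K (rho n) (g n) (D n) (y n) (@M n).

Let cK : 0 < 648 * K ^+ 7.
Proof. by have := exprn_gt0 7 (lt_le_trans ltr01 K1); lra. Qed.

Let cM k1 k2 : 0 < k1 -> 0 < k2 -> 0 < 600 * (K + k2 + k1^-1) ^+ 7.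
Proof.
move=> k10 k20; have ik : 0 < k1^-1 by rewrite invr_gt0.
have M0 : 0 < K + k2 + k1^-1 by have := K1; lra.
by have := exprn_gt0 7 M0; lra.
Qed.

(** The balance of squared bias, (tau / lambda_d)^2, and tail variance, up to constants: both risks
    have their optimum where this square is of order [y]. *)
Definition tuned (k1 k2 : R) (tau : nat -> R) := \forall n \near \oo,
  0 < tau n /\ k1 * y n <= (tau n / g n) ^+ 2 <= k2 * y n.

Let tuned_upper k1 k2 tau : 0 < k1 -> 0 < k2 -> tuned k1 k2 tau ->
  \forall n \near \oo, whp (P n) (1 * fail_prob n sigma_x) (fun w =>
    @M n (tau n) w <= 600 * (K + k2 + k1^-1) ^+ 7 * Num.max (y n) (D n) /\
    optimal (@M n) w <= 600 * (K + k2 + k1^-1) ^+ 7 * Num.max (y n) (D n)).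
Proof.
move=> k10 k20 Ht; near=> n.
have [t0 th] : 0 < tau n /\ k1 * y n <= (tau n / g n) ^+ 2 <= k2 * y n by near: n.
have y0 : 0 < y n by near: n.
have ry : rho n ^+ 2 <= K * y n by near: n.
have [_ _ H] : order_bounds (P n) n sigma_x K (rho n) (g n) (D n) (y n) (@M n) by near: n.
have [h1 h2 h3 h4] := tuning_window (rho0 n) y0 (divr_gt0 t0 (g0 n)) K1 k10 k20 ry th.
by rewrite mul1r; exact: H.
Unshelve. all: by end_near.
Qed.

Let gK n z : g n * z / g n = z.
Proof. by rewrite mulrAC divff ?mul1r // (gt_eqF (g0 n)). Qed.

Lemma optimal_upper : exists2 c, 0 < c & \forall n \near \oo,
  whp (P n) (1 * fail_prob n sigma_x) (fun w => optimal (@M n) w <= c * Num.max (y n) (D n)).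
Proof.
exists (600 * (K + 1 + 1^-1) ^+ 7); first exact: cM.
(* With tau = g sqrt y the square (tau / g)^2 is exactly y. *)
apply: filterS (@tuned_upper 1 1 (fun n => g n * Num.sqrt (y n)) ltr01 ltr01 _) => [n|].
  by apply: whp_imp => // w [].
apply: filterS y_gt0 => n y0; split; first by rewrite mulr_gt0 // sqrtr_gt0.
by rewrite gK mul1r (sqr_sqrtr (ltW y0)) lexx.
Qed.

Lemma optimal_lower : exists2 c, 0 < c & \forall n \near \oo,
  whp (P n) (1 * fail_prob n sigma_x) (fun w => Num.max (y n) (D n) <= c * optimal (@M n) w).
Proof.
by exists (648 * K ^+ 7) => //; apply: filterS bounds => n []; rewrite mul1r.
Qed.

Lemma optimal_order : asymp_prob P (fun n => optimal (@M n)) (fun n _ => Num.max (y n) (D n)).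
Proof.
have [c c0 hc] := optimal_upper; have [c' c'0 hc'] := optimal_lower.
by split; [exact: (lesssim_fail ler01 c0 hc)|exact: (lesssim_fail ler01 c'0 hc')].
Qed.

Lemma tuned_order k1 k2 tau : 0 < k1 -> 0 < k2 -> tuned k1 k2 tau ->
  asymp_prob P (fun n => @M n (tau n)) (fun n _ => Num.max (y n) (D n)).
Proof.
move=> k10 k20 Ht; split.
  apply: (lesssim_fail ler01 (cM k10 k20)); apply: filterS (tuned_upper k10 k20 Ht) => n.
  by apply: whp_imp => // w [].
apply: (lesssim_fail ler01 cK); apply: filterS2 bounds Ht => n [_ h _] [t0 _].
by rewrite mul1r; apply: whp_imp h => // w; apply; exact: ltW.
Qed.

End Rate.

Lemma optimal_le_optimal (M M' : forall n, R -> T n -> R) (y y' : nat -> R) (K K' c : R) :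
  1 <= K -> 1 <= K' -> 1 <= c ->
  (\forall n \near \oo, 0 < y n) -> (\forall n \near \oo, rho n ^+ 2 <= K * y n) ->
  (\forall n \near \oo, order_bounds (P n) n sigma_x K (rho n) (g n) (D n) (y n) (@M n)) ->
  (\forall n \near \oo, order_bounds (P n) n sigma_x K' (rho n) (g n) (D n) (y' n) (@M' n)) ->
  (\forall n \near \oo, y n <= c * y' n) ->
  lesssim_prob P (fun n => optimal (@M n)) (fun n => optimal (@M' n)).
Proof.
move=> K1 K'1 c1 y0 ry B B' yy.
have [a a0 ha] := optimal_upper K1 y0 ry B; have [b b0 hb] := optimal_lower K'1 B'.
have c0 := lt_le_trans ltr01 c1.
(* The two bounds hold on different events, hence twice the failure probability. *)
apply: (lesssim_fail (ler0n _ 2) (mulr_gt0 a0 (mulr_gt0 c0 b0))).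
apply: filterS3 ha hb yy => n H1 H2 yn.
have := whp_and H1 H2; apply: whp_imp; first by rewrite -mulrDl.
move=> w [h1 h2]; apply: (le_trans h1); rewrite -(mulrA a); apply: ler_wpM2l; first exact: ltW.
rewrite -(mulrA c); apply: (@le_trans _ _ (c * Num.max (y' n) (D n))); last first.
  by apply: ler_wpM2l h2; exact: ltW.
have D0 : 0 <= D n by exact: divr_ge0 (ler0n _ _) (ler0n _ _).
rewrite ge_max (le_trans yn) /=; last by rewrite ler_wpM2l ?(ltW c0) // le_max lexx.
have m2 : D n <= Num.max (y' n) (D n) by rewrite le_max lexx orbT.
by rewrite (le_trans m2) // ler_peMl // (le_trans D0).
Qed.

End Sequence.

Theorem corollary3 (R : realType) :
  exists2 C0 : R, 0 < C0 &
  forall (disp : nat -> measure_display)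
    (T : forall n, measurableType (disp n))
    (P : forall n, probability (T n) R)
    (d p : nat -> nat) (lam theta : nat -> nat -> R) (sigma : nat -> R)
    (X : forall n, T n -> 'M[R]_(n, p n)) (eps : forall n, T n -> 'cV[R]_n)
    (MSEout MSEin : forall n, R -> T n -> R)
    (sigma_x C1 delta1 A0 : R),
  (forall n, regression_model (P n) (d n) (lam n) (theta n)
               (sigma n) sigma_x (X n) (eps n)) ->
  (forall n, is_MSE_out (P n) (lam n) (theta n) (X n) (eps n) (MSEout n)) ->
  (forall n, is_MSE_in (P n) (theta n) (X n) (eps n) (MSEin n)) ->
  (\forall n \near \oo, (d n <= n)%N /\
     C0 * sigma_x ^+ 2 * Num.sqrt ((d n)%:R / n%:R) < 2^-1) ->
  0 < C1 ->
  (\forall n \near \oo, eff_rank (d n) (p n) (lam n) / n%:R <= C1) ->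
  0 < delta1 < 1 ->
  (\forall n \near \oo,
     normM (dseg (d n) (p n - d n) (lam n))
           (vseg (d n) (p n - d n) (theta n)) ^+ 2 /
     normM (invmx (dseg 0 (d n) (lam n))) (vseg 0 (d n) (theta n)) ^+ 2
     <= delta1 / (4 * (1 + sigma_x ^+ 2)) * lam n (d n).+1 ^+ 2) ->
  1 <= A0 ->
  (1 + A0) ^+ 2 < 4 * delta1^-1 ->
  asymp (fun n => sigma n ^+ 2) (fun=> 1) ->
  asymp (fun n =>
           normM (invmx (dseg 0 (d n) (lam n))) (vseg 0 (d n) (theta n)) ^+ 2
           * lam n (d n) ^+ 2)
        (fun=> 1) ->
  asymp (fun n => eff_rank (d n) (p n) (lam n)) (fun n => n%:R) ->
  lesssim (fun n => lam n (d n).+1 *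
             Num.sqrt (n%:R / eff_rank (d n) (p n) (fun j => lam n j ^+ 2)))
          (fun n => lam n (d n)) ->
  dominates (fun n => lam n (d n)) (fun n => lam n (d n).+1) ->
  64 * (Num.sqrt delta1 / (1 - Num.sqrt delta1)) < 1 ->
  [/\ (asymp_prob P (fun n => optimal (MSEout n))
         (fun n _ => Num.max
            (lam n (d n).+1 / lam n (d n) *
             Num.sqrt (eff_rank (d n) (p n) (fun j => lam n j ^+ 2) / n%:R))
            ((d n)%:R / n%:R)) /\
       forall c : R,
         (\forall n \near \oo,
            lam n (d n).+1 *
            Num.sqrt (n%:R / eff_rank (d n) (p n) (fun j => lam n j ^+ 2))
            <= c * lam n (d n)) ->
         asymp_prob P
           (fun n => MSEout n
              (Num.sqrt (lam n (d n) * lam n (d n).+1 *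
                 Num.sqrt (eff_rank (d n) (p n) (fun j => lam n j ^+ 2)
                           / n%:R)) *
               Num.min
                 (Num.sqrt (c * A0 ^- 2))
                 (A0 * lam n (d n) /
                  Num.sqrt (lam n (d n) * lam n (d n).+1 *
                    Num.sqrt (eff_rank (d n) (p n) (fun j => lam n j ^+ 2)
                              / n%:R)))))
           (fun n _ => Num.max
              (lam n (d n).+1 / lam n (d n) *
               Num.sqrt (eff_rank (d n) (p n) (fun j => lam n j ^+ 2) / n%:R))
              ((d n)%:R / n%:R))),
      (asymp_prob P (fun n => optimal (MSEin n))
         (fun n _ => Num.max (lam n (d n).+1 / lam n (d n))
                             ((d n)%:R / n%:R)) /\
       forall tau : nat -> R, (forall n, 0 < tau n) ->
         asymp tau (fun n => Num.sqrt (lam n (d n).+1 * lam n (d n))) ->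
         asymp_prob P (fun n => MSEin n (tau n))
           (fun n _ => Num.max (lam n (d n).+1 / lam n (d n))
                               ((d n)%:R / n%:R))) &
      lesssim_prob P (fun n => optimal (MSEout n))
                     (fun n => optimal (MSEin n))].

Proof.
have C0 : 0 < 300 :> R by rewrite ltr0n.
exists 300 => // disp T P d p lam theta sigma X eps MSEout MSEin sigma_x C1 delta1 A0.
move=> model mse_out mse_in head _ _ delta tail A1 _ noise signal rank le_e to0 _.
have [K [K1 rg]] := eventually_regime model head delta tail noise signal rank le_e to0.
have small := ratio_to0 to0.
have h9 : \forall n \near \oo, (0 < n)%N by exists 1%N.
have A00 : 0 < A0 by lra.
have K4 : 4 <= K by have [N _ HN] := rg; exact: rg_K (HN N (leqnn N)).
have K0 : 0 < K by lra.
have K1' : 1 <= K by lra.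
pose rho n := lam n (d n).+1 / lam n (d n).
pose r2 n := eff_rank (d n) (p n) (fun j => lam n j ^+ 2).
pose e n := Num.sqrt (r2 n / n%:R).
have lg n : 0 < lam n (d n).+1 /\ 0 < lam n (d n) by exact: model_lam_pos (model n).
have rho0 n : 0 < rho n by rewrite divr_gt0; case: (lg n).
have tr : \forall n \near \oo, 0 < e n <= K.
  by apply: filterS rg => n rgn; exact: regime_tail_ratio (model n) rgn.
have y0 : \forall n \near \oo, 0 < rho n * e n.
  by apply: filterS tr => n /andP[en _]; rewrite mulr_gt0.
have ry : \forall n \near \oo, rho n ^+ 2 <= K * (rho n * e n).
  apply: filterS rg => n rgn; rewrite mulrCA expr2.
  by apply: ler_wpM2l (rg_rho rgn); exact: ltW.
have rr : \forall n \near \oo, rho n ^+ 2 <= K * rho n.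
  apply: filterS (small _ ltr01) => n rn.
  by rewrite expr2 ler_wpM2r ?(ltW (rho0 n)) // (le_trans rn).
have B_out : \forall n \near \oo, order_bounds (P n) n sigma_x K (rho n) (lam n (d n))
    ((d n)%:R / n%:R) (rho n * e n) (MSEout n).
  by apply: filterS rg => n rgn; have := regime_out (model n) rgn (mse_out n).
have B_in : \forall n \near \oo, order_bounds (P n) n sigma_x K (rho n) (lam n (d n))
    ((d n)%:R / n%:R) (rho n) (MSEin n).
  by apply: filterS rg => n rgn; have := regime_in (model n) rgn (mse_in n).
split.
- have Hout := optimal_order model K1' y0 ry B_out.
  split => [|c hc]; first exact: Hout.
  pose k := c * A0 ^- 2.
  (* The inequality assumed of [c] has a positive left side, so it forces [c] to be positive. *)
  have c0 : 0 < c.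
    have [N _ HN] := filterI hc h9.
    have [hN N0] := HN N (leqnn N); have [l0 g0] := lg N.
    have r20 : 0 < eff_rank (d N) (p N) (fun j => lam N j ^+ 2).
      rewrite (lt_le_trans ltr01) // (model_eff_rank_ge1 (model N)) // => j /andP[j1 jp].
      by rewrite exprn_gt0 // (rm_lam_gt0 (model N)).
    rewrite -(pmulr_lgt0 _ g0) (lt_le_trans _ hN) // mulr_gt0 // sqrtr_gt0 divr_gt0 //.
    by rewrite ltr0n.
  have k0 : 0 < k by rewrite divr_gt0 // exprn_gt0.
  apply: (tuned_order model K1' y0 ry B_out k0 k0).
  (* Since rho tends to 0, eventually rho K k <= 1; this decides the minimum in the prescribed
     tau. *)
  have a0 : 0 < (K * k)^-1 by rewrite invr_gt0 mulr_gt0.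
  apply: filterS2 tr (small _ a0) => n /andP[e0 eK] hn.
  have [l0 g0] := lg n.
  set l := lam n (d n).+1 in l0 hn *; set g := lam n (d n) in g0 hn *.
  rewrite -/(r2 n) -/(e n) /rho -/l -/g; move: (e n) e0 eK => f e0 eK.
  have u0 : 0 < g * l * f by rewrite !mulr_gt0.
  set u := Num.sqrt (g * l * f); have us : 0 < u by rewrite sqrtr_gt0.
  have u2 : u ^+ 2 = g * l * f by rewrite sqr_sqrtr // ltW.
  have ks : Num.sqrt k ^+ 2 = k by rewrite sqr_sqrtr // ltW.
  have gl : l = l / g * g by rewrite divfK // gt_eqF.
  have hk : l / g * f * k <= 1.
    have r0 : 0 <= l / g by rewrite divr_ge0 // ltW.
    have h1 := ler_wpM2r (ltW k0) (ler_wpM2l r0 eK).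
    have h2 := ler_wpM2r (ltW (mulr_gt0 K0 k0)) hn.
    rewrite mulVf ?(gt_eqF (mulr_gt0 K0 k0)) // in h2.
    by rewrite (le_trans h1) // -mulrA.
  (* Squared, the claim is k rho e <= A0^2. With the minimum resolved, (tau / lambda_d)^2 equals k
     rho e, so the window has both constants equal to [k]. *)
  have -> : Num.min (Num.sqrt k) (A0 * g / u) = Num.sqrt k.
    apply/min_idPl; rewrite ler_pdivlMr // -(@ler_pXn2r _ 2) ?nnegrE ?mulr_ge0 ?sqrtr_ge0 ?(ltW A00) ?(ltW g0) //.
    rewrite exprMn ks u2 exprMn.
    have AA : 1 <= A0 ^+ 2 by rewrite exprn_ege1.
    have g2 := sqr_ge0 g; have h1 := ler_wpM2r g2 hk; have h2 := ler_wpM2r g2 AA.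
    have -> : k * (g * l * f) = l / g * f * k * g ^+ 2 by field; rewrite gt_eqF.
    lra.
  split; first by rewrite mulr_gt0 // sqrtr_gt0.
  have -> : (u * Num.sqrt k / g) ^+ 2 = k * (l / g * f).
    rewrite expr_div_n exprMn ks u2; field; by rewrite gt_eqF.
  by rewrite lexx.
- have Hin := optimal_order model K1' (nearW _ rho0) rr B_in.
  split => [|tau tau0]; first exact: Hin.
  move=> [[c1 c10 h1] [c2 c20 h2]].
  (* tau of order sqrt (l g) means (tau / g)^2 of order l / g = rho; the constants of [asymp] enter
     squared. *)
  have k10 : 0 < (c2 ^+ 2)^-1 by rewrite invr_gt0 exprn_gt0.
  apply: (tuned_order model K1' (nearW _ rho0) rr B_in k10 (exprn_gt0 2 c10)).
  apply: filterS2 h1 h2 => n h1 h2; split => //.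
  have [l0 g0] := lg n; have t0 := tau0 n.
  set l := lam n (d n).+1 in l0 h1 h2 *; set g := lam n (d n) in g0 h1 h2 *.
  have lg0 : 0 <= l * g by rewrite mulr_ge0 // ltW.
  set u := Num.sqrt (l * g) in h1 h2; have us : 0 <= u by exact: sqrtr_ge0.
  have u2 : u ^+ 2 = l / g * g ^+ 2 by rewrite sqr_sqrtr // expr2 mulrA divfK // gt_eqF.
  have gg : 0 < g ^+ 2 by rewrite exprn_gt0.
  have H1 : tau n ^+ 2 <= c1 ^+ 2 * u ^+ 2.
    by rewrite -exprMn lerXn2r ?nnegrE ?mulr_ge0 ?(ltW c10) ?(ltW t0).
  have H2 : u ^+ 2 <= c2 ^+ 2 * tau n ^+ 2.
    by rewrite -exprMn lerXn2r ?nnegrE ?mulr_ge0 ?(ltW c20) ?(ltW t0).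
  rewrite expr_div_n ler_pdivlMr // ler_pdivrMr // -!(mulrA _ (l / g)) -u2.
  by rewrite ler_pdivrMl ?exprn_gt0 // H2 H1.
(* The two rates compare because [e <= K], so that rho e <= K rho. *)
- apply: (optimal_le_optimal model K1' K1' K1' y0 ry B_out B_in).
  by apply: filterS tr => n /andP[_ eK]; rewrite mulrC ler_wpM2r // ltW.
Qed.
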